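(* For $i=0,1,\dots,k$ let $\mu_i$ be a probability measure on $([0,1],\mathcal{B})$ and $T_i:[0,1]\to[0,1]$ a $\mu_i$-preserving ergodic transformation such that (1) for each $i$ there is a partition $\mathcal{A}_i$ with $(T_i,\mu_i,\mathcal{A}_i)\in\mathcal{T}$; (2) for $i=1,\dots,k$, $(T_i,\mu_i,\mathcal{A}_i)$ is $\alpha$-mixing. Let $h(T_i)<\infty$ be the entropy of $T_i$ and for each $i$ let $(a_n^{(i)})_n$ be an increasing sequence of natural numbers. Assume there is $\epsilon_0>0$ such that for $i=0,\dots,k-1$, $\lim_{n\to\infty}\big(a_n^{(i+1)}(h(T_{i+1})-\epsilon_0)-a_n^{(i)}(h(T_i)+\epsilon_0)\big)=\infty$. If $T_0$ is strongly mixing, then for every probability measure $\nu$ equivalent to Lebesgue measure $\lambda$ and all $B,A_0,\dots,A_k\in\mathcal{B}$, $\lim_{n\to\infty}\nu(B\cap T_0^{-a_n^{(0)}}A_0\cap T_1^{-a_n^{(1)}}A_1\cap\cdots\cap T_k^{-a_n^{(k)}}A_k)=\nu(B)\prod_{i=0}^k\mu_i(A_i)$.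
   Context: Let $X=[0,1]$, $\mathcal{B}$ Borel, $\lambda$ Lebesgue. A partition of $[0,1]$ is a finite or countable family of intervals with nonempty pairwise disjoint interiors covering $[0,1]$ up to a $\lambda$-null set. The class $\mathcal{T}$ consists of triples $(T,\mu,\mathcal{A})$ where $\mu$ is a Borel probability measure with $\frac1c\mu\le\lambda\le c\mu$ for some $c\ge1$, $T:[0,1]\to[0,1]$ is $\mu$-preserving and ergodic, and $\mathcal{A}$ is a partition such that $T|_{\mathrm{int}(I)}$ is continuous and strictly monotone for each $I\in\mathcal{A}$, $\bigvee_{j\ge0}T^{-j}\sigma(\mathcal{A})=\mathcal{B}$ mod $\lambda$, and $-\sum_{I\in\mathcal{A}}\mu(I)\log\mu(I)<\infty$. Write $\mathcal{A}^l=\bigvee_{j=0}^{l-1}T^{-j}\mathcal{A}$. $(T,\mu,\mathcal{A})\in\mathcal{T}$ is $\alpha$-mixing if there are nonnegative reals $\alpha(n)\to0$ such that for every $l\in\mathbb{N}$, integer $n\ge0$, $A\in\sigma(\mathcal{A}^l)$, $B\in\mathcal{B}$: $|\mu(A\cap T^{-(n+l)}B)-\mu(A)\mu(B)|\le\alpha(n)$. *)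

(* Defs.v *)
(* The space [0,1] is modelled inside R : realType
   (with its Borel sigma-algebra, measurableTypeR R); all sets of interest are
   subsets of I01 = `[0,1], and T^{-j} A is read as I01 `&` (iter j T) @^-1` A. *)
From mathcomp Require Import all_boot all_algebra all_classical all_reals all_analysis.
Import Num.Theory GRing.Theory numFieldNormedType.Exports.
Set Implicit Arguments. Unset Strict Implicit. Unset Printing Implicit Defensive.
Local Open Scope classical_set_scope. Local Open Scope ring_scope.

Section Defs.
Variable R : realType.
Local Notation mR := (measurableTypeR R).
Local Notation lambda := (@lebesgue_measure R).

Definition borel (A : set R) : Prop := @measurable _ mR A.

Definition I01 : set R := `[0, 1]%classic.

Definition iterpre (T : R -> R) (j : nat) (A : set R) : set R :=
  I01 `&` (iter j T) @^-1` A.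

(* x |-> - x log x, applied to a measure value (0 log 0 = 0 since ln 0 = 0) *)
Definition ent (x : \bar R) : R := - (fine x * ln (fine x)).

Definition prob01 (mu : probability mR R) : Prop := mu I01 = 1%E.

Definition measure_preserving (T : R -> R) (mu : probability mR R) : Prop :=
  (forall x, I01 x -> I01 (T x)) /\ measurable_fun (I01 : set mR) (T : mR -> mR) /\
  forall A, borel A -> A `<=` I01 -> mu (iterpre T 1 A) = mu A.

Definition ergodic (T : R -> R) (mu : probability mR R) : Prop :=
  forall A, borel A -> A `<=` I01 -> iterpre T 1 A = A -> mu A = 0%E \/ mu A = 1%E.

Definition strongly_mixing (T : R -> R) (mu : probability mR R) : Prop :=
  forall A B, borel A -> A `<=` I01 -> borel B -> B `<=` I01 ->
    (fun n => fine (mu (A `&` iterpre T n B))) @ \oo --> fine (mu A) * fine (mu B).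

Definition equiv_lebesgue (nu : probability mR R) : Prop :=
  prob01 nu /\ forall A, borel A -> A `<=` I01 -> (nu A = 0%E <-> lambda A = 0%E).

(* a finite or countable family (indexed by J, a subset of nat) of intervals
   I n with endpoints pa n < pb n (so  ]pa n, pb n[ <= I n <= [pa n, pb n]) *)
Record ipart := IPart { pJ : set nat; pa : nat -> R; pb : nat -> R; pI : nat -> set R }.

Definition is_ipart (P : ipart) : Prop :=
  (forall n, pJ P n ->
     0 <= pa P n /\ pa P n < pb P n /\ pb P n <= 1 /\
     `](pa P n), (pb P n)[%classic `<=` pI P n /\ pI P n `<=` `[(pa P n), (pb P n)]%classic) /\
  (forall n m, pJ P n -> pJ P m -> n <> m ->
     `](pa P n), (pb P n)[%classic `&` `](pa P m), (pb P m)[%classic = set0) /\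
  lambda (I01 `\` \bigcup_(n in pJ P) pI P n) = 0%E.

(* generators of sigma(A^l) = sigma(\/_{j<l} T^{-j} A) *)
Definition gens_upto (T : R -> R) (P : ipart) (l : nat) : set (set R) :=
  [set G | exists j n, (j < l)%N /\ pJ P n /\ G = iterpre T j (pI P n)].
(* generators of \/_{j>=0} T^{-j} sigma(A) *)
Definition gens_all (T : R -> R) (P : ipart) : set (set R) :=
  [set G | exists j n, pJ P n /\ G = iterpre T j (pI P n)].

Definition classT (T : R -> R) (mu : probability mR R) (P : ipart) : Prop :=
  prob01 mu /\
  (exists c : R, 1 <= c /\ forall A, borel A -> A `<=` I01 ->
      ((c^-1)%:E * mu A <= lambda A)%E /\ (lambda A <= c%:E * mu A)%E) /\
  measure_preserving T mu /\ ergodic T mu /\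
  is_ipart P /\
  (forall n, pJ P n ->
     {within `](pa P n), (pb P n)[, continuous T} /\
     ((forall x y, `](pa P n), (pb P n)[%classic x -> `](pa P n), (pb P n)[%classic y ->
         x < y -> T x < T y) \/
      (forall x y, `](pa P n), (pb P n)[%classic x -> `](pa P n), (pb P n)[%classic y ->
         x < y -> T y < T x))) /\
  (forall B, borel B -> B `<=` I01 -> exists G, <<s I01, gens_all T P >> G /\
      lambda ((B `\` G) `|` (G `\` B)) = 0%E) /\
  (\esum_(n in pJ P) (ent (mu (pI P n)))%:E < +oo)%E.

Definition alpha_mixing (T : R -> R) (mu : probability mR R) (P : ipart) : Prop :=
  exists alpha : nat -> R, (forall n, 0 <= alpha n) /\ alpha @ \oo --> 0 /\
  forall (l n : nat) (A B : set R), <<s I01, gens_upto T P l >> A ->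
    borel B -> B `<=` I01 ->
    `| fine (mu (A `&` iterpre T (n + l) B)) - fine (mu A) * fine (mu B) | <= alpha n.

Definition is_fpart (m : nat) (Q : 'I_m -> set R) : Prop :=
  (forall i, borel (Q i) /\ Q i `<=` I01) /\
  (forall i j, i != j -> Q i `&` Q j = set0) /\
  \bigcup_(i in [set: 'I_m]) Q i = I01.

Definition Hent (F : finType) (Q : F -> set R) (mu : probability mR R) : R :=
  \sum_(w : F) ent (mu (Q w)).

(* cells of Q^n = \/_{j<n} T^{-j} Q, indexed by words w *)
Definition cell (T : R -> R) (m n : nat) (Q : 'I_m -> set R)
  (w : {ffun 'I_n -> 'I_m}) : set R :=
  [set x | I01 x /\ forall j : 'I_n, Q (w j) (iter j T x)].

Definition hpart (T : R -> R) (mu : probability mR R) (m : nat) (Q : 'I_m -> set R) : R :=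
  limn (fun n : nat => Hent (@cell T m n.+1 Q) mu / n.+1%:R).

Definition KS_entropy (T : R -> R) (mu : probability mR R) : \bar R :=
  ereal_sup [set x | exists m (Q : 'I_m -> set R), is_fpart Q /\ x = (hpart T mu Q)%:E].

End Defs.
Arguments I01 {R}.

(* Main.v *)
(** The cells of [\/_{j < N} T_i^{-j} A_i] have, up to a set of small measure, measure
    [exp (- N (h(T_i) +- eps))] (Shannon-McMillan, in probability), and up to null sets they are
    intervals on which [T_i^N] is monotone.  Hence [T_i^{-a_i(n)} A_i] is, up to small measure, a
    union of at most [K exp (a_i(n) (h(T_i) + eps))] intervals.  Each interval is split by at most
    two cells of length [a_{i+1}(n) - m] of a later map, and these have measure at most
    [exp (- (a_{i+1}(n) - m) (h(T_{i+1}) - eps))]; by the growth hypothesis the total error vanishes.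
    So the event [B /\ T_0^{-a_0(n)} A_0 /\ ... /\ T_i^{-a_i(n)} A_i] is asymptotically measurable
    with respect to the first [a_{i+1}(n) - m] steps of [T_{i+1}], and alpha-mixing over a gap [m]
    decouples it from [T_{i+1}^{-a_{i+1}(n)} A_{i+1}].  The result for [mu_{i+1}] passes to [nu] by
    approximating the density of [nu] by simple functions.

    Shannon-McMillan is obtained from Gibbs' inequality: if [q] is a subprobability on the labels
    and [p] their distribution, then [q / p] has mean at most 1, so [- ln p <= - ln q + q / p].  With
    [q] the product of the distributions of blocks of length [k], [- ln q] is an ergodic sum, which
    gives the upper bound; the lower bound follows since the mean of [- ln p] is at least [N h].
    All maps in play are mixing, so the ergodic theorem needed is a variance estimate. *)

(* Two notions of entropy meet here: $h(T_i)$ is a supremum over finite partitions, while the cells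
   come from a possibly infinite partition of finite entropy. The Kolmogorov-Sinai theorem is
   therefore proved along the way, without conditional entropy: Gibbs' inequality is used again, now
   with the output law of a memoryless channel as reference, and predicting one label from another
   through a channel bounds its entropy rate.

   Blocks of length [k] are read at multiples of [k], so averages run along $T^k$; mixing passes to
   $T^k$, which ergodicity alone need not do. For $T_0$ this is what strong mixing provides, besides
   the base case of the induction on the number of maps.

   Order arguments hold only for points whose orbits avoid all endpoints, so convexity is always
   relative to a set of full measure. Since all $\mu_i$ are comparable with Lebesgue measure, an
   approximation found for one map serves for another up to a constant factor. *)
Require Import Defs.
From mathcomp Require Import all_boot all_order all_algebra all_classical all_reals all_analysis.
From mathcomp Require Import measurable_realfun ring lra zify.
Import Order.TTheory Num.Theory GRing.Theory numFieldNormedType.Exports.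
Set Implicit Arguments. Unset Strict Implicit. Unset Printing Implicit Defensive.
Local Open Scope classical_set_scope. Local Open Scope ring_scope.

(** * Expectations and information functions of countable labels *)

Section nonneg_expectation.
Context d (Om : measurableType d) (R : realType) (P : probability Om R).
Implicit Types (f g : Om -> R) (A : set Om).

(** Extended-valued, and used only for nonnegative functions, so additivity and monotonicity need no
    integrability. *)
Definition mean f : \bar R := (\int[P]_x (f x)%:E)%E.

Lemma mean_ge0 f : (forall x, 0 <= f x) -> (0 <= mean f)%E.
Proof. by move=> f0; apply: integral_ge0 => x _; rewrite lee_fin. Qed.

Lemma mean_le f g : measurable_fun setT f -> measurable_fun setT g ->
  (forall x, 0 <= f x) -> (forall x, f x <= g x) -> (mean f <= mean g)%E.
Proof.
move=> mf mg f0 fg; apply: ge0_le_integral => //.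
- by move=> x _; rewrite lee_fin.
- exact/measurable_EFinP.
- exact/measurable_EFinP.
- by move=> x _; rewrite lee_fin.
Qed.

Lemma mean_ae_le f g A : measurable_fun setT f -> measurable_fun setT g ->
  (forall x, 0 <= f x) -> (forall x, 0 <= g x) -> measurable A -> P A = 0%E ->
  (forall x, ~ A x -> f x <= g x) -> (mean f <= mean g)%E.
Proof.
move=> mf mg f0 g0 mA A0 fg; apply: ae_ge0_le_integral => //.
- by move=> x _; rewrite lee_fin.
- exact/measurable_EFinP.
- by move=> x _; rewrite lee_fin.
- exact/measurable_EFinP.
- exists A; split => // x /= H; apply: contrapT => nA; apply: H => _.
  by rewrite lee_fin fg.
Qed.

Lemma meanD f g : measurable_fun setT f -> measurable_fun setT g ->
  (forall x, 0 <= f x) -> (forall x, 0 <= g x) ->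
  mean (fun x => f x + g x) = (mean f + mean g)%E.
Proof.
move=> mf mg f0 g0; rewrite /mean -ge0_integralD //.
- by move=> x _; rewrite lee_fin.
- exact/measurable_EFinP.
- by move=> x _; rewrite lee_fin.
- exact/measurable_EFinP.
Qed.

Lemma meanZ f (c : R) : measurable_fun setT f ->
  (forall x, 0 <= f x) -> 0 <= c -> mean (fun x => c * f x) = (c%:E * mean f)%E.
Proof.
move=> mf f0 c0; rewrite /mean -ge0_integralZl_EFin //.
- by move=> x _; rewrite lee_fin.
- exact/measurable_EFinP.
Qed.

Lemma mean_sum (I : Type) (s : seq I) (f : I -> Om -> R) :
  (forall i, measurable_fun setT (f i)) -> (forall i x, 0 <= f i x) ->
  mean (fun x => \sum_(i <- s) f i x) = (\sum_(i <- s) mean (f i))%E.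
Proof.
move=> mf f0; rewrite /mean -ge0_integral_sum //.
- by apply: eq_integral => x _; rewrite -sumEFin.
- by move=> i; exact/measurable_EFinP.
- by move=> i x _; rewrite lee_fin.
Qed.

Lemma mean_cst (c : R) : mean (fun=> c) = c%:E.
Proof.
rewrite /mean (_ : (fun _ => c%:E) = cst c%:E)// integral_cst //.
by rewrite [X in (_ * X)%E](@probability_setT _ _ _ P) mule1.
Qed.

Lemma mean_indic A : measurable A -> mean (\1_A) = P A.
Proof. by move=> mA; rewrite /mean integral_indic// setIT. Qed.

Lemma mean_markov f (c : R) : measurable_fun setT f -> (forall x, 0 <= f x) -> 0 <= c ->
  (c%:E * P [set x | (c <= f x)%R] <= mean f)%E.
Proof.
move=> mf f0 c0.
have mA : measurable [set x | (c <= f x)%R].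
  rewrite -[X in measurable X]setTI.
  have -> : [set x | c <= f x] = f @^-1` `[c, +oo[%classic.
    by apply/seteqP; split=> x /=; rewrite in_itv /= andbT.
  exact: mf.
rewrite -mean_indic// -meanZ//.
apply: mean_le => //.
- by apply: measurable_funM => //; exact: measurable_indic.
- by move=> x; rewrite mulr_ge0 // indicE.
- move=> x; rewrite indicE; case: (boolP (_ \in _)) => [|_]; last by rewrite mulr0.
  by rewrite inE /= mulr1.
Qed.

End nonneg_expectation.

Section labels.
Context d (Om : measurableType d) (R : realType) (P : probability Om R).

(** Preimages of all sets of labels, as if [C] carried the discrete sigma-algebra: any function of a
    label, real-valued or not, is then measurable for free. *)
Definition measurable_label (C : Type) (xi : Om -> C) := forall S : set C, measurable (xi @^-1` S).

Lemma measurable_label_fib (C : countType) (xi : Om -> C) :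
  (forall c, measurable (xi @^-1` [set c])) -> measurable_label xi.
Proof.
move=> H S.
have -> : xi @^-1` S = \bigcup_n (if unpickle n is Some c then
    (if c \in S then xi @^-1` [set c] else set0) else set0).
  apply/seteqP; split => [x Sx|x [n _]].
    by exists (pickle (xi x)) => //; rewrite pickleK /= mem_set.
  case: (unpickle n) => // c; case: (boolP (c \in S)) => // /set_mem Sc.
  by move=> /= ->.
apply: bigcupT_measurable => n; case: (unpickle n) => // c.
by case: ifP.
Qed.

Lemma measurable_label_comp (C D : Type) (f : C -> D) (xi : Om -> C) : measurable_label xi -> measurable_label (f \o xi).
Proof. by move=> H S; rewrite comp_preimage; exact: H. Qed.

Lemma measurable_label_pair (C D : countType) (xi : Om -> C) (eta : Om -> D) :
  measurable_label xi -> measurable_label eta -> measurable_label (fun x => (xi x, eta x)).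
Proof.
move=> mx me; apply: measurable_label_fib => -[c e].
have -> : (fun x => (xi x, eta x)) @^-1` [set (c, e)] =
    xi @^-1` [set c] `&` eta @^-1` [set e].
  by apply/seteqP; split => x /= [-> ->].
exact: measurableI.
Qed.

Lemma measurable_label_fun (C : Type) (xi : Om -> C) (g : C -> R) :
  measurable_label xi -> measurable_fun setT (g \o xi).
Proof. by move=> mx _ Y _; rewrite setTI comp_preimage; exact: mx. Qed.

Definition label_prob (C : Type) (xi : Om -> C) (c : C) : R := fine (P (xi @^-1` [set c])).

Lemma label_prob_ge0 (C : Type) (xi : Om -> C) c : 0 <= label_prob xi c.
Proof. exact: fine_ge0. Qed.

Lemma label_probE (C : Type) (xi : Om -> C) c : measurable_label xi -> P (xi @^-1` [set c]) = (label_prob xi c)%:E.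
Proof. by move=> mx; rewrite fineK // fin_num_measure. Qed.

Lemma label_prob_le1 (C : Type) (xi : Om -> C) c : measurable_label xi -> label_prob xi c <= 1.
Proof. by move=> mx; rewrite -lee_fin -label_probE// probability_le1. Qed.

(* Labels of probability 0 carry information 0, since [ln 0 = 0]. *)
Definition info (C : Type) (xi : Om -> C) (x : Om) : R := - ln (label_prob xi (xi x)).

Lemma info_ge0 (C : Type) (xi : Om -> C) x : measurable_label xi -> 0 <= info xi x.
Proof. by move=> mx; rewrite oppr_ge0 ln_le0 // label_prob_le1. Qed.

Lemma measurable_info (C : Type) (xi : Om -> C) : measurable_label xi -> measurable_fun setT (info xi).
Proof.
move=> mx; rewrite (_ : info xi = (fun c => - ln (label_prob xi c)) \o xi)//.
exact: measurable_label_fun.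
Qed.

Definition label_entropy (C : Type) (xi : Om -> C) : \bar R := mean P (info xi).

Lemma label_entropy_ge0 (C : Type) (xi : Om -> C) : measurable_label xi -> (0 <= label_entropy xi)%E.
Proof. by move=> mx; apply: mean_ge0 => x; exact: info_ge0. Qed.

(** Monotone convergence along the finite sets of labels with code below [n]: finite sums control
    the mean, and no sum over the countable type is formed. *)
Lemma mean_lab_le (C : countType) (xi : Om -> C) (g : C -> R) (M : \bar R) :
  measurable_label xi -> (forall c, 0 <= g c) ->
  (forall s : seq C, uniq s -> ((\sum_(c <- s) g c * label_prob xi c)%:E <= M)%E) ->
  (mean P (g \o xi) <= M)%E.
Proof.
move=> mx g0 HM.
pose s n := pmap (@pickle_inv C) (iota 0 n).
have us n : uniq (s n).
  apply: (@pmap_uniq _ _ _ (@pickle C)); last exact: iota_uniq.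
  exact: pickle_invK.
pose h n x := (\sum_(c <- s n) g c * \1_(xi @^-1` [set c]) x)%:E.
have mt c : measurable_fun setT (fun x => g c * \1_(xi @^-1` [set c]) x : R).
  by apply: measurable_funM => //; exact: measurable_indic.
have t0 c x : 0 <= g c * \1_(xi @^-1` [set c]) x :> R.
  by rewrite mulr_ge0 // indicE.
have hE n x : h n x = (if xi x \in s n then g (xi x) else 0)%:E.
  rewrite /h; case: ifPn => xs.
    rewrite (bigD1_seq (xi x)) //= big1 ?addr0 ?indicE ?mem_set ?mulr1// => c cx.
    by rewrite indicE memNset ?mulr0//= => xc; move: cx; rewrite xc eqxx.
  rewrite big_seq big1// => c cs; rewrite indicE memNset ?mulr0//= => xc.
  by rewrite xc cs in xs.
have -> : mean P (g \o xi) = (\int[P]_x (limn (h^~ x)))%E.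
  apply: eq_integral => x _; apply/esym/cvg_lim => //.
  apply: cvg_near_cst; exists (pickle (xi x)).+1 => // n /= nx.
  rewrite hE ifT//; rewrite /s mem_pmap; apply/mapP.
  exists (pickle (xi x)); first by rewrite mem_iota.
  by rewrite pickleK_inv.
rewrite monotone_convergence //.
- apply: lime_le; last first.
    near=> n; rewrite /h (_ : (\int[P]_x _)%E = mean P (fun x =>
      \sum_(c <- s n) g c * \1_(xi @^-1` [set c]) x))// mean_sum //.
    apply: le_trans (HM _ (us n)); rewrite -sumEFin; apply: lee_sum => c _.
    by rewrite meanZ ?mean_indic ?label_probE// => x; rewrite indicE.
  apply: ereal_nondecreasing_is_cvgn => m n mn.
  apply: ge0_le_integral => //.
  + by move=> x _; rewrite lee_fin; apply: sumr_ge0.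
  + by apply/measurable_EFinP; exact: measurable_sum.
  + by apply/measurable_EFinP; exact: measurable_sum.
  + move=> x _; rewrite !hE lee_fin; case: ifP => [xm|_]; last by case: ifP.
    rewrite ifT//; move: xm; rewrite /s !mem_pmap => /mapP [i]; rewrite mem_iota => im ->.
    by apply/mapP; exists i => //; rewrite mem_iota; lia.
- by move=> n; apply/measurable_EFinP; exact: measurable_sum.
- by move=> n x _; rewrite lee_fin; apply: sumr_ge0.
- move=> x _ m n mn; rewrite !hE lee_fin; case: ifP => [xm|_]; last by case: ifP.
  rewrite ifT//; move: xm; rewrite /s !mem_pmap => /mapP [i]; rewrite mem_iota => im ->.
  by apply/mapP; exists i => //; rewrite mem_iota; lia.
Unshelve. all: by end_near. Qed.

Lemma mean_lab_fin (C : finType) (xi : Om -> C) (g : C -> R) :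
  measurable_label xi -> (forall c, 0 <= g c) ->
  mean P (g \o xi) = (\sum_(c : C) g c * label_prob xi c)%:E.
Proof.
move=> mx g0.
have -> : g \o xi = fun x => \sum_(c : C) g c * \1_(xi @^-1` [set c]) x.
  apply/funext => x; rewrite (bigD1 (xi x)) //= big1 ?addr0 ?indicE ?mem_set ?mulr1//.
  by move=> c cx; rewrite indicE memNset ?mulr0//= => xc; move: cx; rewrite xc eqxx.
rewrite mean_sum -?sumEFin.
- by apply: eq_bigr => c _; rewrite meanZ ?mean_indic ?label_probE// => x; rewrite indicE.
- by move=> c; apply: measurable_funM => //; exact: measurable_indic.
- by move=> c x; rewrite mulr_ge0// indicE.
Qed.

(** With the convention [ln 0 = 0] information is not monotone on labels of probability 0; these can
    be discarded because together they form a null event. *)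
Lemma prl0_null (C : countType) (xi : Om -> C) : measurable_label xi ->
  P (xi @^-1` [set c | label_prob xi c = 0]) = 0%E.
Proof.
move=> mx; have mN := mx [set c | label_prob xi c = 0].
apply/eqP; rewrite eq_le measure_ge0 andbT -mean_indic//.
have -> : (\1_(xi @^-1` [set c | label_prob xi c = 0]) : Om -> R) =
    (fun c => ((label_prob xi c == 0)%:R : R)) \o xi.
  apply/funext => x; rewrite indicE /=; congr (_%:R); congr nat_of_bool.
  by apply/idP/eqP => [/set_mem//|?]; exact/mem_set.
apply: mean_lab_le => // s _; rewrite lee_fin big1// => c _.
by case: eqP => [->|]; rewrite ?mulr0 ?mul0r.
Qed.

Lemma label_prob_mono (C D : Type) (xi : Om -> C) (eta : Om -> D) x : measurable_label xi -> measurable_label eta ->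
  (forall y, eta y = eta x -> xi y = xi x) -> label_prob eta (eta x) <= label_prob xi (xi x).
Proof.
move=> mx me H; rewrite fine_le ?fin_num_measure// le_measure ?inE//.
Qed.

Lemma info_mono (C D : Type) (xi : Om -> C) (eta : Om -> D) x : measurable_label xi -> measurable_label eta ->
  (forall y, eta y = eta x -> xi y = xi x) -> label_prob eta (eta x) != 0 ->
  info xi x <= info eta x.
Proof.
move=> mx me H n0; have e0 : 0 < label_prob eta (eta x) by rewrite lt_def n0 label_prob_ge0.
rewrite lerN2 ler_ln ?posrE ?label_prob_mono//.
by apply: lt_le_trans e0 _; exact: label_prob_mono.
Qed.

Lemma label_entropy_mono (C : Type) (D : countType) (xi : Om -> C) (eta : Om -> D) :
  measurable_label xi -> measurable_label eta -> (forall x y, eta y = eta x -> xi y = xi x) -> (label_entropy xi <= label_entropy eta)%E.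
Proof.
move=> mx me H; apply: (mean_ae_le (measurable_info mx) (measurable_info me) _ _ _ (prl0_null me)).
- by move=> x; exact: info_ge0.
- by move=> x; exact: info_ge0.
- exact: me.
- by move=> x /= /eqP; apply: info_mono => // y; exact: H.
Qed.

(** Tested on duplicate-free lists to avoid infinite sums. Mass at most 1 is all that Gibbs'
    inequality asks of a reference law. *)
Definition subprobability (C : eqType) (q : C -> R) :=
  (forall c, 0 <= q c) /\ forall s, uniq s -> \sum_(c <- s) q c <= 1.

Lemma subprobability_le1 (C : eqType) (q : C -> R) c : subprobability q -> q c <= 1.
Proof. by move=> [_ /(_ [:: c] isT)]; rewrite big_seq1. Qed.

Lemma label_prob_set (C : eqType) (xi : Om -> C) (s : seq C) : measurable_label xi -> uniq s ->
  \sum_(c <- s) label_prob xi c = fine (P (xi @^-1` [set c | c \in s])).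
Proof.
move=> mx; elim: s => [_|c s IH /andP[cs us]].
  rewrite big_nil (_ : xi @^-1` _ = set0) ?measure0//.
  by apply/seteqP; split.
have -> : [set c' | c' \in c :: s] = [set c] `|` [set c' | c' \in s].
  apply/seteqP; split=> c' /=; rewrite inE.
    by case/orP => [/eqP|]; [left|right].
  by case=> [->|->]; rewrite ?eqxx ?orbT.
rewrite big_cons IH// preimage_setU measureU; [|exact: mx|exact: mx|].
  by rewrite fineD// fin_num_measure//; exact: mx.
by rewrite -preimage_setI -subset0 => x [/= -> ]; apply/negP.
Qed.

Lemma subprobability_prl (C : eqType) (xi : Om -> C) : measurable_label xi -> subprobability (label_prob xi).
Proof.
move=> mx; split=> [c|s us]; first exact: label_prob_ge0.
rewrite label_prob_set// -lee_fin fineK ?fin_num_measure//.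
exact: probability_le1.
Qed.

(** The inequality [ln t <= t - 1] at [t = q / p], kept pointwise with a remainder [r]: later
    arguments need positive parts of information, not only its mean. *)
Lemma gibbs (C : countType) (xi : Om -> C) (q : C -> R) : measurable_label xi -> subprobability q ->
  (forall c, 0 < label_prob xi c -> 0 < q c) ->
  exists r : Om -> R, [/\ measurable_fun setT r, (forall x, 0 <= r x), (mean P r <= 1)%E &
    forall x, info xi x + 1 <= - ln (q (xi x)) + r x].
Proof.
move=> mx [q0 q1] pq.
(* On labels of probability 0 the pointwise bound wants the value 1 and the bound on the mean wants
   0; [g] and [g'] agree almost everywhere, so both are obtained. *)
pose g c := if label_prob xi c == 0 then 1 else q c / label_prob xi c.
pose g' c := if label_prob xi c == 0 then 0 else q c / label_prob xi c.
exists (g \o xi); split.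
- exact: measurable_label_fun.
- by move=> x /=; rewrite /g; case: ifP => // _; rewrite divr_ge0// label_prob_ge0.
- have : (mean P (g' \o xi) <= 1)%E.
    apply: mean_lab_le => //.
      by move=> x /=; rewrite /g'; case: ifP => // _; rewrite divr_ge0// label_prob_ge0.
    move=> s us; rewrite lee_fin; apply: le_trans (q1 s us); apply: ler_sum => c _.
    by rewrite /g'; case: ifPn => [_|c0]; rewrite ?mul0r// divfK.
  apply: le_trans; apply: (@mean_ae_le _ _ _ P _ _ _ _ _ _ _ (mx _) (prl0_null mx)).
  + exact: measurable_label_fun.
  + exact: measurable_label_fun.
  + by move=> x /=; rewrite /g; case: ifP => // _; rewrite divr_ge0// label_prob_ge0.
  + by move=> x /=; rewrite /g'; case: ifP => // _; rewrite divr_ge0// label_prob_ge0.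
  + by move=> x /= /eqP/negPf x0; rewrite /g /g' x0.
- move=> x; rewrite /info /= /g; case: eqP => [->|/eqP n0].
    rewrite ln0// oppr0 add0r lerDr oppr_ge0 ln_le0//.
    by have := q1 [:: xi x] isT; rewrite big_seq1.
  have p0 : 0 < label_prob xi (xi x) by rewrite lt_def n0 label_prob_ge0.
  have qx0 := pq _ p0; have t0 : 0 < q (xi x) / label_prob xi (xi x) by rewrite divr_gt0.
  have := @le_ln1Dx _ (q (xi x) / label_prob xi (xi x) - 1); rewrite addrCA subrr addr0.
  rewrite ln_div ?posrE//.
  by move=> /(_ ltac:(lra)); lra.
Qed.

End labels.

(** * Words, block measures and subadditivity *)

Section subprobability.
Context (R : realType).

Lemma sum_fibers (C D : eqType) (f : C -> D) (s : seq C) (F : C -> R) :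
  \sum_(c <- s) F c = \sum_(a <- undup (map f s)) \sum_(c <- s | f c == a) F c.
Proof.
rewrite (exchange_big_dep predT)//= big_seq [RHS]big_seq; apply: eq_bigr => c cs.
have fs : f c \in undup (map f s) by rewrite mem_undup map_f.
rewrite big_mkcond (bigD1_seq (f c)) ?undup_uniq//= eqxx big1 ?addr0// => a /negPf.
by rewrite eq_sym => ->.
Qed.

(** Chain rule for laws: summing over the fibers of [f] first leaves masses of the kernel [v].
    Injectivity of the pair [(f, g)] is enough, so words can be split into head and tail. *)
Lemma subprobability_pair (C C1 C2 : eqType) (u : C1 -> R) (v : C1 -> C2 -> R)
    (f : C -> C1) (g : C -> C2) :
  subprobability u -> (forall a, subprobability (v a)) -> (forall c c', f c = f c' -> g c = g c' -> c = c') ->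
  subprobability (fun c => u (f c) * v (f c) (g c)).
Proof.
move=> [u0 u1] Hv inj; split=> [c|s us]; first by rewrite mulr_ge0// (Hv _).1.
rewrite (sum_fibers f); apply: le_trans (u1 _ (undup_uniq (map f s))).
apply: ler_sum => a _.
rewrite (eq_bigr (fun c => u a * v a (g c))); last by move=> c /eqP ->.
rewrite -mulr_sumr -[leRHS]mulr1 ler_wpM2l//.
rewrite -big_filter -(big_map g predT (v a)); apply: (Hv a).2.
rewrite map_inj_in_uniq ?filter_uniq// => c c'.
rewrite !mem_filter => /andP[/eqP fc _] /andP[/eqP fc' _] gg.
by apply: inj => //; rewrite fc.
Qed.

(** Only an inequality, since a zero factor turns the left side into [- ln 0 = 0]. *)
Lemma lnM_ge (a b : R) : 0 <= a <= 1 -> 0 <= b <= 1 -> - ln (a * b) <= - ln a + - ln b.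
Proof.
move=> /andP[a0 a1] /andP[b0 b1].
have [->|an] := eqVneq a 0.
  by rewrite mul0r ln0// oppr0 add0r oppr_ge0 ln_le0.
have [->|bn] := eqVneq b 0.
  by rewrite mulr0 ln0// oppr0 addr0 oppr_ge0 ln_le0.
by rewrite lnM ?posrE ?lt_def ?an ?bn// opprD.
Qed.

End subprobability.

Section dynamics.
Context d (Om : measurableType d) (R : realType) (P : probability Om R).
Variable T : Om -> Om.
Hypothesis mT : measurable_fun setT T.
Hypothesis pT : forall A, measurable A -> P (T @^-1` A) = P A.

Lemma measurable_iter n : measurable_fun setT (iter n T).
Proof.
elim: n => [|n IH]; first exact: measurable_id.
rewrite (_ : iter n.+1 T = T \o iter n T)//.
exact: measurableT_comp.
Qed.

Lemma measurable_iter_preimage n A : measurable A -> measurable (iter n T @^-1` A).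
Proof. by move=> mA; rewrite -[X in measurable X]setTI; exact: measurable_iter. Qed.

Lemma prob_iter n A : measurable A -> P (iter n T @^-1` A) = P A.
Proof.
elim: n A => [//|n IH] A mA.
rewrite (_ : iter n.+1 T @^-1` A = iter n T @^-1` (T @^-1` A))//.
by rewrite IH ?pT//; exact: (@measurable_iter_preimage 1).
Qed.

Lemma measurable_label_iter (C : Type) (xi : Om -> C) n : measurable_label xi -> measurable_label (xi \o iter n T).
Proof. by move=> mx S; rewrite comp_preimage; exact: measurable_iter_preimage. Qed.

Lemma label_prob_iter (C : Type) (xi : Om -> C) n c : measurable_label xi -> label_prob P (xi \o iter n T) c = label_prob P xi c.
Proof. by move=> mx; rewrite /label_prob comp_preimage prob_iter. Qed.

Lemma mean_iter (f : Om -> R) n : measurable_fun setT f -> (forall x, 0 <= f x) ->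
  mean P (f \o iter n T) = mean P f.
Proof.
move=> mf f0; rewrite /mean.
pose E y := (f y)%:E.
have -> : (\int[P]_x ((f \o iter n T) x)%:E)%E =
  (\int[P]_(x in iter n T @^-1` setT) (E \o iter n T) x)%E by rewrite preimage_setT.
rewrite -(ge0_integral_pushforward (measurable_iter n))//.
- apply: eq_measure_integral => [|? A mA _]; first exact: measurable_iter.
  exact: prob_iter.
- exact/measurable_EFinP.
- by move=> y _; rewrite lee_fin.
Qed.

Variables (C : countType) (xi : Om -> C).
Hypothesis mx : measurable_label xi.

Definition word n (x : Om) : seq C := [seq xi (iter j T x) | j <- iota 0 n].

Lemma size_word n x : size (word n x) = n.
Proof. by rewrite size_map size_iota. Qed.

Lemma nth_word c n x j : (j < n)%N -> nth c (word n x) j = xi (iter j T x).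
Proof. by move=> jn; rewrite (nth_map 0%N) ?size_iota// nth_iota. Qed.

Lemma word_cat n m x : word (n + m) x = word n x ++ word m (iter n T x).
Proof.
rewrite /word iotaD map_cat add0n; congr (_ ++ _).
rewrite -{1}[n]addn0 iotaDl -map_comp; apply: eq_map => j /=.
by rewrite addnC iterD.
Qed.

Lemma wordS n x : word n.+1 x = xi x :: word n (T x).
Proof. by rewrite -add1n word_cat. Qed.

Lemma take_word n m x : take n (word (n + m) x) = word n x.
Proof. by rewrite word_cat take_cat size_word ltnn subnn take0 cats0. Qed.

Lemma drop_word n m x : drop n (word (n + m) x) = word m (iter n T x).
Proof. by rewrite word_cat drop_cat size_word ltnn subnn drop0. Qed.

Lemma measurable_label_word n : measurable_label (word n).
Proof.
elim: n => [|n IH].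
  move=> S; case: (pselect (S [::])) => h.
    by rewrite (_ : _ @^-1` _ = setT)//; apply/seteqP; split.
  by rewrite (_ : _ @^-1` _ = set0)//; apply/seteqP; split.
have -> : word n.+1 = (fun p => p.1 :: p.2) \o (fun x => (xi x, word n (T x))).
  by apply/funext => x; rewrite wordS.
apply: measurable_label_comp; apply: measurable_label_pair => //.
exact: (@measurable_label_iter _ _ 1).
Qed.

Definition word_entropy n : \bar R := label_entropy P (word n).

Lemma label_prob_wordl n m w : label_prob P (word (n + m)) w <= label_prob P (word n) (take n w).
Proof.
rewrite fine_le ?fin_num_measure ?le_measure ?inE//; try exact: measurable_label_word.
by move=> x /= <-; rewrite take_word.
Qed.

Lemma label_prob_wordr n m w : label_prob P (word (n + m)) w <= label_prob P (word m) (drop n w).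
Proof.
rewrite -(label_prob_iter n _ (measurable_label_word m)).
rewrite fine_le ?fin_num_measure ?le_measure ?inE//; try exact: measurable_label_word.
- exact: (measurable_label_iter _ (measurable_label_word m)).
- exact: (measurable_label_iter _ (measurable_label_word m)).
- by move=> x /= <-; rewrite drop_word.
Qed.

Lemma label_prob_word01 n w : 0 <= label_prob P (word n) w <= 1.
Proof. by rewrite label_prob_ge0 label_prob_le1//; exact: measurable_label_word. Qed.

(** The law of [m] independent copies of the first [k] letters, concatenated. The base case allows
    no leftover letter, which keeps the mass at most 1. *)
Fixpoint block_prob k m (w : seq C) : R :=
  if m is m'.+1 then label_prob P (word k) (take k w) * block_prob k m' (drop k w)
  else (w == [::])%:R.

Lemma subprobability_blockq k m : subprobability (block_prob k m).
Proof.
elim: m => [|m IH].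
  split=> [c|s us]; first exact: ler0n.
  have [ins|nins] := boolP ([::] \in s).
    by rewrite (bigD1_seq [::])//= big1 ?addr0// => c /negPf ->.
  by rewrite big_seq big1// => c cs /=; case: (eqVneq c [::]) => // c0; rewrite -c0 cs in nins.
apply: (@subprobability_pair _ _ _ _ (label_prob P (word k)) (fun=> block_prob k m)) => //.
- by apply: subprobability_prl; exact: measurable_label_word.
- by move=> c c' e1 e2; rewrite -(cat_take_drop k c) e1 e2 cat_take_drop.
Qed.

Lemma blockq_gt0 k m w : 0 < label_prob P (word (m * k)) w -> 0 < block_prob k m w.
Proof.
elim: m w => [|m IH] w /=.
  rewrite mul0n; case: eqP => // w0.
  rewrite /label_prob (_ : _ @^-1` _ = set0) ?measure0 ?ltxx//.
  by rewrite -subset0 => x /= /esym.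
rewrite mulSn => p0; apply: mulr_gt0.
  exact: lt_le_trans p0 (label_prob_wordl _ _ _).
by apply: IH; exact: lt_le_trans p0 (label_prob_wordr _ _ _).
Qed.

Lemma ln_blockq k m x :
  - ln (block_prob k m (word (m * k) x)) <= \sum_(j < m) info P (word k) (iter (k * j) T x).
Proof.
elim: m x => [|m IH] x; first by rewrite mul0n /= ln1 oppr0 big_ord0.
rewrite big_ord_recl /= muln0 mulSn take_word drop_word.
apply: le_trans (lnM_ge (label_prob_word01 _ _) _) _.
  by rewrite (subprobability_blockq _ _).1 subprobability_le1//; exact: subprobability_blockq.
apply: lerD => //; apply: le_trans (IH _) _; apply: ler_sum => j _.
by rewrite -iterD /bump /= mulnDr muln1 addnC.
Qed.

(** The 1 on the left compensates for the mean of [r]: integrated, the bound becomes subadditivity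
    of entropy with no error term; pointwise, it bounds information by an ergodic sum. *)
Lemma info_blocks k m : exists r : Om -> R,
  [/\ measurable_fun setT r, (forall x, 0 <= r x), (mean P r <= 1)%E &
    forall x, info P (word (m * k)) x + 1 <=
       \sum_(j < m) info P (word k) (iter (k * j) T x) + r x].
Proof.
have [r [mr r0 r1 rE]] := gibbs (measurable_label_word (m * k)) (subprobability_blockq k m) (@blockq_gt0 k m).
exists r; split => // x; apply: le_trans (rE x) _.
by rewrite lerD2r ln_blockq.
Qed.

Lemma mean_sum_info k m :
  mean P (fun x => \sum_(j < m) info P (word k) (iter (k * j) T x)) = (m%:R%:E * word_entropy k)%E.
Proof.
rewrite mean_sum.
- rewrite (eq_bigr (fun=> word_entropy k)) => [|j _].
    by rewrite sumr_const card_ord mule_natl.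
  rewrite -[LHS]/(mean P (info P (word k) \o iter (k * j) T)) mean_iter//.
    exact: measurable_info (measurable_label_word _).
  by move=> x; apply: info_ge0; exact: measurable_label_word.
- move=> j; apply: measurableT_comp (measurable_iter _).
  exact: measurable_info (measurable_label_word _).
- by move=> j x; apply: info_ge0; exact: measurable_label_word.
Qed.

Lemma word_entropy_blocks k m : (word_entropy (m * k) <= m%:R%:E * word_entropy k)%E.
Proof.
have [r [mr r0 r1 rE]] := info_blocks k m.
have mi := measurable_info P (measurable_label_word (m * k)).
have ms : measurable_fun setT (fun x => \sum_(j < m) info P (word k) (iter (k * j) T x)).
  apply: measurable_sum => j; apply: measurableT_comp (measurable_iter _).
  exact: measurable_info (measurable_label_word _).
have s0 x : 0 <= \sum_(j < m) info P (word k) (iter (k * j) T x).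
  by apply: sumr_ge0 => j _; apply: info_ge0; exact: measurable_label_word.
have i0 x : 0 <= info P (word (m * k)) x by apply: info_ge0; exact: measurable_label_word.
have : (word_entropy (m * k) + 1 <= m%:R%:E * word_entropy k + 1)%E.
  rewrite -mean_sum_info -{1}(mean_cst P 1) -meanD//.
  apply: (@le_trans _ _ (mean P (fun x =>
     \sum_(j < m) info P (word k) (iter (k * j) T x) + r x))).
    apply: mean_le => //; try exact: measurable_funD.
    by move=> x; rewrite addr_ge0.
  by rewrite meanD// leeD2l.
by rewrite leeD2rE.
Qed.

End dynamics.

(** * Mean ergodic averages under mixing *)

Section tail.
Context d (Om : measurableType d) (R : realType) (P : probability Om R).

Lemma mean_tail (f : Om -> R) (t : Om -> nat) (e : R) : measurable_fun setT f ->
  (forall x, 0 <= f x) -> (mean P f < +oo)%E -> measurable_label t -> 0 < e ->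
  exists K, (mean P (fun x => (f x * (K <= t x)%:R)%R) <= e%:E)%E.
Proof.
move=> mf f0 fi mt e0.
have mg K : measurable_fun setT (fun x => f x * (K <= t x)%:R).
  apply: measurable_funM => //.
  exact: (measurable_label_fun (fun n => ((K <= n)%:R : R)) mt).
have : mean P (fun x => f x * (K <= t x)%:R) @[K --> \oo] --> (\int[P]_x (cst 0%E x))%E.
  apply: (@dominated_cvg _ _ _ _ _ _ _ _ (EFin \o f)) => //.
  - by move=> K; exact/measurable_EFinP.
  - move=> x _; apply: cvg_near_cst; exists (t x).+1 => // K /= Kx.
    by rewrite leqNgt Kx mulr0.
  - apply/integrableP; split; first exact/measurable_EFinP.
    by under eq_integral => x _ do rewrite /= ger0_norm//.
  - move=> K x _; rewrite /= lee_fin ger0_norm ?mulr_ge0//.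
    by case: (K <= t x)%N; rewrite ?mulr1// mulr0.
rewrite integral0 => /fine_cvgP[[K1 _ fK1]].
move=> /cvgrPdist_le /(_ _ e0)[K2 _ fK2].
exists (maxn K1 K2).
have h1 : (K1 <= maxn K1 K2)%N by lia.
have h2 : (K2 <= maxn K1 K2)%N by lia.
rewrite -[X in (X <= _)%E]fineK; last exact: fK1.
rewrite lee_fin; apply: le_trans (fK2 _ h2); rewrite sub0r normrN; exact: ler_norm.
Qed.

End tail.

(** Expands the square of [h * m - |z - m * p|], in place of Cauchy-Schwarz. The cross term stays on
    the left because only nonnegative functions are integrated. *)
Lemma amgm_deviation (R : realType) (h m p z : R) : 0 <= h * m ->
  h * m * `|z - m * p| + 2 * m * p * z <= h * m * (h * m) + (z ^+ 2 + m ^+ 2 * p ^+ 2).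
Proof.
move=> hm; have := sqr_ge0 (h * m - `|z - m * p|).
have := real_normK (num_real (z - m * p)).
have : 0 <= h * m * `|z - m * p| by rewrite mulr_ge0.
move: (`|_|) => y; nra.
Qed.

Lemma deviation_le (R : realType) (h m p s D y : R) : 0 < h -> 0 < m ->
  h * m * y + 2 * m * p * (m * p) <= h * m * (h * m) + (s + m ^+ 2 * p ^+ 2) ->
  s <= m ^+ 2 * p ^+ 2 + h ^+ 2 * m ^+ 2 + (2 * D + 1) * m -> 2 * D + 1 <= m * h ^+ 2 ->
  y <= 3 * h * m.
Proof.
move=> h0 m0 key sm mb; have hm : 0 < h * m by rewrite mulr_gt0.
rewrite -(ler_pM2l hm).
have mb2 : (2 * D + 1) * m <= m * h ^+ 2 * m by rewrite ler_pM2r.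
nra.
Qed.

Section ergodic_averages.
Context d (Om : measurableType d) (R : realType) (P : probability Om R).
Variable T : Om -> Om.
Hypothesis mT : measurable_fun setT T.
Hypothesis pT : forall A, measurable A -> P (T @^-1` A) = P A.
Hypothesis mixT : forall A B, measurable A -> measurable B ->
  (fun n => fine (P (A `&` iter n T @^-1` B))) @ \oo --> fine (P A) * fine (P B).

Section indicator.
Variables (A : set Om) (k : nat).
Hypotheses (mA : measurable A) (k0 : (0 < k)%N).

Let N m x : R := \sum_(j < m) \1_A (iter (k * j) T x).
Let p : R := fine (P A).
Let c j : R := fine (P (A `&` iter (k * j) T @^-1` A)).

Let p01 : 0 <= p <= 1.
Proof. by rewrite fine_ge0// -lee_fin fineK ?fin_num_measure// probability_le1. Qed.

Let mind j : measurable_fun setT (fun x => \1_A (iter j T x) : R).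
Proof. exact: measurableT_comp (measurable_indic _) (measurable_iter mT j). Qed.

Let mN m : measurable_fun setT (N m).
Proof. by apply: measurable_sum => j; exact: mind. Qed.

Let N0 m x : 0 <= N m x.
Proof. exact: sumr_ge0. Qed.

Let Nle m x : N m x <= m%:R.
Proof.
rewrite -[m in leRHS]card_ord -sumr_const; apply: ler_sum => i _.
by rewrite indicE; case: (_ \in _).
Qed.

Let ExN m : mean P (N m) = (m%:R * p)%:E.
Proof.
have -> : mean P (N m) = (\sum_(j < m) mean P (fun x => \1_A (iter (k * j) T x)))%E.
  by rewrite -mean_sum//; move=> j; exact: mind.
rewrite (eq_bigr (fun=> p%:E)) => [|j _].
  by rewrite sumEFin sumr_const card_ord -[p *+ m]mulr_natl.
rewrite (mean_iter mT pT (k * j) (measurable_indic mA)) ?mean_indic//.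
by rewrite fineK ?fin_num_measure.
Qed.

(* The mean square of the number of visits to [A] at the times [0, k, ..., (m - 1) k]. *)
Fixpoint second_moment m : R :=
  if m is m'.+1 then second_moment m' + 2 * (\sum_(i < m') c (m' - i)) + p else 0.

Let ExN2 m : mean P (fun x => N m x ^+ 2) = (second_moment m)%:E.
Proof.
elim: m => [|m IH] /=.
  by rewrite -(mean_cst P 0); congr mean; apply/funext => x; rewrite /N big_ord0 expr0n.
have -> : (fun x => N m.+1 x ^+ 2) = (fun x => (N m x ^+ 2 +
   2 * (\sum_(i < m) \1_(A `&` iter (k * (m - i)) T @^-1` A) (iter (k * i) T x)))
     + \1_A (iter (k * m) T x)).
  apply/funext => x; have -> : \sum_(i < m) \1_(A `&` iter (k * (m - i)) T @^-1` A)
      (iter (k * i) T x) = N m x * \1_A (iter (k * m) T x) :> R.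
    rewrite mulr_suml; apply: eq_bigr => i _; rewrite indicI /= !indicE.
    congr (_ * (nat_of_bool _)%:R); rewrite /preimage.
    apply/idP/idP; rewrite !inE /= -iterD -mulnDr subnK//; exact: ltnW.
  have -> : N m.+1 x = N m x + \1_A (iter (k * m) T x) by rewrite /N big_ord_recr.
  rewrite sqrrD -mulr_natl; congr (_ + _ + _).
  by rewrite indicE; case: (_ \in _); rewrite /= ?expr1n ?expr0n.
have mI (i : 'I_m) : measurable_fun setT
   (fun x => \1_(A `&` iter (k * (m - i)) T @^-1` A) (iter (k * i) T x) : R).
  apply: measurableT_comp (measurable_iter mT _); apply: measurable_indic.
  by apply: measurableI => //; exact: measurable_iter_preimage.
have mS : measurable_fun setT (fun x =>
   \sum_(i < m) \1_(A `&` iter (k * (m - i)) T @^-1` A) (iter (k * i) T x) : R).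
  exact: measurable_sum.
have mS2 := measurable_funM (measurable_cst (2 : R)) mS.
have mN2 : measurable_fun setT (fun x => N m x ^+ 2) by exact: measurable_funX (mN m).
have S0 x : 0 <= \sum_(i < m) \1_(A `&` iter (k * (m - i)) T @^-1` A) (iter (k * i) T x) :> R.
  exact: sumr_ge0.
have S20 x : 0 <= 2 * \sum_(i < m) \1_(A `&` iter (k * (m - i)) T @^-1` A) (iter (k * i) T x) :> R.
  by rewrite mulr_ge0.
have N20 x : 0 <= N m x ^+ 2 by rewrite sqr_ge0.
have NS0 x : 0 <= N m x ^+ 2 +
    2 * \sum_(i < m) \1_(A `&` iter (k * (m - i)) T @^-1` A) (iter (k * i) T x) :> R.
  by rewrite addr_ge0.
have I0 x : 0 <= \1_A (iter (k * m) T x) :> R by rewrite indicE.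
rewrite (meanD P (measurable_funD mN2 mS2) (mind (k * m)) NS0 I0).
rewrite (meanD P mN2 mS2 N20 S20) (meanZ P mS S0)//.
rewrite IH mean_sum// (mean_iter mT pT (k * m) (measurable_indic mA))// mean_indic//.
rewrite (eq_bigr (fun i : 'I_m => (c (m - i))%:E)) => [|i _].
  by rewrite sumEFin /p !EFinD EFinM fineK ?fin_num_measure.
have mAI : measurable (A `&` iter (k * (m - i)) T @^-1` A).
  by apply: measurableI => //; exact: measurable_iter_preimage.
rewrite (mean_iter mT pT (k * i) (measurable_indic mAI))// mean_indic//.
by rewrite /c fineK ?fin_num_measure.
Qed.

Let count_lt m D : (\sum_(i < m) (m - i < D)%N <= D)%N.
Proof.
rewrite -(big_mkord xpredT (fun i => (m - i < D)%N : nat)) big_nat_rev /=.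
rewrite big_mkord add0n (eq_bigr (fun i : 'I_m => (i.+1 < D)%N : nat)) => [|i _].
  suff -> : (\sum_(i < m) (i.+1 < D)%N = minn m D.-1)%N by lia.
  elim: m => [|m IH]; first by rewrite big_ord0 min0n.
  by rewrite big_ord_recr /= IH; lia.
by rewrite subKn.
Qed.

(** Each new visit meets at most [D] earlier ones at index distance below [D], with correlation at
    most 1; the others contribute at most [p ^+ 2 + e] each. Hence the linear term in [m]. *)
Let second_moment_le (D m : nat) (e : R) : 0 <= e ->
  (forall j, (D <= j)%N -> c j - p ^+ 2 <= e) ->
  second_moment m <= m%:R ^+ 2 * p ^+ 2 + e * m%:R ^+ 2 + (2 * D%:R + 1) * m%:R.
Proof.
move=> e0 He.
have c1 j : c j <= 1.
  rewrite -lee_fin fineK ?fin_num_measure ?probability_le1//;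
    by apply: measurableI => //; exact: measurable_iter_preimage.
elim: m => [|m IH] /=; first by rewrite expr0n /= mulr0 !mul0r mulr0 !addr0.
have S1 : \sum_(i < m) c (m - i) <= m%:R * (p ^+ 2 + e) + D%:R.
  have -> : m%:R * (p ^+ 2 + e) = \sum_(i < m) (p ^+ 2 + e).
    by rewrite sumr_const card_ord mulr_natl.
  apply: (@le_trans _ _ (\sum_(i < m) ((p ^+ 2 + e) + (m - i < D)%:R))).
    apply: ler_sum => i _; case: ltnP => h /=.
      have := c1 (m - i)%N; have := sqr_ge0 p; lra.
    have := He _ h; lra.
  rewrite big_split /= lerD2l -natr_sum ler_nat; exact: count_lt.
rewrite -natr1; move: p01 => /andP[p0 p1]; nra.
Qed.

(** Times are multiples of [k] to serve blocks of length [k]; the correlations at times [k * j] are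
    among those that mixing controls. *)
Lemma mixing_L1_indic (eta : R) : 0 < eta -> \forall m \near \oo,
  (mean P (fun x => `|\sum_(j < m) \1_A (iter (k * j) T x) - m%:R * fine (P A)|%R)
     <= (eta * m%:R)%:E)%E.
Proof.
(* Three terms of size [(h * m) ^+ 2] are divided by [h * m] at the end: one from the square, one
   from the correlations, one bounding the linear term for large [m]. *)
move=> eta0; pose h := eta / 3; have h0 : 0 < h by rewrite divr_gt0.
have [D HD] : exists D, forall j, (D <= j)%N -> c j - p ^+ 2 <= h ^+ 2.
  have /cvgrPdist_le /(_ _ (exprn_gt0 2 h0)) [D _ HD] := mixT mA mA.
  exists D => j Dj; have /HD : (D <= k * j)%N by rewrite (leq_trans Dj)// leq_pmull.
  rewrite /= distrC /c -/p -expr2; apply: le_trans; exact: ler_norm.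
near=> m.
have m0 : 0 < m%:R :> R by rewrite ltr0n; near: m; exists 1%N.
have mbig : (2 * D%:R + 1) / h ^+ 2 <= m%:R :> R.
  near: m; exact: nbhs_infty_ger.
have mabs : measurable_fun setT (fun x => `|N m x - m%:R * p|).
  by apply: measurableT_comp => //; apply: measurable_funB => //; exact: mN.
set X := mean P (fun x => `|N m x - m%:R * p|).
have Xfin : X \is a fin_num.
  rewrite ge0_fin_numE; last by apply: mean_ge0.
  apply: (@le_lt_trans _ _ (m%:R + m%:R)%:E); last exact: ltry.
  rewrite -(mean_cst P); apply: mean_le => // x.
  rewrite (le_trans (ler_normB _ _))//= lerD//.
    rewrite (ger0_norm (N0 m x)); exact: Nle.
  by have /andP[p0' p1] := p01; rewrite (ger0_norm (mulr_ge0 (ler0n _ m) p0')) ler_piMr.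
have key : ((h * m%:R)%:E * X + (2 * m%:R * p)%:E * (m%:R * p)%:E <=
     (h * m%:R)%:E * (h * m%:R)%:E + ((second_moment m)%:E + (m%:R ^+ 2 * p ^+ 2)%:E))%E.
  case/andP: p01 => p0' p1.
  have q0 : 0 <= 2 * m%:R * p by rewrite !mulr_ge0.
  rewrite -ExN2 -ExN -(mean_cst P (m%:R ^+ 2 * p ^+ 2)) -(meanZ P (mN m))//.
  rewrite /X -meanZ//; last by rewrite mulr_ge0// ltW.
  rewrite -EFinM -(mean_cst P (h * m%:R * (h * m%:R))).
  have mN2 : measurable_fun setT (fun x => N m x ^+ 2) by exact: measurable_funX (mN m).
  have m1 : measurable_fun setT (fun x => h * m%:R * `|N m x - m%:R * p|).
    exact: measurable_funM.
  have m2 : measurable_fun setT (fun x => 2 * m%:R * p * N m x).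
    exact: measurable_funM (measurable_cst _) (mN m).
  have m4 : measurable_fun setT (fun _ : Om => h * m%:R * (h * m%:R)) by [].
  have m5 : measurable_fun setT (fun _ : Om => m%:R ^+ 2 * p ^+ 2) by [].
  have p1' x : 0 <= h * m%:R * `|N m x - m%:R * p| by rewrite !mulr_ge0// ltW.
  have p2 x : 0 <= 2 * m%:R * p * N m x by exact: mulr_ge0 q0 (N0 m x).
  have p3 (x : Om) : 0 <= h * m%:R * (h * m%:R) by rewrite -expr2 sqr_ge0.
  have p4 x : 0 <= N m x ^+ 2 by rewrite sqr_ge0.
  have p5 (x : Om) : 0 <= m%:R ^+ 2 * p ^+ 2 by rewrite mulr_ge0// sqr_ge0.
  have p6 x : 0 <= N m x ^+ 2 + m%:R ^+ 2 * p ^+ 2 by rewrite addr_ge0// p5.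
  rewrite -(meanD P m1 m2 p1' p2) -(meanD P mN2 m5 p4 p5).
  have m3 : measurable_fun setT (fun x => N m x ^+ 2 + m%:R ^+ 2 * p ^+ 2).
    exact: measurable_funD.
  rewrite -(meanD P m4 m3 p3 p6).
  apply: mean_le.
  - exact: measurable_funD m1 m2.
  - exact: measurable_funD m4 m3.
  - by move=> x; rewrite addr_ge0.
  - by move=> x; apply: amgm_deviation; rewrite mulr_ge0// ltW.
move: key; rewrite -(fineK Xfin) -!EFinM -!EFinD !lee_fin => key.
have := second_moment_le m (exprn_ge0 2 (ltW h0)) HD => sm.
rewrite ler_pdivrMr ?exprn_gt0// in mbig.
have -> : eta * m%:R = 3 * h * m%:R by congr (_ * _); rewrite /h mulrC divfK.
exact: deviation_le key sm mbig.
Unshelve. all: by end_near. Qed.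

End indicator.

End ergodic_averages.

(** * Shannon-McMillan theorem in probability *)

Lemma upper_budget (R : realType) (e N m K : R) :
  e / 4 * m <= e / 4 * (N + 1) -> e / 4 + 1 + K <= N * (e / 4) -> 0 <= e * N ->
  e / 4 * m + 1 + (K + N * (e / 4)) <= e * N.
Proof. lra. Qed.

Section shannon_mcmillan.
Context d (Om : measurableType d) (R : realType) (P : probability Om R).
Variable T : Om -> Om.
Hypothesis mT : measurable_fun setT T.
Hypothesis pT : forall A, measurable A -> P (T @^-1` A) = P A.
Hypothesis mixT : forall A B, measurable A -> measurable B ->
  (fun n => fine (P (A `&` iter n T @^-1` B))) @ \oo --> fine (P A) * fine (P B).

Lemma mixing_L1_simple (C : Type) (xi : Om -> C) (g : C -> R) (s : seq C) k (eta : R) :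
  measurable_label xi -> (forall c, 0 <= g c) -> (0 < k)%N -> 0 < eta -> \forall m \near \oo,
  (mean P (fun x => \sum_(c <- s) g c *
     `|\sum_(j < m) \1_(xi @^-1` [set c]) (iter (k * j) T x) - m%:R * label_prob P xi c|)%R
     <= (eta * m%:R)%:E)%E.
Proof.
move=> mx g0 k0; elim: s eta => [|c s IH] eta eta0.
  near=> m; rewrite (_ : (fun x => _) = fun=> 0); last by apply/funext => x; rewrite big_nil.
  by rewrite mean_cst lee_fin mulr_ge0// ltW.
have e2 : 0 < eta / 2 by rewrite divr_gt0.
have e3 : 0 < eta / 2 / (g c + 1) by rewrite divr_gt0// ltr_wpDl.
have mabs m c' : measurable_fun setT (fun x => g c' *
     `|\sum_(j < m) \1_(xi @^-1` [set c']) (iter (k * j) T x) - m%:R * label_prob P xi c'|).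
  apply: measurable_funM => //; apply: measurableT_comp => //; apply: measurable_funB => //.
  apply: measurable_sum => j.
  exact: measurableT_comp (measurable_indic (mx _)) (measurable_iter mT (k * j)).
have abs0 m c' x : 0 <= g c' *
     `|\sum_(j < m) \1_(xi @^-1` [set c']) (iter (k * j) T x) - m%:R * label_prob P xi c'|.
  by rewrite mulr_ge0.
have := mixing_L1_indic mT pT mixT (mx [set c]) k0 e3.
have := IH _ e2.
apply: filterS2 => m h1 h2.
rewrite (_ : (fun x => _) = (fun x => g c *
     `|\sum_(j < m) \1_(xi @^-1` [set c]) (iter (k * j) T x) - m%:R * label_prob P xi c| +
     \sum_(c <- s) g c *
     `|\sum_(j < m) \1_(xi @^-1` [set c]) (iter (k * j) T x) - m%:R * label_prob P xi c|)); last first.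
  by apply/funext => x; rewrite big_cons.
rewrite meanD//; last 2 first.
- exact: measurable_sum.
- by move=> x; apply: sumr_ge0.
rewrite (_ : eta * m%:R = eta / 2 * m%:R + eta / 2 * m%:R); last by rewrite -mulrDl -splitr.
rewrite EFinD; apply: leeD => //.
rewrite meanZ//; last first.
  apply: measurableT_comp => //; apply: measurable_funB => //.
  apply: measurable_sum => j.
  exact: measurableT_comp (measurable_indic (mx _)) (measurable_iter mT (k * j)).
apply: (@le_trans _ _ ((g c)%:E * (eta / 2 / (g c + 1) * m%:R)%:E)%E).
  by apply: lee_wpmul2l => //; rewrite lee_fin.
rewrite -EFinM lee_fin mulrA ler_wpM2r// mulrCA ler_piMr ?(ltW e2)//.
by rewrite ler_pdivrMr ?ltr_wpDl// mul1r lerDl.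
Unshelve. all: by end_near. Qed.

(** An unbounded [g] is cut to finitely many labels, where visits are controlled, plus a tail of
    small mean. Bounding only the positive part lets the truncated mean be replaced by the larger
    [c]. *)
Lemma ergodic_upper (C : countType) (xi : Om -> C) (g : C -> R) (c : R) k (eta : R) :
  measurable_label xi -> (forall c, 0 <= g c) -> mean P (g \o xi) = c%:E -> (0 < k)%N -> 0 < eta ->
  \forall m \near \oo,
  (mean P (fun x => Num.max 0 (\sum_(j < m) g (xi (iter (k * j) T x)) - m%:R * c))%R
     <= (eta * m%:R)%:E)%E.
Proof.
move=> mx g0 Eg k0 eta0.
have e2 : 0 < eta / 2 by rewrite divr_gt0.
have mg : measurable_fun setT (g \o xi) by exact: measurable_label_fun.
have [|K HK] := @mean_tail _ _ _ P (g \o xi) (@pickle C \o xi) _ mg (fun x => g0 _) _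
  (measurable_label_comp (@pickle C) mx) e2.
  by rewrite Eg ltry.
pose s := pmap (@pickle_inv C) (iota 0 K).
have us : uniq s.
  apply: (@pmap_uniq _ _ _ (@pickle C)); last exact: iota_uniq.
  exact: pickle_invK.
have ins x : (xi x \in s) = (pickle (xi x) < K)%N.
  rewrite /s mem_pmap; apply/mapP/idP => [[i]|h].
    rewrite mem_iota add0n => /= iK /esym h.
    by have := @pickle_invK C i; rewrite /oapp h /= => ->.
  by exists (pickle (xi x)); [rewrite mem_iota|rewrite pickleK_inv].
pose tl x := g (xi x) * (K <= pickle (xi x))%:R.
have mtl : measurable_fun setT tl.
  exact: (measurable_label_fun (fun c => g c * (K <= pickle c)%:R) mx).
have tl0 x : 0 <= tl x by rewrite mulr_ge0.
have gE x : g (xi x) = \sum_(a <- s) g a * \1_(xi @^-1` [set a]) x + tl x.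
  rewrite /tl leqNgt -ins; have [xs|xs] := boolP (xi x \in s).
    rewrite mulr0 addr0 (bigD1_seq (xi x))//= big1 ?addr0 ?indicE ?mem_set ?mulr1// => a ax.
    by rewrite indicE memNset ?mulr0//= => xa; rewrite xa eqxx in ax.
  rewrite mulr1 big_seq big1 ?add0r// => a as_.
  by rewrite indicE memNset ?mulr0//= => xa; rewrite xa as_ in xs.
have mind a : measurable_fun setT (fun x => g a * \1_(xi @^-1` [set a]) x : R).
  by apply: measurable_funM => //; exact: measurable_indic.
have ind0 a x : 0 <= g a * \1_(xi @^-1` [set a]) x :> R by rewrite mulr_ge0// indicE.
have cge : \sum_(a <- s) g a * label_prob P xi a <= c.
  rewrite -lee_fin -Eg (_ : g \o xi = fun x => \sum_(a <- s) g a * \1_(xi @^-1` [set a]) x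
    + tl x); last by apply/funext => x /=; rewrite gE.
  rewrite meanD//; last 2 first.
  - exact: measurable_sum.
  - by move=> x; apply: sumr_ge0.
  rewrite mean_sum// -[X in (X <= _)%E]adde0; apply: leeD; last by apply: mean_ge0.
  rewrite -sumEFin; apply: lee_sum => a _.
  by rewrite meanZ ?mean_indic ?label_probE//.
have mabs m a : measurable_fun setT (fun x => g a *
     `|\sum_(j < m) \1_(xi @^-1` [set a]) (iter (k * j) T x) - m%:R * label_prob P xi a|).
  apply: measurable_funM => //; apply: measurableT_comp => //; apply: measurable_funB => //.
  apply: measurable_sum => j.
  exact: measurableT_comp (measurable_indic (mx _)) (measurable_iter mT (k * j)).
have := mixing_L1_simple s mx g0 k0 e2; apply: filterS => m Hm.
have mtlj m' : measurable_fun setT (fun x => \sum_(j < m') tl (iter (k * j) T x)).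
  by apply: measurable_sum => j; exact: measurableT_comp mtl (measurable_iter mT (k * j)).
apply: (@le_trans _ _ (mean P (fun x => \sum_(a <- s) g a *
    `|\sum_(j < m) \1_(xi @^-1` [set a]) (iter (k * j) T x) - m%:R * label_prob P xi a|
    + \sum_(j < m) tl (iter (k * j) T x))%R)).
  apply: mean_le.
  - apply: measurable_maxr => //; apply: measurable_funB => //.
    apply: measurable_sum => j; exact: measurableT_comp mg (measurable_iter mT (k * j)).
  - by apply: measurable_funD => //; exact: measurable_sum.
  - by move=> x; rewrite le_max lexx.
  - move=> x; rewrite ge_max; apply/andP; split.
      by apply: addr_ge0; apply: sumr_ge0 => // a _; rewrite mulr_ge0.
    rewrite (eq_bigr _ (fun (j : 'I_m) _ => gE (iter (k * j) T x))) big_split /=.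
    rewrite addrAC lerD2r exchange_big /=.
    apply: (@le_trans _ _ (\sum_(a <- s) (\sum_(j < m) g a *
       \1_(xi @^-1` [set a]) (iter (k * j) T x)) - m%:R * \sum_(a <- s) g a * label_prob P xi a)).
      by rewrite lerD2l lerN2 ler_wpM2l.
    rewrite mulr_sumr -sumrB; apply: ler_sum => a _.
    rewrite -mulr_sumr mulrCA -mulrBr ler_wpM2l//; exact: ler_norm.
rewrite meanD//; last 3 first.
- exact: measurable_sum.
- by move=> x; apply: sumr_ge0 => a _; rewrite mulr_ge0.
- by move=> x; apply: sumr_ge0.
rewrite (_ : eta * m%:R = eta / 2 * m%:R + eta / 2 * m%:R); last by rewrite -mulrDl -splitr.
rewrite EFinD; apply: leeD => //.
rewrite mean_sum//; last by move=> j; exact: measurableT_comp mtl (measurable_iter mT (k * j)).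
rewrite (eq_bigr (fun=> mean P tl)) => [|j _]; last first.
  exact: (mean_iter mT pT (k * j) mtl tl0).
apply: (@le_trans _ _ (m%:R%:E * mean P tl)%E).
  by rewrite sumr_const card_ord mule_natl.
rewrite EFinM [leRHS]muleC; exact: lee_wpmul2l.
Qed.

Variables (C : countType) (xi : Om -> C).
Hypothesis mx : measurable_label xi.
Hypothesis fin1 : (word_entropy P T xi 1 < +oo)%E.

Local Notation W n := (word T xi n).
Local Notation mW n := (measurable_label_word mT mx n).

Definition word_rentropy n : R := fine (word_entropy P T xi n).

Lemma word_entropy_ge0 n : (0 <= word_entropy P T xi n)%E.
Proof. exact: label_entropy_ge0 (mW n). Qed.

Lemma word_rentropyE n : word_entropy P T xi n = (word_rentropy n)%:E.
Proof.
rewrite fineK// ge0_fin_numE ?word_entropy_ge0//.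
have := word_entropy_blocks mT pT mx 1 n; rewrite muln1 => /le_lt_trans; apply.
have : word_entropy P T xi 1 \is a fin_num by rewrite ge0_fin_numE ?word_entropy_ge0.
by move=> /fineK <-; rewrite -EFinM ltry.
Qed.

Lemma word_rentropy_ge0 n : 0 <= word_rentropy n.
Proof. by rewrite fine_ge0// word_entropy_ge0. Qed.

(** An infimum makes [N * entropy_rate <= word_rentropy N] hold for every [N], which the lower bound
    on information needs; that it is also the limit follows from the upper bound. *)
Definition entropy_rate : R := inf (range (fun n => word_rentropy n.+1 / n.+1%:R)).

Lemma entropy_rate_has_inf : has_inf (range (fun n => word_rentropy n.+1 / n.+1%:R)).
Proof.
split; first by exists (word_rentropy 1 / 1%:R); exists 0%N.
by exists 0 => _ [n _ <-]; rewrite divr_ge0// word_rentropy_ge0.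
Qed.

Lemma entropy_rate_ge0 : 0 <= entropy_rate.
Proof.
apply: lb_le_inf; first exact: entropy_rate_has_inf.1.
by move=> _ [n _ <-]; rewrite divr_ge0// word_rentropy_ge0.
Qed.

Lemma entropy_rate_le n : n%:R * entropy_rate <= word_rentropy n.
Proof.
case: n => [|n]; first by rewrite mul0r word_rentropy_ge0.
rewrite -ler_pdivlMl// mulrC; apply: ge_inf; first exact: entropy_rate_has_inf.2.
by exists n.
Qed.

Lemma entropy_rate_approx (e : R) : 0 < e -> exists2 k, (0 < k)%N & word_rentropy k <= k%:R * (entropy_rate + e).
Proof.
move=> e0; have [_ [n _ <-] h] := inf_adherent e0 entropy_rate_has_inf.
by exists n.+1 => //; rewrite -ler_pdivrMl// mulrC ltW.
Qed.

Lemma info_upper_L1 (e : R) : 0 < e -> \forall N \near \oo,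
  (mean P (fun x => Num.max 0 (info P (W N) x - N%:R * entropy_rate))%R <= (e * N%:R)%:E)%E.
Proof.
move=> e0; have e4 : 0 < e / 4 by rewrite divr_gt0.
have [k k0 Hk] := entropy_rate_approx e4.
have Ek : mean P ((fun c => - ln (label_prob P (W k) c)) \o W k) = (word_rentropy k)%:E by rewrite -word_rentropyE.
have gk0 c : 0 <= - ln (label_prob P (W k) c).
  by rewrite oppr_ge0 ln_le0//; have /andP[] := label_prob_word01 P mT mx k c.
have [M _ HM] := ergodic_upper (mW k) gk0 Ek k0 e4.
near=> N.
(* [m * k] is the first multiple of [k] strictly above [N]: the longer word determines the word of
   length [N] and has at most [k] extra letters. *)
pose m := (N %/ k).+1.
have Nm : (N <= m * k)%N by rewrite ltnW// ltn_ceil.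
have mN : (m * k <= N + k)%N by rewrite mulSn addnC leq_add2r leq_divM.
have mM : (M <= m)%N.
  apply: leqW; rewrite leq_divRL//; near: N; exact: nbhs_infty_ge.
have [r [mr r0 r1 rE]] := info_blocks mT pT mx k m.
have mS : measurable_fun setT (fun x => Num.max 0
    (\sum_(j < m) info P (W k) (iter (k * j) T x) - m%:R * word_rentropy k)).
  apply: measurable_maxr => //; apply: measurable_funB => //.
  apply: measurable_sum => j; exact: measurableT_comp (measurable_info P (mW k)) (measurable_iter mT (k * j)).
have S0 x : 0 <= Num.max 0 (\sum_(j < m) info P (W k) (iter (k * j) T x) - m%:R * word_rentropy k).
  by rewrite le_max lexx.
(* Bounds [m * word_rentropy k - N * entropy_rate], by [m * k <= N + k] and the choice of [k]. *)
pose b := k%:R * (entropy_rate + e / 4) + N%:R * (e / 4).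
have b0 : 0 <= b.
  by rewrite addr_ge0 ?mulr_ge0 ?addr_ge0 ?entropy_rate_ge0 // ltW.
apply: (@le_trans _ _ (mean P (fun x => (Num.max 0
    (\sum_(j < m) info P (W k) (iter (k * j) T x) - m%:R * word_rentropy k) + r x) + b)%R)).
  apply: (mean_ae_le _ _ _ _ (mW (m * k) _) (prl0_null P (mW (m * k)))).
  - apply: measurable_maxr => //; apply: measurable_funB => //.
    exact: measurable_info (mW N).
  - by apply: measurable_funD => //; exact: measurable_funD.
  - by move=> x; rewrite le_max lexx.
  - by move=> x; exact: addr_ge0 (addr_ge0 (S0 x) (r0 x)) b0.
  move=> x /= /eqP px; rewrite ge_max; apply/andP; split.
    exact: addr_ge0 (addr_ge0 (S0 x) (r0 x)) b0.
  have h1 : info P (W N) x <= info P (W (m * k)) x.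
    apply: info_mono => //; [exact: (mW _)|exact: (mW _)|move=> y /(congr1 (take N))].
    by rewrite -(subnKC Nm) !take_word.
  have h2 := rE x.
  have h3 : \sum_(j < m) info P (W k) (iter (k * j) T x) - m%:R * word_rentropy k <=
    Num.max 0 (\sum_(j < m) info P (W k) (iter (k * j) T x) - m%:R * word_rentropy k).
    by rewrite le_max lexx orbT.
  have h4 : m%:R * word_rentropy k <= (N%:R + k%:R) * (entropy_rate + e / 4).
    apply: (@le_trans _ _ (m%:R * (k%:R * (entropy_rate + e / 4)))); first exact: ler_wpM2l.
    rewrite mulrA ler_wpM2r ?addr_ge0 ?entropy_rate_ge0// ?(ltW e4)//.
    by rewrite -natrM -natrD ler_nat.
  rewrite /b; lra.
rewrite meanD//; last 2 first.
- exact: measurable_funD.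
- by move=> x; rewrite addr_ge0.
rewrite meanD// mean_cst.
apply: (@le_trans _ _ ((e / 4 * m%:R)%:E + 1 + b%:E)%E).
  by apply: leeD => //; apply: leeD => //; exact: HM.
rewrite -!EFinD lee_fin.
have h5 : m%:R <= N%:R + 1 :> R by rewrite natr1 ler_nat /m ltnS leq_div.
have h6 : e / 4 * m%:R <= e / 4 * (N%:R + 1) by rewrite ler_pM2l.
have h7 : (e / 4 + 1 + k%:R * (entropy_rate + e / 4)) / (e / 4) <= N%:R.
  near: N; exact: nbhs_infty_ger.
rewrite ler_pdivrMr// in h7; rewrite /b.
have h8 : 0 <= e * N%:R by rewrite mulr_ge0// ltW.
exact: upper_budget h6 h7 h8.
Unshelve. all: by end_near. Qed.

(** Positive and negative parts differ by [info - N * entropy_rate], whose mean is nonnegative;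
    hence the negative part has the smaller mean. *)
Lemma info_lower_L1 (e : R) : 0 < e -> \forall N \near \oo,
  (mean P (fun x => Num.max 0 (N%:R * entropy_rate - info P (W N) x))%R <= (e * N%:R)%:E)%E.
Proof.
move=> e0; have := info_upper_L1 e0; apply: filterS => N HN.
set U := mean P _ in HN; set L := mean P _.
have mi := measurable_info P (mW N).
have i0 x : 0 <= info P (W N) x by exact: info_ge0 (mW N).
have Nh : 0 <= N%:R * entropy_rate by rewrite mulr_ge0 ?entropy_rate_ge0.
have mU : measurable_fun setT (fun x => Num.max 0 (info P (W N) x - N%:R * entropy_rate)).
  by apply: measurable_maxr => //; exact: measurable_funB.
have mL : measurable_fun setT (fun x => Num.max 0 (N%:R * entropy_rate - info P (W N) x)).
  by apply: measurable_maxr => //; exact: measurable_funB.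
have U0 x : 0 <= Num.max 0 (info P (W N) x - N%:R * entropy_rate) by rewrite le_max lexx.
have L0 x : 0 <= Num.max 0 (N%:R * entropy_rate - info P (W N) x) by rewrite le_max lexx.
have : (L + word_entropy P T xi N = U + (N%:R * entropy_rate)%:E)%E.
  rewrite -(mean_cst P (N%:R * entropy_rate)) -!meanD//; congr mean; apply/funext => x.
  by rewrite !maxEle; case: ifPn; case: ifPn; rewrite ?subr_le0 ?subr_ge0 -?ltNge; lra.
rewrite word_rentropyE => LU.
apply: le_trans HN; rewrite -(leeD2rE (x := (word_rentropy N)%:E))// LU leeD2lE ?lee_fin ?entropy_rate_le//.
have : (0 <= U < +oo)%E.
  rewrite mean_ge0//=; apply: le_lt_trans (ltry (word_rentropy N)); rewrite -word_rentropyE.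
  apply: mean_le => // x; rewrite ge_max i0 /=; lra.
by case/andP => ? ?; rewrite ge0_fin_numE.
Qed.

Lemma prob_info_upper (e dl : R) : 0 < e -> 0 < dl -> \forall N \near \oo,
  (P [set x | N%:R * (entropy_rate + e) <= info P (W N) x]%R <= dl%:E)%E.
Proof.
move=> e0 dl0; have := info_upper_L1 (mulr_gt0 e0 dl0) => HN.
near=> N.
have N0 : 0 < N%:R :> R by rewrite ltr0n; near: N; exists 1%N.
have mi := measurable_info P (mW N).
have mU : measurable_fun setT (fun x => Num.max 0 (info P (W N) x - N%:R * entropy_rate)).
  by apply: measurable_maxr => //; exact: measurable_funB.
have eN : 0 < e * N%:R by rewrite mulr_gt0.
rewrite -(@lee_pmul2l _ (e * N%:R)%:E)//.
have -> : [set x | N%:R * (entropy_rate + e) <= info P (W N) x] =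
   [set x | e * N%:R <= Num.max 0 (info P (W N) x - N%:R * entropy_rate)].
  apply/seteqP; split => x /=; rewrite le_max (leNgt (e * N%:R) 0) eN /=; lra.
have U0 x : 0 <= Num.max 0 (info P (W N) x - N%:R * entropy_rate) by rewrite le_max lexx.
apply: (le_trans (mean_markov P mU U0 (ltW eN))).
rewrite -EFinM mulrAC; near: N; exact: HN.
Unshelve. all: by end_near. Qed.

Lemma prob_info_lower (e dl : R) : 0 < e -> 0 < dl -> \forall N \near \oo,
  (P [set x | info P (W N) x <= N%:R * (entropy_rate - e)]%R <= dl%:E)%E.
Proof.
move=> e0 dl0; have := info_lower_L1 (mulr_gt0 e0 dl0) => HN.
near=> N.
have N0 : 0 < N%:R :> R by rewrite ltr0n; near: N; exists 1%N.
have mi := measurable_info P (mW N).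
have mU : measurable_fun setT (fun x => Num.max 0 (N%:R * entropy_rate - info P (W N) x)).
  by apply: measurable_maxr => //; exact: measurable_funB.
have eN : 0 < e * N%:R by rewrite mulr_gt0.
rewrite -(@lee_pmul2l _ (e * N%:R)%:E)//.
have -> : [set x | info P (W N) x <= N%:R * (entropy_rate - e)] =
   [set x | e * N%:R <= Num.max 0 (N%:R * entropy_rate - info P (W N) x)].
  apply/seteqP; split => x /=; rewrite le_max (leNgt (e * N%:R) 0) eN /=; lra.
have U0 x : 0 <= Num.max 0 (N%:R * entropy_rate - info P (W N) x) by rewrite le_max lexx.
apply: (le_trans (mean_markov P mU U0 (ltW eN))).
rewrite -EFinM mulrAC; near: N; exact: HN.
Unshelve. all: by end_near. Qed.

Lemma word_rentropy_upper (e : R) : 0 < e -> \forall N \near \oo, word_rentropy N <= N%:R * (entropy_rate + e).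
Proof.
move=> e0; have := info_upper_L1 e0; apply: filterS => N HN.
have Nh : 0 <= N%:R * entropy_rate by rewrite mulr_ge0 ?entropy_rate_ge0.
have mi := measurable_info P (mW N).
have mU : measurable_fun setT (fun x => Num.max 0 (info P (W N) x - N%:R * entropy_rate)).
  by apply: measurable_maxr => //; exact: measurable_funB.
rewrite -lee_fin -word_rentropyE.
apply: (@le_trans _ _ (mean P (fun x => Num.max 0 (info P (W N) x - N%:R * entropy_rate)
   + N%:R * entropy_rate)%R)).
  apply: mean_le => //.
  - exact: measurable_funD.
  - by move=> x; exact: info_ge0 (mW N).
  - by move=> x; rewrite -lerBlDr le_max lexx orbT.
rewrite meanD//; last by move=> x; rewrite le_max lexx.
by rewrite mean_cst mulrDr EFinD [leRHS]addeC (mulrC _ e) leeD2r.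
Qed.

Lemma word_rentropy_cvg : (fun n => word_rentropy n.+1 / n.+1%:R) @ \oo --> entropy_rate.
Proof.
apply/cvgrPdist_le => e e0; have [M _ HM] := word_rentropy_upper e0.
exists M => // n /= Mn; have := HM n.+1 (leqW Mn); rewrite -ler_pdivrMl// => h2.
have := entropy_rate_le n.+1; rewrite -ler_pdivlMl// => h1.
rewrite [word_rentropy _ / _]mulrC distrC ger0_norm; [rewrite lerBlDl|rewrite subr_ge0].
  exact: h2.
exact: h1.
Qed.

End shannon_mcmillan.

(** * Entropy and noisy channels *)

Section channels.
Context (R : realType).

Lemma subprobability_le (C : eqType) (q q' : C -> R) :
  (forall c, 0 <= q c) -> (forall c, q c <= q' c) -> subprobability q' -> subprobability q.
Proof.
move=> q0 qq' [_ q1]; split=> // s us; apply: le_trans (q1 s us).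
exact: ler_sum.
Qed.

Lemma subprobability_delta (C : eqType) (a : C) : subprobability (fun c => (c == a)%:R : R).
Proof.
split=> [c|s us]; first exact: ler0n.
have [as_|as_] := boolP (a \in s).
  by rewrite (bigD1_seq a)//= eqxx big1 ?addr0// => c /negPf ->.
by rewrite big_seq big1// => c cs; case: eqP => // ca; rewrite -ca cs in as_.
Qed.

Lemma subprobability_option (C : eqType) (q : C -> R) : subprobability q ->
  subprobability (fun o => if o is Some c then q c else 0).
Proof.
move=> [q0 q1]; split=> [[c|]//|s us].
have -> : \sum_(o <- s) (if o is Some c then q c else 0) = \sum_(c <- pmap id s) q c.
  elim: s {us} => [|[c|] s IH]; first by rewrite !big_nil.
  - by rewrite /= !big_cons IH.
  - by rewrite /= big_cons add0r IH.
by apply: q1; apply: (@pmap_uniq _ _ id Some) => // -[].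
Qed.

(** The law of the output [w] of a memoryless channel with transition law [s] on input [u]; words of
    another length get mass 0. *)
Fixpoint channel_prob (E C : Type) (s : E -> C -> R) (u : seq E) (w : seq C) : R :=
  match u, w with
  | [::], [::] => 1
  | e :: u', c :: w' => s e c * channel_prob s u' w'
  | _, _ => 0
  end.

Lemma subprobability_chanq (E C : eqType) (s : E -> C -> R) u :
  (forall e, subprobability (s e)) -> subprobability (channel_prob s u).
Proof.
move=> Hs; elim: u => [|e u IH].
  apply: (subprobability_le _ _ (subprobability_delta [::])) => -[|c w] //=.
have -> : channel_prob s (e :: u) = fun w => (if ohead w is Some c then s e c else 0) *
    channel_prob s u (behead w).
  by apply/funext => -[|c w]//=; rewrite mul0r.
apply: (@subprobability_pair _ _ _ _ (fun o => if o is Some c then s e c else 0)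
  (fun=> channel_prob s u)) => //.
- exact: subprobability_option.
- by move=> [|c w] [|c' w'] //= [->] ->.
Qed.

End channels.

Section channel_entropy.
Context d (Om : measurableType d) (R : realType) (P : probability Om R).
Variable T : Om -> Om.
Hypothesis mT : measurable_fun setT T.
Hypothesis pT : forall A, measurable A -> P (T @^-1` A) = P A.

(** Gibbs' inequality for the pair of [eta] and the output word, against the law of [eta] followed
    by the channel. The second term on the right plays the role of a conditional entropy, and
    stationarity makes it [N] equal contributions. *)
Lemma channel (D E C : countType) (eta : Om -> D) (theta : Om -> E) (zeta : Om -> C)
    (s : E -> C -> R) (uf : D -> seq E) N :
  measurable_label eta -> measurable_label theta -> measurable_label zeta -> (forall e, subprobability (s e)) ->
  (forall e c, 0 < label_prob P (fun x => (theta x, zeta x)) (e, c) -> 0 < s e c) ->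
  (forall x, uf (eta x) = word T theta N x) ->
  (word_entropy P T zeta N <= label_entropy P eta +
     N%:R%:E * mean P (fun x => - ln (s (theta x) (zeta x)))%R)%E.
Proof.
move=> me mt mz Hs pos Huf.
have s01 e c : 0 <= s e c <= 1 by rewrite (Hs e).1 subprobability_le1.
have c01 u w : 0 <= channel_prob s u w <= 1.
  by have Hc := subprobability_chanq u Hs; rewrite Hc.1 subprobability_le1.
pose J x := (eta x, word T zeta N x).
have mJ : measurable_label J by apply: measurable_label_pair => //; exact: measurable_label_word.
pose q (p : D * seq C) := label_prob P eta p.1 * channel_prob s (uf p.1) p.2.
have Hq : subprobability q.
  apply: (@subprobability_pair _ _ _ _ (label_prob P eta) (fun d => channel_prob s (uf d)) fst snd).
  - exact: subprobability_prl.
  - by move=> a; exact: subprobability_chanq.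
  - by move=> [? ?] [? ?] /= -> ->.
have mtz : measurable_label (fun x => (theta x, zeta x)) by exact: measurable_label_pair.
have chan_pos n x : (forall j, (j < n)%N -> 0 < s (theta (iter j T x)) (zeta (iter j T x))) ->
    0 < channel_prob s (word T theta n x) (word T zeta n x).
  elim: n x => [|n IH] x pj; first by rewrite /= ltr01.
  rewrite !wordS /=; apply: mulr_gt0; first exact: (pj 0%N).
  by apply: IH => j jn; rewrite -iterSr; exact: pj.
have chan_gt0 x : 0 < label_prob P J (J x) -> 0 < channel_prob s (word T theta N x) (word T zeta N x).
  move=> pJ.
  have pos_j j : (j < N)%N -> 0 < s (theta (iter j T x)) (zeta (iter j T x)).
    move=> jN; apply: pos; rewrite -(label_prob_iter mT pT j _ mtz).
    apply: lt_le_trans pJ _; rewrite fine_le ?fin_num_measure//.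
    - exact: (measurable_label_iter mT j mtz).
    - rewrite le_measure ?inE//; first exact: (measurable_label_iter mT j mtz).
      move=> y /= [ey wy]; congr (_, _); last first.
        by rewrite -(nth_word T zeta (zeta y) _ jN) wy nth_word.
      by rewrite -(nth_word T theta (theta y) _ jN) -Huf ey Huf nth_word.
  exact: chan_pos.
have qpos c : 0 < label_prob P J c -> 0 < q c.
  move=> pc.
  have [x Jx] : exists x, J x = c.
    apply: contrapT => nx; move: pc; rewrite /label_prob (_ : _ @^-1` _ = set0) ?measure0 ?ltxx//.
    by rewrite -subset0 => y /= Jy; apply: nx; exists y.
  rewrite -Jx /q /= Huf mulr_gt0//; last by rewrite chan_gt0// Jx.
  rewrite -Jx in pc; apply: lt_le_trans pc _.
  by apply: label_prob_mono => // y [].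
have [r [mr r0 r1 rE]] := gibbs mJ Hq qpos.
have chan_ln n x : - ln (channel_prob s (word T theta n x) (word T zeta n x)) <=
    \sum_(j < n) - ln (s (theta (iter j T x)) (zeta (iter j T x))).
  elim: n x => [|n IH] x; first by rewrite big_ord0 /= ln1 oppr0.
  rewrite !wordS /= big_ord_recl; apply: le_trans (lnM_ge _ _) _ => //.
  apply: lerD => //; apply: le_trans (IH _) _; apply: ler_sum => j _.
  by rewrite -iterSr.
have mls : measurable_fun setT (fun x => - ln (s (theta x) (zeta x))).
  exact: (measurable_label_fun (fun p => - ln (s p.1 p.2)) mtz).
have ls0 x : 0 <= - ln (s (theta x) (zeta x)).
  by rewrite oppr_ge0 ln_le0//; case/andP: (s01 (theta x) (zeta x)).
have mlsj j : measurable_fun setT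
    (fun x => - ln (s (theta (iter j T x)) (zeta (iter j T x)))).
  exact: measurableT_comp mls (measurable_iter mT j).
have mS : measurable_fun setT
    (fun x => \sum_(j < N) - ln (s (theta (iter j T x)) (zeta (iter j T x)))).
  exact: measurable_sum.
have S0 x : 0 <= \sum_(j < N) - ln (s (theta (iter j T x)) (zeta (iter j T x))).
  by apply: sumr_ge0 => j _; exact: ls0.
have mi := measurable_info P me; have mij := measurable_info P mJ.
have i0 x : 0 <= info P eta x by exact: info_ge0.
have ij0 x : 0 <= info P J x by exact: info_ge0.
apply: (@le_trans _ _ (label_entropy P J)).
  by apply: label_entropy_mono => //; [exact: measurable_label_word|move=> x y [_ ->]].
have main : (label_entropy P J + 1 <= (label_entropy P eta +
    mean P (fun x => \sum_(j < N) - ln (s (theta (iter j T x)) (zeta (iter j T x))))%R) + 1)%E.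
  rewrite -{1}(mean_cst P 1) -!meanD//.
  apply: (@le_trans _ _ (mean P (fun x => (info P eta x +
    \sum_(j < N) - ln (s (theta (iter j T x)) (zeta (iter j T x)))) + r x)%R)).
    apply: mean_le.
    - exact: measurable_funD.
    - by apply: measurable_funD => //; exact: measurable_funD.
    - by move=> x; rewrite addr_ge0.
    - move=> x; apply: le_trans (rE x) _; rewrite lerD2r /q /= Huf.
      apply: le_trans (lnM_ge _ (c01 _ _)) _; first by rewrite label_prob_ge0 label_prob_le1.
      by rewrite lerD2l.
  rewrite meanD//.
  - by rewrite leeD2l.
  - exact: measurable_funD.
  - by move=> x; rewrite addr_ge0.
rewrite leeD2rE// in main; apply: le_trans main _; rewrite leeD2l// mean_sum//.
rewrite (eq_bigr (fun=> mean P (fun x => - ln (s (theta x) (zeta x))))) => [|j _].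
  by rewrite sumr_const card_ord mule_natl.
exact: (mean_iter mT pT j mls ls0).
Qed.

End channel_entropy.

(** * Comparison of entropy rates *)

Section rates.
Context d (Om : measurableType d) (R : realType) (P : probability Om R).
Variable T : Om -> Om.
Hypothesis mT : measurable_fun setT T.
Hypothesis pT : forall A, measurable A -> P (T @^-1` A) = P A.

Lemma Hw1_fin (C : countType) (xi : Om -> C) : measurable_label xi ->
  (label_entropy P xi < +oo)%E -> (word_entropy P T xi 1 < +oo)%E.
Proof.
move=> mx; apply: le_lt_trans; apply: label_entropy_mono => //; first exact: measurable_label_word.
by move=> x y /= xy; rewrite /word /= xy.
Qed.

Lemma label_entropy_fin (C : finType) (xi : Om -> C) : measurable_label xi -> (label_entropy P xi < +oo)%E.
Proof.
move=> mx; have g0 c : 0 <= - ln (label_prob P xi c) by rewrite oppr_ge0 ln_le0 ?label_prob_le1.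
have -> : label_entropy P xi = mean P ((fun c => - ln (label_prob P xi c)) \o xi) by [].
by rewrite mean_lab_fin// ltry.
Qed.

(** Truncation loses only the information of labels [>= M], whose mean is small for large [M] by
    integrability. It turns a countable partition into a finite one, as the definition of entropy
    demands. *)
Lemma coarse_rate (xi : Om -> nat) (e : R) : measurable_label xi -> (label_entropy P xi < +oo)%E -> 0 < e ->
  exists M, entropy_rate P T xi <= entropy_rate P T (minn M \o xi) + e.
Proof.
move=> mx fx e0; have e2 : 0 < e / 2 by rewrite divr_gt0.
have i0 x : 0 <= info P xi x by exact: info_ge0.
have [M HM] := mean_tail (measurable_info P mx) i0 fx mx e2.
exists M; have mz : measurable_label (minn M \o xi) by exact: measurable_label_comp.
have fz : (label_entropy P (minn M \o xi) < +oo)%E.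
  by apply: le_lt_trans fx; apply: label_entropy_mono => // x y /= ->.
(* Given the truncated label, labels below [M] cost nothing and the others their information. *)
pose s (b a : nat) : R := if b == minn M a then (if (a < M)%N then 1 else label_prob P xi a) else 0.
have Hs b : subprobability (s b).
  have s0 a : 0 <= s b a by rewrite /s; case: ifP => // _; case: ifP => // _; exact: label_prob_ge0.
  have [bM|bM] := ltnP b M.
    apply: (subprobability_le s0 _ (subprobability_delta R b)) => a; rewrite /s.
    case: ifP => [/eqP bE|_]; last exact: ler0n.
    case: ifP => aM; last by exfalso; lia.
    by rewrite (_ : a = b) ?eqxx//; lia.
  apply: (subprobability_le s0 _ (subprobability_prl P mx)) => a; rewrite /s.
  case: ifP => [/eqP bE|_]; last exact: label_prob_ge0.
  by case: ifP => // aM; exfalso; lia.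
have pos b a : 0 < label_prob P (fun x => ((minn M \o xi) x, xi x)) (b, a) -> 0 < s b a.
  move=> pba.
  have [x [bE aE]] : exists x, minn M (xi x) = b /\ xi x = a.
    apply: contrapT => nx; move: pba; rewrite /label_prob (_ : _ @^-1` _ = set0) ?measure0 ?ltxx//.
    by rewrite -subset0 => y /= [? ?]; apply: nx; exists y.
  rewrite /s -bE aE eqxx; case: ifP => // _.
  apply: lt_le_trans pba _; rewrite -aE -bE.
  apply: (@label_prob_mono _ _ _ P _ _ xi (fun x => ((minn M \o xi) x, xi x)) x) => //.
    exact: measurable_label_pair.
  by move=> y [].
have chan N : (word_entropy P T xi N <= word_entropy P T (minn M \o xi) N + (N%:R * (e / 2))%:E)%E.
  have := channel mT pT (measurable_label_word mT mz N) mz mx Hs pos (uf := id) (fun x => erefl).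
  move=> /le_trans; apply; rewrite leeD2l// EFinM lee_wpmul2l ?lee_fin//.
  apply: le_trans HM; rewrite le_eqVlt; apply/orP; left; apply/eqP; congr mean.
  apply/funext => x; rewrite /s /= eqxx; case: (ltnP (xi x) M) => _ /=.
    by rewrite ln1 oppr0 mulr0.
  by rewrite mulr1.
(* A single length [k] suffices, because the rate of the original label is an infimum over
   lengths. *)
have [k k0 Hk] := entropy_rate_approx P mT mz e2.
have := chan k; rewrite (word_rentropyE mT pT mx (Hw1_fin mx fx)) (word_rentropyE mT pT mz (Hw1_fin mz fz)).
rewrite -EFinD lee_fin => ck.
have := entropy_rate_le P mT mx k.
have k0' : 0 < k%:R :> R by rewrite ltr0n.
move=> hk; rewrite -(ler_pM2l k0').
move: hk ck Hk; move: (entropy_rate _ _ _) (entropy_rate _ _ _) (word_rentropy _ _ _ _) (word_rentropy _ _ _ _) => a b u v.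
by move=> *; lra.
Qed.

Hypothesis mixT : forall A B, measurable A -> measurable B ->
  (fun n => fine (P (A `&` iter n T @^-1` B))) @ \oo --> fine (P A) * fine (P B).

(** When a block code [g] predicts [zeta] with small error, [N + l] letters of [xi] determine [N]
    predictions, and the [l] extra letters are negligible in the rate. *)
Lemma generator_rate (xi : Om -> nat) (C : finType) (zeta : Om -> C) :
  measurable_label xi -> (label_entropy P xi < +oo)%E -> measurable_label zeta ->
  (forall dl : R, 0 < dl -> exists l (g : seq nat -> C),
     (P [set x | g (word T xi l x) <> zeta x] <= dl%:E)%E) ->
  entropy_rate P T zeta <= entropy_rate P T xi.
Proof.
move=> mx fx mz gen; apply/ler_addgt0Pl => e e0.
have e4 : 0 < e / 4 by rewrite divr_gt0.
(* Chosen so that a correct prediction costs exactly [- ln (1 - dl) = e / 4]. *)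
pose dl : R := 1 - expR (- (e / 4)).
have dl01 : 0 < dl < 1.
  by rewrite /dl subr_gt0 expR_lt1 oppr_lt0 e4 ltrBlDr ltrDl expR_gt0.
have /andP[dl0 dl1] := dl01.
have fz := label_entropy_fin mz.
have [x0 _] : exists x0 : Om, True.
  apply: contrapT => nx; have := probability_setT P; rewrite (_ : setT = set0).
    by rewrite measure0 => /eqP; rewrite eq_sym onee_eq0.
  by rewrite -subset0 => x _; apply: nx; exists x.
have cC : (0 < #|C|)%N by apply/card_gt0P; exists (zeta x0).
have cC' : 0 < #|C|%:R :> R by rewrite ltr0n.
have cC1 : 1 <= #|C|%:R :> R by rewrite ler1n.
pose K := - ln (dl / #|C|%:R).
have q01 : 0 < dl / #|C|%:R <= 1.
  rewrite divr_gt0// ler_pdivrMr// mul1r; apply: le_trans cC1; exact: ltW.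
have /andP[q0 q1] := q01.
have K0 : 0 <= K by rewrite oppr_ge0 ln_le0.
(* The error probability demanded of the code: an error costs [K], hence at most [e / 4] on average.
   The [+ 1] guards against [K = 0]. *)
have eK : 0 < e / 4 / (K + 1) by rewrite divr_gt0// ltr_wpDl.
have [l [g Hg]] := gen _ eK.
pose theta x := g (word T xi l x).
have mt : measurable_label theta by apply: (measurable_label_comp g); exact: measurable_label_word.
(* A symmetric channel with error [dl]: predicting [zeta] from [theta] costs at most [e / 4],
   plus [K] on the rare event [theta <> zeta]. *)
pose s (a c : C) : R := if a == c then 1 - dl else dl / #|C|%:R.
have s0 a c : 0 < s a c by rewrite /s; case: ifP => _; rewrite ?subr_gt0.
have Hs a : subprobability (s a).
  split=> [c|r ur]; first exact: ltW.
  apply: (@le_trans _ _ (\sum_(c <- r) ((1 - dl) * (c == a)%:R + dl / #|C|%:R))).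
    apply: ler_sum => c _; rewrite /s eq_sym; case: eqP => _; rewrite ?mulr1 ?mulr0 ?add0r//.
    by rewrite lerDl ltW.
  rewrite big_split /= -mulr_sumr big_const_seq count_predT iter_addr_0.
  have h1 : \sum_(c <- r) (c == a)%:R <= 1 :> R by exact: (subprobability_delta R a).2.
  have h2 : dl / #|C|%:R *+ size r <= dl.
    rewrite -mulr_natr mulrAC ler_pdivrMr// ler_pM2l// ler_nat.
    by rewrite cardE uniq_leq_size// => c _; rewrite mem_enum.
  have : (1 - dl) * (\sum_(c <- r) (c == a)%:R) <= 1 - dl.
    by rewrite ler_piMr// subr_ge0 ltW.
  move: h2; lra.
have mE : measurable [set x | theta x <> zeta x].
  exact: (measurable_label_pair mt mz (fun p => p.1 <> p.2)).
have ExS : (mean P (fun x => - ln (s (theta x) (zeta x)))%R <= (e / 2)%:E)%E.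
  apply: (@le_trans _ _ (mean P (fun x => e / 4 + K * \1_[set x | theta x <> zeta x] x)%R)).
    apply: mean_le.
    - exact: (measurable_label_fun (fun p => - ln (s p.1 p.2)) (measurable_label_pair mt mz)).
    - by apply: measurable_funD => //; apply: measurable_funM => //; exact: measurable_indic.
    - move=> x; rewrite oppr_ge0 ln_le0//; exact: subprobability_le1 (Hs _).
    - move=> x; rewrite /s indicE; case: eqP => h.
        rewrite /dl opprB addrC subrK expRK opprK lerDl mulr_ge0//.
      by rewrite mem_set// mulr1 -/K lerDr ltW.
  rewrite meanD//; last 3 first.
  - by apply: measurable_funM => //; exact: measurable_indic.
  - by move=> _; exact: ltW.
  - by move=> x; rewrite mulr_ge0// indicE.
  rewrite mean_cst meanZ// mean_indic//.
  rewrite (_ : e / 2 = e / 4 + e / 4); last by field.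
  rewrite EFinD leeD2l//.
  apply: (@le_trans _ _ (K%:E * (e / 4 / (K + 1))%:E)%E).
    by apply: lee_wpmul2l.
  rewrite -EFinM lee_fin mulrCA ler_piMr ?(ltW e4)//.
  by rewrite ler_pdivrMr ?ltr_wpDl// mul1r lerDl.
(* Sliding window: the prediction at time [j] reads the letters [j] to [j + l - 1]. *)
pose uf N (w : seq nat) := [seq g (take l (drop j w)) | j <- iota 0 N].
have Huf N x : uf N (word T xi (N + l) x) = word T theta N x.
  apply/eq_in_map => j; rewrite mem_iota add0n => /= jN.
  rewrite (_ : N + l = j + (l + (N - j)))%N; last by lia.
  by rewrite drop_word take_word.
have chan N : (word_entropy P T zeta N <= word_entropy P T xi (N + l) + (N%:R * (e / 2))%:E)%E.
  have := channel mT pT (measurable_label_word mT mx (N + l)) mt mz Hs (fun a c _ => s0 a c) (Huf N).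
  by move=> /le_trans; apply; rewrite leeD2l// EFinM lee_wpmul2l// lee_fin.
have fx1 := Hw1_fin mx fx; have fz1 := Hw1_fin mz fz.
have [M _ HM] := word_rentropy_upper mT pT mixT mx fx1 e4.
pose h := entropy_rate P T xi.
have h0 : 0 <= h by exact: entropy_rate_ge0.
have : \forall N \near \oo, entropy_rate P T zeta <= e + h.
  near=> N.
  have N0 : 0 < N%:R :> R by rewrite ltr0n; near: N; exists 1%N.
  have NM : (M <= N + l)%N by apply: leq_trans (leq_addr _ _); near: N; exact: nbhs_infty_ge.
  have := chan N; rewrite (word_rentropyE mT pT mx fx1) (word_rentropyE mT pT mz fz1) -EFinD lee_fin => c1.
  have := HM _ NM; rewrite -/h => c2.
  have := entropy_rate_le P mT mz N => c3.
  have : l%:R * (h + e / 4) / (e / 4) <= N%:R by near: N; exact: nbhs_infty_ger.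
  rewrite ler_pdivrMr// => c4.
  rewrite -(ler_pM2l N0); rewrite natrD in c2.
  move: c1 c2 c3 c4; rewrite mulrDl.
  move: (l%:R * _) (entropy_rate _ _ _) (word_rentropy _ _ _ _) (word_rentropy _ _ _ _) (N%:R) => L a u v n.
  move: (h) => b; lra.
by move=> [N _ /(_ N)]; apply => /=.
Unshelve. all: by end_near. Qed.

End rates.

(** * Approximation by algebras and by finite unions of intervals *)

Section symmetric_difference.
Context d (Om : measurableType d) (R : realType) (P : probability Om R).
Implicit Types A B : set Om.

Definition prob A : R := fine (P A).
Definition symdiff_prob A B : R := prob (A `+` B).

Lemma prob_ge0 A : 0 <= prob A.
Proof. exact: fine_ge0. Qed.

Lemma prE A : measurable A -> P A = (prob A)%:E.
Proof. by move=> mA; rewrite fineK// fin_num_measure. Qed.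

Lemma prob_le1 A : measurable A -> prob A <= 1.
Proof. by move=> mA; rewrite -lee_fin -prE// probability_le1. Qed.

Lemma prob_mono A B : measurable A -> measurable B -> A `<=` B -> prob A <= prob B.
Proof. by move=> mA mB AB; rewrite -lee_fin -!prE// le_measure ?inE. Qed.

Lemma prU_le A B : measurable A -> measurable B -> prob (A `|` B) <= prob A + prob B.
Proof.
move=> mA mB; rewrite -lee_fin EFinD -!prE//; last exact: measurableU.
exact: measureU2.
Qed.

Lemma measurable_symdiff A B : measurable A -> measurable B -> measurable (A `+` B).
Proof. by move=> mA mB; apply: measurableU; exact: measurableD. Qed.

Lemma symdiff_probC A B : symdiff_prob A B = symdiff_prob B A.
Proof. by rewrite /symdiff_prob setYC. Qed.

Lemma symdiff_probxx A : symdiff_prob A A = 0.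
Proof. by rewrite /symdiff_prob setYK /prob measure0. Qed.

Lemma symdiff_prob_triangle A B C : measurable A -> measurable B -> measurable C ->
  symdiff_prob A C <= symdiff_prob A B + symdiff_prob B C.
Proof.
move=> mA mB mC; apply: le_trans (prU_le (measurable_symdiff mA mB) (measurable_symdiff mB mC)).
apply: prob_mono; [exact: measurable_symdiff|by apply: measurableU; exact: measurable_symdiff|].
by move=> x [[Ax nC]|[Cx nA]]; case: (pselect (B x)) => Bx;
  [right; left|left; left|left; right|right; right].
Qed.

Lemma symdiff_prob_op (f : set Om -> set Om -> set Om) A A' B B' :
  measurable A -> measurable A' -> measurable B -> measurable B' ->
  measurable (f A B) -> measurable (f A' B') ->
  f A B `+` f A' B' `<=` (A `+` A') `|` (B `+` B') ->
  symdiff_prob (f A B) (f A' B') <= symdiff_prob A A' + symdiff_prob B B'.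
Proof.
move=> mA mA' mB mB' m1 m2 H; apply: le_trans (prU_le (measurable_symdiff mA mA') (measurable_symdiff mB mB')).
by apply: prob_mono => //; [exact: measurable_symdiff|apply: measurableU; exact: measurable_symdiff].
Qed.

Lemma symdiff_prob_setI A A' B B' : measurable A -> measurable A' -> measurable B -> measurable B' ->
  symdiff_prob (A `&` B) (A' `&` B') <= symdiff_prob A A' + symdiff_prob B B'.
Proof.
move=> mA mA' mB mB'; apply: (symdiff_prob_op mA mA' mB mB'); try exact: measurableI.
move=> x [[[Ax Bx] /not_andP[nA|nB]]|[[Ax Bx] /not_andP[nA|nB]]].
- by left; left.
- by right; left.
- by left; right.
- by right; right.
Qed.

Lemma symdiff_prob_setU A A' B B' : measurable A -> measurable A' -> measurable B -> measurable B' ->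
  symdiff_prob (A `|` B) (A' `|` B') <= symdiff_prob A A' + symdiff_prob B B'.
Proof.
move=> mA mA' mB mB'; apply: (symdiff_prob_op mA mA' mB mB'); try exact: measurableU.
move=> x [[[Ax|Bx] /not_orP[nA nB]]|[[Ax|Bx] /not_orP[nA nB]]].
- by left; left.
- by right; left.
- by left; right.
- by right; right.
Qed.

Lemma symdiff_prob_setD A A' B B' : measurable A -> measurable A' -> measurable B -> measurable B' ->
  symdiff_prob (A `\` B) (A' `\` B') <= symdiff_prob A A' + symdiff_prob B B'.
Proof.
move=> mA mA' mB mB'; apply: (symdiff_prob_op mA mA' mB mB'); try exact: measurableD.
move=> x [[[Ax nB] /not_andP[nA|/contrapT Bx]]|[[Ax nB] /not_andP[nA|/contrapT Bx]]].
- by left; left.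
- by right; right.
- by left; right.
- by right; left.
Qed.

Lemma dist_pr A B : measurable A -> measurable B -> `|prob A - prob B| <= symdiff_prob A B.
Proof.
move=> mA mB.
have H C D : measurable C -> measurable D -> prob C <= prob D + symdiff_prob C D.
  move=> mC mD; apply: le_trans (prU_le mD (measurable_symdiff mC mD)).
  apply: prob_mono => //; first by apply: measurableU => //; exact: measurable_symdiff.
  by move=> x Cx; case: (pselect (D x)) => Dx; [left|right; left].
have h1 := H _ _ mA mB; have h2 := H _ _ mB mA; rewrite symdiff_probC in h2.
by rewrite ler_norml; apply/andP; split; lra.
Qed.

Lemma symdiff_prob_preimage (T : Om -> Om) A B n : measurable_fun setT T ->
  (forall A, measurable A -> P (T @^-1` A) = P A) -> measurable A -> measurable B ->
  symdiff_prob (iter n T @^-1` A) (iter n T @^-1` B) = symdiff_prob A B.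
Proof.
move=> mT pT mA mB; rewrite /symdiff_prob /prob -(prob_iter mT pT n (measurable_symdiff mA mB)).
by rewrite /setY preimage_setU.
Qed.

Definition approximable (DD : set (set Om)) A :=
  measurable A /\ forall e : R, 0 < e -> exists2 B, DD B & symdiff_prob A B <= e.

(** By continuity from below a countable union is close to a finite one, while relative complements
    and finite unions respect symmetric differences; so the approximable sets are closed under the
    operations that generate the sigma-algebra. *)
Lemma approximable_sigma (D : set Om) (DD GG : set (set Om)) :
  measurable D -> (forall A, DD A -> measurable A) -> DD set0 ->
  (forall A, DD A -> DD (D `\` A)) -> (forall A B, DD A -> DD B -> DD (A `|` B)) ->
  GG `<=` approximable DD -> <<s D, GG >> `<=` approximable DD.
Proof.
move=> mD mDD DD0 DDC DDU HG; apply: smallest_sub => //; split.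
- by split=> // e e0; exists set0 => //; rewrite symdiff_probxx ltW.
- move=> A [mA HA]; split=> [|e e0]; first exact: measurableD.
  have [B DB AB] := HA e e0; exists (D `\` B); first exact: DDC.
  apply: le_trans AB; rewrite -[leRHS]add0r -(symdiff_probxx D); apply: symdiff_prob_setD => //; exact: mDD.
- move=> F HF; have mF n : measurable (F n) by have [] := HF n.
  have mU N : measurable (\big[setU/set0]_(i < N) F i) by exact: bigsetU_measurable.
  have mUF : measurable (\bigcup_n F n) by exact: bigcupT_measurable.
  split=> [//|e e0].
  have fin N : forall e, 0 < e -> exists2 B, DD B & symdiff_prob (\big[setU/set0]_(i < N) F i) B <= e.
    elim: N => [|N IH] e' e'0; first by rewrite big_ord0; exists set0 => //; rewrite symdiff_probxx ltW.
    have e2 : 0 < e' / 2 by rewrite divr_gt0.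
    have [B DB HB] := IH _ e2; have [C DC HC] := (HF N).2 _ e2.
    exists (B `|` C); first exact: DDU.
    rewrite big_ord_recr /= (splitr e'); apply: le_trans (symdiff_prob_setU (mU N) (mDD _ DB) (mF N) (mDD _ DC)) _.
    exact: lerD.
  have e2 : 0 < e / 2 by rewrite divr_gt0.
  have [N HN] : exists N, symdiff_prob (\bigcup_n F n) (\big[setU/set0]_(i < N) F i) <= e / 2.
    have cv : (fun N => P (\big[setU/set0]_(i < N) F i)) @ \oo --> P (\bigcup_n F n).
      have eqU : \bigcup_N \big[setU/set0]_(i < N) F i = \bigcup_n F n.
        apply/seteqP; split=> [x [N _]|x [n _ Fx]].
          by rewrite -bigcup_mkord => -[i _ Fx]; exists i.
        by exists n.+1 => //; rewrite -bigcup_mkord; exists n => /=.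
      rewrite -eqU.
      apply: (@nondecreasing_cvg_mu _ _ _ P (fun N => \big[setU/set0]_(i < N) F i)) => //.
        by rewrite eqU.
      by move=> n m nm; apply/subsetPset; exact: subset_bigsetU.
    have /fine_cvgP[_ /cvgrPdist_le /(_ _ e2)[N _ HN]] : (fun N =>
      P (\big[setU/set0]_(i < N) F i)) @ \oo --> (prob (\bigcup_n F n))%:E by rewrite -prE.
    exists N; have := HN N (leqnn N) => /=; apply: le_trans.
    have sub : \big[setU/set0]_(i < N) F i `<=` \bigcup_n F n.
      by rewrite -bigcup_mkord => x [i _ Fx]; exists i.
    have mD' := measurableD mUF (mU N).
    rewrite /symdiff_prob /setY (_ : \big[setU/set0]_(i < N) F i `\` _ = set0) ?setU0; last first.
      by rewrite -subset0 => x [/sub].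
    have : P (\bigcup_n F n) = (prob (\big[setU/set0]_(i < N) F i) +
        prob (\bigcup_n F n `\` \big[setU/set0]_(i < N) F i))%:E.
      rewrite EFinD -!prE// -measureU//; first by rewrite setDUK.
      by rewrite -subset0 => x [? []].
    rewrite prE// => -[->]; rewrite -/(prob (\big[setU/set0]_(i < N) F i)) addrAC subrr add0r.
    exact: ler_norm.
  have [B DB HB] := fin N _ e2; exists B => //.
  rewrite (splitr e); apply: le_trans (symdiff_prob_triangle mUF (mU N) (mDD _ DB)) _.
  exact: lerD.
Qed.

End symmetric_difference.

(** * Finite unions of intervals of the line *)

Section intervals.
Context (R : realType).

(** The intervals may overlap or be empty: only their number matters later. *)
Inductive fin_itv_union : set R -> Prop :=
| fin_itv_union0 : fin_itv_union set0
| fin_itv_unionU I A : is_interval I -> fin_itv_union A -> fin_itv_union (I `|` A).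

Lemma is_interval_setI (A B : set R) : is_interval A -> is_interval B -> is_interval (A `&` B).
Proof.
by move=> iA iB x y [Ax Bx] [Ay By] z h; split; [exact: iA h|exact: iB h].
Qed.

Lemma fin_itv_union_U A B : fin_itv_union A -> fin_itv_union B -> fin_itv_union (A `|` B).
Proof.
move=> + FB; elim=> [|I A' iI _ IH]; first by rewrite set0U.
by rewrite -setUA; exact: fin_itv_unionU.
Qed.

Lemma fin_itv_union1 I : is_interval I -> fin_itv_union I.
Proof. by move=> iI; rewrite -(setU0 I); apply: fin_itv_unionU => //; constructor. Qed.

Lemma fin_itv_union_I A B : fin_itv_union A -> fin_itv_union B -> fin_itv_union (A `&` B).
Proof.
move=> + FB; elim=> [|I A' iI _ IH]; first by rewrite set0I; constructor.
rewrite setIUl; apply: fin_itv_union_U => //.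
elim: {IH} FB => [|J B' iJ _ IH]; first by rewrite setI0; constructor.
rewrite setIUr; apply: fin_itv_unionU => //; exact: is_interval_setI.
Qed.

Lemma fin_itv_union_C A : fin_itv_union A -> fin_itv_union (~` A).
Proof.
elim=> [|I A' iI _ IH].
  by rewrite setC0; apply: fin_itv_union1.
rewrite setCU; apply: fin_itv_union_I => //.
have [->|/set0P[a Ia]] := eqVneq I set0.
  by rewrite setC0; apply: fin_itv_union1.
rewrite (_ : ~` I = [set y | forall x, I x -> y < x] `|` [set y | forall x, I x -> x < y]).
  apply: fin_itv_unionU.
    move=> x y /= Hx Hy z /andP[xz zy] w Iw; exact: le_lt_trans zy (Hy _ Iw).
  apply: fin_itv_union1 => x y /= Hx Hy z /andP[xz zy] w Iw; exact: lt_le_trans (Hx _ Iw) xz.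
apply/seteqP; split => [y /= nI|y [] H Iy]; [|by have := H _ Iy; rewrite ltxx..].
have ny x : I x -> x != y by move=> Ix; apply/eqP => xy; apply: nI; rewrite -xy.
have [ya|ay] := ltP y a; [left|right] => x Ix.
  rewrite ltNge; apply/negP => xy; apply: nI; apply: (iI x a) => //.
  by rewrite xy ltW.
rewrite ltNge; apply/negP => yx; apply: nI; apply: (iI a x) => //.
by rewrite ay.
Qed.

Lemma fin_itv_union_measurable (A : set (measurableTypeR R)) :
  fin_itv_union A -> measurable A.
Proof.
elim=> [//|I A' iI _ IH]; apply: measurableU => //; exact: is_interval_measurable.
Qed.

Lemma fin_itv_union_seq (A : set R) : fin_itv_union A ->
  exists s : seq (set R), (forall i, is_interval (nth set0 s i)) /\
    forall x, A x <-> exists2 i, (i < size s)%N & nth set0 s i x.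
Proof.
elim=> [|I A' iI _ [s [is_ sE]]].
  by exists [::]; split=> [i|x]; [rewrite nth_nil|split=> [|[]]].
exists (I :: s); split=> [[|i]|x] //=.
split=> [[Ix|/sE[i im Ax]]|[[|i]/= im Ax]].
- by exists 0%N.
- by exists i.+1.
- by left.
- by right; apply/sE; exists i.
Qed.

Lemma borel_approx (P : probability (measurableTypeR R) R) (A : set (measurableTypeR R))
    (e : R) : measurable A -> 0 < e ->
  exists2 B, fin_itv_union B & symdiff_prob P A B <= e.
Proof.
move=> mA e0; suff [_] : approximable P fin_itv_union A by exact.
apply: (@approximable_sigma _ _ _ P setT fin_itv_union (@ocitv R)) => //.
- by move=> B; exact: fin_itv_union_measurable.
- exact: fin_itv_union0.
- by move=> B FB; rewrite setTD; exact: fin_itv_union_C.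
- by move=> B C; exact: fin_itv_union_U.
- move=> _ [[x y] _ <-]; have FI : fin_itv_union `]x, y]%classic.
    by apply: fin_itv_union1; exact: interval_is_interval.
  split; first exact: fin_itv_union_measurable.
  by move=> r r0; exists `]x, y]%classic => //; rewrite symdiff_probxx ltW.
Qed.

End intervals.

(** * Saturation of intervals by cells *)

Section frequent_labels.
Context d (Om : measurableType d) (R : realType) (P : probability Om R).

(** [C] may be infinite, so the list is obtained by contradiction: if no list were exhaustive,
    frequent labels could be added until it is longer than [1 / g]. *)
Lemma frequent_labels (C : countType) (xi : Om -> C) (g : R) : measurable_label xi -> 0 < g ->
  exists s : seq C, (forall c, g <= label_prob P xi c -> c \in s) /\ (size s)%:R * g <= 1.
Proof.
move=> mx g0.
have small (s : seq C) : uniq s -> all (fun c => g <= label_prob P xi c) s -> (size s)%:R * g <= 1.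
  move=> us /allP as_; apply: le_trans ((subprobability_prl P mx).2 s us).
  have -> : (size s)%:R * g = \sum_(c <- s) g.
    by rewrite big_const_seq count_predT iter_addr_0 mulr_natl.
  by rewrite big_seq [leRHS]big_seq; apply: ler_sum => c /as_.
have [s us as_] : exists2 s : seq C, uniq s /\ all (fun c => g <= label_prob P xi c) s &
    forall c, g <= label_prob P xi c -> c \in s.
  apply: contrapT => H.
  have build n : exists s : seq C, [/\ uniq s, all (fun c => g <= label_prob P xi c) s & size s = n].
    elim: n => [|n [s [us as_ sn]]]; first by exists [::].
    have [c gc cs] : exists2 c, g <= label_prob P xi c & c \notin s.
      apply: contrapT => H'; apply: H; exists s => // c gc.
      by apply: contrapT => cs; apply: H'; exists c => //; exact/negP.
    by exists (c :: s); rewrite /= cs us gc as_ sn.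
  have [n _ /(_ n (leqnn n)) /= gn] := nbhs_infty_gtr g^-1.
  have [s [us as_ sn]] := build n.
  have := small s us as_; rewrite sn -ler_pdivlMr// div1r.
  by rewrite leNgt gn.
by exists s; split => //; apply: small; case: us.
Qed.

End frequent_labels.

(** Betweenness is tested on points of [Z] only, so a set spoilt by exceptional points, such as
    endpoints of atoms and their preimages, still counts as an interval. *)
Definition itv_in (R : realType) (Z F : set R) :=
  forall x y z, Z x -> Z y -> Z z -> x < y -> y < z -> F x -> F z -> F y.

Section saturation.
Context (R : realType) (P : probability (measurableTypeR R) R).
Variables (Z : set (measurableTypeR R)) (C : countType) (W : measurableTypeR R -> C).
Hypothesis mZ : measurable Z.
Hypothesis Z1 : P (~` Z) = 0%E.
Hypothesis mW : measurable_label W.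
Hypothesis cW : forall c, itv_in Z (W @^-1` [set c]).
Variable beta : R.
Hypothesis b0 : 0 <= beta.

(** Cells too large to be charged one by one; their total probability is counted once, whatever the
    number of intervals. *)
Let Big := W @^-1` [set c | beta <= label_prob P W c].

(* The cells meeting [F] but not contained in it, and having a point to the left of [F],
   all coincide; the same holds on the right. *)
Lemma boundary_cells (F : set R) : itv_in Z F ->
  exists M : set (measurableTypeR R), [/\ measurable M, prob P M <= 2 * beta &
   forall y, Z y -> (exists x, [/\ Z x, F x & W x = W y]) -> ~ F y -> Big y \/ M y].
Proof.
move=> cF.
pose Lp y := [/\ Z y, ~ Big y, ~ F y & exists x, [/\ Z x, F x, W x = W y & y < x]].
pose Rp y := [/\ Z y, ~ Big y, ~ F y & exists x, [/\ Z x, F x, W x = W y & x < y]].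
(* Let [y < y'] both see [F] on their right within their cells, at [x] and [x']. If [y' < x], the
   cell of [y] and [x] contains [y']; otherwise [y'] would lie in [F], by convexity between [x] and
   [x']. *)
have Ll y y' : Lp y -> Lp y' -> W y = W y'.
  wlog yy' : y y' / y <= y' => [H|] Ly Ly'.
    by case/orP: (le_total y y') => h; [exact: H|apply/esym; exact: H].
  move: yy'; rewrite le_eqVlt => /orP[/eqP->//|yy'].
  have [Zy _ _ [x [Zx Fx Wx yx]]] := Ly; have [Zy' _ nF' [x' [Zx' Fx' Wx' yx']]] := Ly'.
  have [y'x|xy'] := ltP y' x.
    by apply/esym; apply: (cW Zy Zy' Zx yy' y'x).
  exfalso; apply: nF'; move: xy'; rewrite le_eqVlt => /orP[/eqP<-//|xy'].
  exact: (cF x y' x').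
have Rr y y' : Rp y -> Rp y' -> W y = W y'.
  wlog yy' : y y' / y' <= y => [H|] Ly Ly'.
    by case/orP: (le_total y' y) => h; [exact: H|apply/esym; exact: H].
  move: yy'; rewrite le_eqVlt => /orP[/eqP->//|yy'].
  have [Zy _ _ [x [Zx Fx Wx yx]]] := Ly; have [Zy' _ nF' [x' [Zx' Fx' Wx' yx']]] := Ly'.
  have [y'x|xy'] := ltP x y'.
    by apply/esym; apply: (cW Zx Zy' Zy y'x yy').
  exfalso; apply: nF'; move: xy'; rewrite le_eqVlt => /orP[/eqP->//|xy'].
  exact: (cF x' y' x).
have side (Q : R -> Prop) : (forall y, Q y -> ~ Big y) ->
    (forall y y', Q y -> Q y' -> W y = W y') ->
    exists M : set (measurableTypeR R), [/\ measurable M, prob P M <= beta & forall y, Q y -> M y].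
  move=> nB QQ; case: (pselect (exists y, Q y)) => [[y Qy]|nQ].
    exists (W @^-1` [set W y]); split; [exact: mW| |by move=> y' Qy' /=; exact: QQ].
    by have := nB _ Qy; rewrite /Big /= => /negP; rewrite -ltNge => /ltW.
  exists set0; split=> [//||y Qy]; first by rewrite /prob measure0.
  by exfalso; apply: nQ; exists y.
have [M1 [mM1 pM1 LM]] := side Lp (fun y => ltac:(by case)) Ll.
have [M2 [mM2 pM2 RM]] := side Rp (fun y => ltac:(by case)) Rr.
exists (M1 `|` M2); split; first exact: measurableU.
  by apply: le_trans (prU_le P mM1 mM2) _; rewrite mulr_natl mulr2n lerD.
move=> y Zy [x [Zx Fx Wx]] nF; case: (pselect (Big y)) => [|nB]; first by left.
right; have [xy|yx|xy] := ltgtP x y.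
- by right; apply: RM; split=> //; exists x.
- by left; apply: LM; split=> //; exists x.
- by rewrite -xy in nF.
Qed.

Lemma saturation (F : set (measurableTypeR R)) (s : seq (set R)) : measurable F ->
  (forall i, itv_in Z (nth set0 s i)) ->
  (forall x, Z x -> F x <-> exists2 i, (i < size s)%N & nth set0 s i x) ->
  exists S : set C, symdiff_prob P F (W @^-1` S) <= prob P Big + 2 * beta * (size s)%:R.
Proof.
move=> mF cs Fs.
(* All cells that meet [F] in [Z]: then [F] is covered up to a null set, and only the excess has to
   be bounded. *)
exists [set c | exists x, [/\ Z x, F x & W x = c]].
set S := [set c | _].
have mB : measurable Big by exact: mW.
have [M [mM pM HM]] : exists M : set (measurableTypeR R), [/\ measurable M,
    prob P M <= 2 * beta * (size s)%:R &
    forall y, Z y -> (exists i x, [/\ (i < size s)%N, Z x, nth set0 s i x & W x = W y]) ->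
      ~ (exists2 i, (i < size s)%N & nth set0 s i y) -> Big y \/ M y].
  elim: s cs {Fs} => [|A s IH] cs.
    exists set0; split=> //; first by rewrite /prob measure0 mulr0.
    by move=> y _ [i [x []]].
  have [M1 [mM1 pM1 H1]] := IH (fun i => cs i.+1).
  have [M2 [mM2 pM2 H2]] := boundary_cells (cs 0%N).
  exists (M2 `|` M1); split; first exact: measurableU.
    apply: le_trans (prU_le P mM2 mM1) _.
    have -> : (size (A :: s))%:R = (size s)%:R + 1 :> R by rewrite /= -natr1.
    by rewrite mulrDr mulr1 addrC lerD.
  move=> y Zy [[|i] [x [/= iN Zx Ax Wx]]] nA.
    have [||h|h] := H2 y Zy; [by exists x| |by left|by right; left].
    by move=> Ay; apply: nA; exists 0%N.
  have [||h|h] := H1 y Zy; [by exists i, x| |by left|by right; right].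
  by move=> [j js Ay]; apply: nA; exists j.+1.
have mS : measurable (W @^-1` S) by exact: mW.
have mZC : measurable (~` Z) by exact: measurableC.
have sub : F `+` (W @^-1` S) `<=` ~` Z `|` (Big `|` M).
  move=> x; case: (pselect (Z x)) => [Zx|nZ _]; last by left.
  case=> [[Fx nS]|[/= [y [Zy Fy Wy]] nF]].
    by exfalso; apply: nS; exists x.
  right; apply: HM => //.
    have [i im Ay] := (Fs y Zy).1 Fy; by exists i, y.
  by move=> h; apply: nF; apply/Fs.
apply: le_trans (prob_mono P _ _ sub) _.
- exact: measurable_symdiff.
- by apply: measurableU => //; exact: measurableU.
apply: le_trans (prU_le P mZC (measurableU _ _ mB mM)) _.
rewrite /prob Z1 add0r -!/(prob P _); apply: le_trans (prU_le P mB mM) _.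
by rewrite lerD2l.
Qed.

End saturation.

(** * Maps and partitions of the unit interval *)

Section measurable_interval_maps.
Context (R : realType).
Local Notation mR := (measurableTypeR R).
Implicit Types (T : R -> R) (mu : probability mR R) (A B : set mR).

(* The identity outside [0,1] makes the extension a measure preserving self-map of the line. *)
Definition total_ext T (x : mR) : mR := if 0 <= x <= 1 then T x else x.

Lemma I01P (x : R) : I01 x <-> (0 <= x <= 1).
Proof. by rewrite /I01 /= in_itv. Qed.

Lemma measurable_I01 : measurable (I01 : set mR).
Proof. exact: measurable_itv. Qed.

Lemma prob_I01C mu : prob01 mu -> mu (~` I01) = 0%E.
Proof.
move=> h; rewrite probability_setC; last exact: measurable_I01.
by rewrite (h : mu I01 = 1%E) subee.
Qed.

Lemma prob_I01 mu A : prob01 mu -> measurable A -> mu (I01 `&` A) = mu A.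
Proof.
move=> h mA; rewrite -[in RHS](setIT A) -(setvU I01) setIUr measureU.
- rewrite [X in (X + _)%E](_ : _ = 0)%E ?add0e 1?setIC//.
  apply/eqP; rewrite eq_le measure_ge0 andbT -(prob_I01C h) le_measure ?inE//.
  + by apply: measurableI => //; apply: measurableC; exact: measurable_I01.
  + by apply: measurableC; exact: measurable_I01.
- by apply: measurableI => //; apply: measurableC; exact: measurable_I01.
- by apply: measurableI => //; exact: measurable_I01.
- by rewrite -subset0 => x [[_ nI] [_]].
Qed.

Section preserving.
Variables (T : R -> R) (mu : probability mR R).
Hypotheses (mu01 : prob01 mu) (Tmu : measure_preserving T mu).

Lemma total_ext_I01 x : I01 x -> total_ext T x = T x.
Proof. by move=> /I01P h; rewrite /total_ext h. Qed.

Lemma iter_I01 n x : I01 x -> I01 (iter n T x).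
Proof. by move=> Ix; elim: n => //= n; exact: Tmu.1. Qed.

Lemma iter_tot n x : I01 x -> iter n (total_ext T) x = iter n T x.
Proof.
by move=> Ix; elim: n => //= n ->; rewrite total_ext_I01//; exact: iter_I01.
Qed.

Lemma iterpreE n A : iterpre T n A = I01 `&` iter n (total_ext T) @^-1` A.
Proof.
apply/seteqP; split=> x [Ix]; rewrite /= ?iter_tot// => h; split=> //=;
  by rewrite ?iter_tot// in h *.
Qed.

Lemma measurable_total_ext : measurable_fun setT (total_ext T).
Proof.
move=> _ Y mY; rewrite setTI.
have -> : total_ext T @^-1` Y = (I01 `&` T @^-1` Y) `|` (Y `\` I01).
  apply/seteqP; split => x.
    rewrite /total_ext /=; case: ifPn => h Hx; [left; split=> //; exact/I01P|right; split=> //].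
    by move=> /I01P; exact/negP.
  case=> [[Ix Yx]|[Yx nI]]; rewrite /preimage /= /total_ext.
    by move/I01P : Ix => ->.
  by case: ifPn => // /I01P.
apply: measurableU; last by apply: measurableD => //; exact: measurable_I01.
by case: Tmu => _ [mT _]; exact: (mT measurable_I01 Y mY).
Qed.

Lemma total_ext_preserving A : measurable A -> mu (total_ext T @^-1` A) = mu A.
Proof.
move=> mA; have mtA : measurable (total_ext T @^-1` A).
  by rewrite -[X in measurable X]setTI; exact: measurable_total_ext.
rewrite -(prob_I01 mu01 mtA) -(prob_I01 mu01 mA).
have mIA : borel (I01 `&` A) by apply: measurableI => //; exact: measurable_I01.
have [_ [_ pT]] := Tmu; rewrite -(pT _ mIA (@subIsetl _ _ _)).
congr (mu _); rewrite iterpreE/=; apply/seteqP; split=> x [Ix]; rewrite /preimage /=.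
  by split=> //; split=> //; rewrite total_ext_I01//; exact: Tmu.1.
by move=> [].
Qed.

Lemma measurable_iterpre n A : measurable A -> measurable (iterpre T n A : set mR).
Proof.
move=> mA; rewrite iterpreE; apply: measurableI; first exact: measurable_I01.
exact: measurable_iter_preimage measurable_total_ext _ _ mA.
Qed.

Lemma symdiff_prob_iterpre n A B : measurable A -> measurable B ->
  symdiff_prob mu (iterpre T n A) (iterpre T n B) <= symdiff_prob mu A B.
Proof.
move=> mA mB; rewrite !iterpreE -(symdiff_prob_preimage n measurable_total_ext total_ext_preserving mA mB).
rewrite -[leRHS]add0r -(symdiff_probxx mu I01); apply: symdiff_prob_setI; try exact: measurable_I01;
  exact: measurable_iter_preimage measurable_total_ext _ _ _.
Qed.

End preserving.

End measurable_interval_maps.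

(** * Labelling points by the atoms of a partition *)

Section partition_labels.
Context (R : realType).
Local Notation mR := (measurableTypeR R).
Variable Q : ipart R.
Hypothesis HQ : is_ipart Q.

(** Empty off [pJ Q], so that all of [nat] serves as index set. *)
Definition atoms n : set R := [set x | pJ Q n /\ pI Q n x].
Definition oatoms n : set R := [set x | pJ Q n /\ `](pa Q n), (pb Q n)[%classic x].

(* One plus the least index of an atom containing [x], and 0 outside the atoms: atoms may share
   endpoints, and taking the least index keeps the fibers in the sigma-algebra they generate. *)
Definition atom_label (x : mR) : nat :=
  if pselect (exists n, seqDU atoms n x) is left h then (projT1 (cid h)).+1 else 0%N.

Lemma lab_seqDU n x : seqDU atoms n x -> atom_label x = n.+1.
Proof.
move=> h; rewrite /atom_label; case: pselect => [h'|]; last by case; exists n.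
case: (cid h') => m hm /=; congr S; apply: contrapT => mn.
have := @trivIset_seqDU _ atoms m n Logic.I Logic.I; move=> H; apply: mn; apply: H.
by exists x.
Qed.

Lemma labS n : atom_label @^-1` [set n.+1] = seqDU atoms n.
Proof.
apply/seteqP; split=> x /=; last exact: lab_seqDU.
by rewrite /atom_label; case: pselect => // h [<-]; case: (cid h).
Qed.

Lemma lab0 : atom_label @^-1` [set 0%N] = ~` \bigcup_n atoms n.
Proof.
rewrite seqDU_bigcup_eq; apply/seteqP; split=> x /=.
  by rewrite /atom_label; case: pselect => // h _ [n _ hn]; apply: h; exists n.
by move=> h; rewrite /atom_label; case: pselect => // -[n hn]; exfalso; apply: h; exists n.
Qed.

Lemma pI_itv n : pJ Q n -> is_interval (pI Q n).
Proof.
move=> Jn; have [_ [ab [_ [op cl]]]] := HQ.1 n Jn.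
move=> x y Ix Iy z /andP[]; rewrite !le_eqVlt => /orP[/eqP<-//|xz] /orP[/eqP->//|zy].
apply: op; rewrite /= in_itv /=.
have := cl _ Ix; have := cl _ Iy; rewrite /= !in_itv /= => /andP[_ yb] /andP[ax _].
by rewrite (le_lt_trans ax xz) (lt_le_trans zy yb).
Qed.

Lemma measurable_atoms n : measurable (atoms n : set mR).
Proof.
case: (pselect (pJ Q n)) => Jn.
  rewrite (_ : atoms n = pI Q n); last by apply/seteqP; split=> x //= [].
  exact: is_interval_measurable (pI_itv Jn).
by rewrite (_ : atoms n = set0)// -subset0 => x [].
Qed.

Lemma measurable_oatoms n : measurable (oatoms n : set mR).
Proof.
case: (pselect (pJ Q n)) => Jn.
  rewrite (_ : oatoms n = `](pa Q n), (pb Q n)[%classic); first exact: measurable_itv.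
  by apply/seteqP; split=> x //= [].
by rewrite (_ : oatoms n = set0)// -subset0 => x [].
Qed.

Lemma measurable_seqDU_atoms n : measurable (seqDU atoms n : set mR).
Proof.
apply: measurableD; first exact: measurable_atoms.
by apply: bigsetU_measurable => i _; exact: measurable_atoms.
Qed.

Lemma measurable_label_lab : measurable_label atom_label.
Proof.
apply: measurable_label_fib => -[|n].
  rewrite lab0; apply: measurableC; apply: bigcupT_measurable => n; exact: measurable_atoms.
by rewrite labS; exact: measurable_seqDU_atoms.
Qed.

(** Two distinct indices would give overlapping open intervals: the shared point leaves room between
    the larger left and the smaller right endpoint, and their midpoint lies in both interiors. *)
Lemma oatoms_atoms m n x : oatoms n x -> atoms m x -> m = n.
Proof.
move=> [Jn xo] [Jm am]; apply: contrapT => mn.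
have [_ [abm [_ [_ cm]]]] := HQ.1 m Jm.
have [_ [abn _]] := HQ.1 n Jn.
have := cm _ am; move: xo; rewrite /= !in_itv /= => /andP[ax xb] /andP[cx xd].
have := HQ.2.1 m n Jm Jn mn; rewrite -subset0 => H.
pose y := (Num.max (pa Q n) (pa Q m) + Num.min (pb Q n) (pb Q m)) / 2.
have lo : Num.max (pa Q n) (pa Q m) < Num.min (pb Q n) (pb Q m).
  rewrite gt_max !lt_min abn abm (le_lt_trans cx xb) (lt_le_trans ax xd)//.
have h1 : Num.max (pa Q n) (pa Q m) < y by rewrite midf_lt.
have h2 : y < Num.min (pb Q n) (pb Q m) by rewrite midf_lt.
move: h1 h2; rewrite gt_max lt_min => /andP[? ?] /andP[? ?].
by apply: (H y); split; rewrite /= in_itv /=; apply/andP.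
Qed.

Lemma lab_oatoms n x : oatoms n x -> atom_label x = n.+1.
Proof.
move=> xo; apply: lab_seqDU; split.
  by case: xo => Jn xo; split=> //; have [_ [_ [_ [op _]]]] := HQ.1 n Jn; exact: op.
by rewrite -bigcup_mkord => -[m /= mn am]; rewrite (oatoms_atoms xo am) ltnn in mn.
Qed.

Lemma seqDU_endpoints n : atoms n `\` seqDU atoms n `<=` [set pa Q n; pb Q n].
Proof.
move=> x [[Jn an] nD]; have [_ [_ [_ [op cl]]]] := HQ.1 n Jn.
have := cl _ an; rewrite /= in_itv /= => /andP[]; rewrite !le_eqVlt.
move=> /orP[/eqP->|ax]; first by left.
move=> /orP[/eqP->|xb]; first by right.
exfalso; apply: nD; rewrite -labS /=; apply: lab_oatoms; split=> //.
by rewrite /= in_itv /= ax.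
Qed.

End partition_labels.

(** * Regular points and mixing *)

Section system.
Context (R : realType).
Local Notation mR := (measurableTypeR R).
Local Notation lambda := (@lebesgue_measure R).
Variables (T : R -> R) (mu : probability mR R) (Q : ipart R).
Hypothesis sys : classT T mu Q.

Local Notation T' := (total_ext T).
Local Notation W n := (word T' (atom_label Q) n).

Lemma sys_prob01 : prob01 mu. Proof. by case: sys. Qed.
Lemma sys_preserving : measure_preserving T mu. Proof. by case: sys => _ [_ []]. Qed.
Lemma sys_ipart : is_ipart Q. Proof. by case: sys => _ [_ [_ [_ []]]]. Qed.

Lemma sys_measurable_ext : measurable_fun setT T'. Proof. exact: measurable_total_ext sys_preserving. Qed.

Lemma sys_preserving_ext (A : set mR) : measurable A -> mu (T' @^-1` A) = mu A.
Proof. exact: total_ext_preserving sys_prob01 sys_preserving _. Qed.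

Lemma sys_measurable_label : measurable_label (atom_label Q). Proof. exact: measurable_label_lab sys_ipart. Qed.

Lemma sys_null (A : set mR) : measurable A -> A `<=` I01 -> lambda A = 0%E -> mu A = 0%E.
Proof.
move=> mA AI A0; have [_ [[c [c1 /(_ A mA AI)[+ _]]] _]] := sys.
rewrite A0 => h; apply/eqP; rewrite eq_le measure_ge0 andbT.
have ci : 0 < c^-1 by rewrite invr_gt0 (lt_le_trans ltr01).
by rewrite -(@lee_pmul2l _ c^-1%:E)// mule0.
Qed.

Lemma sys_set1 x : I01 x -> mu [set x] = 0%E.
Proof.
move=> Ix; apply: sys_null; [exact: measurable_set1|by move=> _ ->|].
exact: lebesgue_measure_set1.
Qed.

Lemma ends_I01 n : pJ Q n -> I01 (pa Q n) /\ I01 (pb Q n).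
Proof.
move=> Jn; have [a0 [ab [b1 _]]] := sys_ipart.1 n Jn.
by split; apply/I01P; rewrite ?a0 ?b1 /=; [exact: le_trans (ltW ab) b1|
  rewrite (le_trans a0 (ltW ab))].
Qed.

Lemma sys_ends (n : nat) (A : set mR) : pJ Q n -> measurable A ->
  A `<=` [set pa Q n; pb Q n] -> mu A = 0%E.
Proof.
move=> Jn mA sub; have [Ia Ib] := ends_I01 Jn.
apply/eqP; rewrite eq_le measure_ge0 andbT.
have m1 x : measurable ([set x] : set mR) by exact: measurable_set1.
apply: (@le_trans _ _ (mu ([set pa Q n] `|` [set pb Q n]))).
  by rewrite le_measure ?inE//; apply: measurableU.
apply: le_trans (measureU2 _ (m1 _) (m1 _)) _.
by rewrite [X in (X + _)%E](sys_set1 Ia) [X in (_ + X)%E](sys_set1 Ib) adde0.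
Qed.

Lemma oatoms_I01 n : oatoms Q n `<=` I01.
Proof.
move=> x [Jn]; rewrite /= in_itv /= => /andP[ax xb].
have [a0 [ab [b1 _]]] := sys_ipart.1 n Jn.
by apply/I01P; rewrite (le_trans a0 (ltW ax)) (le_trans (ltW xb) b1).
Qed.

Lemma measurable_bigcup_oatoms : measurable (\bigcup_n oatoms Q n : set mR).
Proof. by apply: bigcupT_measurable => n; exact: measurable_oatoms. Qed.

Lemma sys_oatoms : mu (~` \bigcup_n oatoms Q n) = 0%E.
Proof.
have mU := measurable_bigcup_oatoms.
have mat n : measurable (atoms Q n : set mR) by exact: measurable_atoms sys_ipart _.
have mot n : measurable (oatoms Q n : set mR) by exact: measurable_oatoms.
have mU2 : measurable (\bigcup_n atoms Q n : set mR) by exact: bigcupT_measurable.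
have mID : measurable (I01 `\` \bigcup_n atoms Q n : set mR).
  by apply: measurableD => //; exact: measurable_I01.
have eJ : \bigcup_n atoms Q n = \bigcup_(n in pJ Q) pI Q n.
  by apply/seteqP; split=> x; [move=> [n _ [Jn Ix]]; exists n|move=> [n Jn Ix]; exists n].
have n1 : mu.-negligible (~` I01).
  exists (~` I01); split=> //; last exact: prob_I01C sys_prob01.
  by apply: measurableC; exact: measurable_I01.
have n2 : mu.-negligible (I01 `\` \bigcup_n atoms Q n).
  exists (I01 `\` \bigcup_n atoms Q n); split=> //.
  apply: sys_null => //.
  by rewrite eJ; have [_ [_ ->]] := sys_ipart.
have n3 : mu.-negligible (\bigcup_n (atoms Q n `\` oatoms Q n)).
  apply: negligible_bigcup => n; exists (atoms Q n `\` oatoms Q n).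
  split=> //; first exact: measurableD.
  case: (pselect (pJ Q n)) => Jn.
    apply: (sys_ends Jn); first exact: measurableD.
    move=> x [[_ Ix] no]; have [_ [_ [_ [_ cl]]]] := sys_ipart.1 n Jn.
    have := cl _ Ix; rewrite /= in_itv /= => /andP[]; rewrite !le_eqVlt.
    move=> /orP[/eqP->|ax]; first by left.
    move=> /orP[/eqP->|xb]; first by right.
    by exfalso; apply: no; split=> //; rewrite /= in_itv /= ax.
  by rewrite (_ : _ `\` _ = set0) ?measure0// -subset0 => x [[]].
have : mu.-negligible (~` \bigcup_n oatoms Q n).
  apply: negligibleS (negligibleU (negligibleU n1 n2) n3) => x nx.
  case: (pselect (I01 x)) => Ix; last by left; left.
  case: (pselect ((\bigcup_n atoms Q n) x)) => [[n _ an]|na]; last by left; right.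
  by right; exists n => //; split=> // xo; apply: nx; exists n.
by move/negligibleP; apply; exact: measurableC.
Qed.

(* The full measure set on which order arguments are valid: no orbit meets an endpoint. *)
Definition regular : set mR := I01 `&` \bigcap_j (iter j T' @^-1` (\bigcup_n oatoms Q n)).

Lemma measurable_regular : measurable regular.
Proof.
apply: measurableI; first exact: measurable_I01.
by apply: bigcapT_measurable => j; exact: measurable_iter_preimage sys_measurable_ext _ _ measurable_bigcup_oatoms.
Qed.

Lemma regularC : mu (~` regular) = 0%E.
Proof.
have mU := measurable_bigcup_oatoms.
apply/(@negligibleP _ _ _ mu); first by apply: measurableC; exact: measurable_regular.
rewrite setCI setC_bigcap; apply: negligibleU.
  exists (~` I01); split=> //; last exact: prob_I01C sys_prob01.
  by apply: measurableC; exact: measurable_I01.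
apply: negligible_bigcup => j; exists (iter j T' @^-1` (~` \bigcup_n oatoms Q n)).
split=> //.
  by apply: measurable_iter_preimage sys_measurable_ext _ _ _; exact: measurableC.
exact: (etrans (prob_iter sys_measurable_ext sys_preserving_ext j (measurableC mU)) sys_oatoms).
Qed.

Lemma regular_lab x j : regular x ->
  exists2 n, oatoms Q n (iter j T' x) & atom_label Q (iter j T' x) = n.+1.
Proof.
move=> [_ /(_ j Logic.I) [n _ xo]]; exists n => //.
exact: (lab_oatoms sys_ipart xo).
Qed.

Lemma wordSr n x : W n.+1 x = rcons (W n x) (atom_label Q (iter n T' x)).
Proof. by rewrite -addn1 word_cat -cats1. Qed.

(** Betweenness of the images is carried along the induction: it places the [n]-th image of [y] in
    the same open atom as its neighbours, where [T] is strictly monotone and so preserves or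
    reverses the order. *)
Lemma regular_order n x y z : regular x -> regular y -> regular z ->
  x < y -> y < z -> W n x = W n z -> W n y = W n x /\
  ((iter n T' x < iter n T' y /\ iter n T' y < iter n T' z) \/
   (iter n T' z < iter n T' y /\ iter n T' y < iter n T' x)).
Proof.
move=> Zx Zy Zz xy yz; elim: n => [|n IH]; first by move=> _; split=> //; left.
rewrite !wordSr => /rcons_inj [/IH [Wy btw] Lxz].
have [p ox lx] := regular_lab n Zx; have [q oz lz] := regular_lab n Zz.
have pq : p = q by move: Lxz; rewrite lx lz => -[].
rewrite -{q lz}pq in oz.
have oy : oatoms Q p (iter n T' y).
  case: ox => Jp; rewrite /= in_itv /= => /andP[ax xb].
  case: oz => _; rewrite /= in_itv /= => /andP[az zb].
  split=> //; rewrite /= in_itv /=.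
  case: btw => -[h1 h2]; apply/andP; split.
  - exact: lt_trans ax h1.
  - exact: lt_trans h2 zb.
  - exact: lt_trans az h1.
  - exact: lt_trans h2 xb.
have ly : atom_label Q (iter n T' y) = p.+1 by exact: (lab_oatoms sys_ipart oy).
split; first by rewrite Wy lx ly.
have tI u : oatoms Q p u -> T' u = T u by move=> ou; apply: total_ext_I01; exact: oatoms_I01 ou.
rewrite !iterS !tI//.
have [_ [_ [_ [_ [_ [mono _]]]]]] := sys.
have [_ mon] := mono p ox.1.
case: ox => _ ox; case: oy => _ oy; case: oz => _ oz.
case: mon => mon; case: btw => -[h1 h2].
- by left; split; apply: mon.
- by right; split; apply: mon.
- by right; split; apply: mon.
- by left; split; apply: mon.
Qed.

Lemma regular_cells n w : itv_in regular (W n @^-1` [set w]).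
Proof.
move=> x y z Zx Zy Zz xy yz /= Wx Wz.
have [] := regular_order Zx Zy Zz xy yz (etrans Wx (esym Wz)).
by rewrite Wx.
Qed.

Lemma regular_cells_itv n w (J : set R) : is_interval J ->
  itv_in regular [set x | W n x = w /\ J (iter n T' x)].
Proof.
move=> iJ x y z Zx Zy Zz xy yz /= [Wx Jx] [Wz Jz].
have [Wy] := regular_order Zx Zy Zz xy yz (etrans Wx (esym Wz)).
rewrite Wx in Wy; case=> -[h1 h2]; split=> //.
- by apply: (iJ _ _ Jx Jz); rewrite !ltW.
- by apply: (iJ _ _ Jz Jx); rewrite !ltW.
Qed.

Lemma mu_seqDU n : pJ Q n -> mu (seqDU (atoms Q) n) = mu (pI Q n).
Proof.
move=> Jn; have eI : pI Q n = atoms Q n by apply/seteqP; split=> x //= [].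
have mS : measurable (seqDU (atoms Q) n : set mR) by exact: measurable_seqDU_atoms sys_ipart _.
have mat : measurable (atoms Q n : set mR) by exact: measurable_atoms sys_ipart _.
rewrite eI -[in RHS](setDUK (@subset_seqDU _ (atoms Q) n)) measureU//; last 2 first.
- exact: measurableD.
- by rewrite -subset0 => x [? []].
rewrite [X in (_ + X)%E](_ : _ = 0%E) ?adde0//.
apply: (sys_ends Jn); first exact: measurableD.
exact: seqDU_endpoints sys_ipart _.
Qed.

(** Label [n.+1] has the measure of [pI Q n] and label 0 has measure 0, so a finite sum over labels
    is a finite subsum of the entropy series of the partition. *)
Lemma sys_entropy_fin : (label_entropy mu (atom_label Q) < +oo)%E.
Proof.
have [_ [_ [_ [_ [_ [_ [_ fin]]]]]]] := sys.
apply: le_lt_trans fin.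
have -> : label_entropy mu (atom_label Q) = mean mu ((fun c => - ln (label_prob mu (atom_label Q) c)) \o atom_label Q) by [].
apply: mean_lab_le; first exact: sys_measurable_label.
  by move=> c; rewrite oppr_ge0 ln_le0// label_prob_le1//; exact: sys_measurable_label.
move=> s us.
have ent0 n : ~ pJ Q n -> label_prob mu (atom_label Q) n.+1 = 0.
  move=> nJ; rewrite /label_prob labS (_ : seqDU _ n = set0) ?measure0//.
  by rewrite -subset0 => x [[]].
have entJ n : pJ Q n -> - ln (label_prob mu (atom_label Q) n.+1) * label_prob mu (atom_label Q) n.+1 = ent (mu (pI Q n)).
  by move=> Jn; rewrite /label_prob labS mu_seqDU// /ent mulNr mulrC.
have p0 : label_prob mu (atom_label Q) 0%N = 0.
  rewrite /label_prob lab0 (_ : mu _ = 0%E)//.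
  have mU2 : measurable (\bigcup_n atoms Q n : set mR).
    by apply: bigcupT_measurable => n; exact: measurable_atoms sys_ipart _.
  apply/eqP; rewrite eq_le measure_ge0 andbT -sys_oatoms.
  rewrite le_measure ?inE//; try by apply: measurableC => //; exact: measurable_bigcup_oatoms.
  apply: subsetC => x [n _ [Jn xo]]; exists n => //; split=> //.
  by have [_ [_ [_ [op _]]]] := sys_ipart.1 n Jn; exact: op.
pose t := [seq n <- map predn [seq c <- s | c != 0%N] | `[< pJ Q n >]].
have ut : uniq t.
  rewrite filter_uniq// map_inj_in_uniq ?filter_uniq// => -[|a] [|b];
    by rewrite ?mem_filter//= => _ _ ->.
have -> : \sum_(c <- s) - ln (label_prob mu (atom_label Q) c) * label_prob mu (atom_label Q) c =
    \sum_(n <- t) ent (mu (pI Q n)).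
  rewrite /t big_filter big_map big_filter_cond [RHS]big_mkcond /= [RHS]big_mkcond /=.
  apply: eq_bigr => -[|n] _ /=; first by rewrite p0 mulr0.
  by case: asboolP => Jn; [exact: entJ|rewrite ent0// mulr0].
rewrite -sumEFin /esum; apply: ereal_sup_ubound => /=.
exists [set` t]; first split; first exact: finite_seq.
  by move=> n /=; rewrite mem_filter => /andP[/asboolP].
by rewrite -fsbig_seq.
Qed.

(** Events read off finitely many letters. They form an algebra relative to [I01], since words of
    lengths [l] and [l'] are both prefixes of the word of length [l + l']. *)
Definition label_sets : set (set mR) :=
  [set A | exists l S, A = I01 `&` W l @^-1` S].

Lemma sys_measurable_word n : measurable_label (W n).
Proof. exact (measurable_label_word sys_measurable_ext sys_measurable_label n). Qed.

Lemma measurable_label_set l S : measurable (I01 `&` W l @^-1` S).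
Proof. by apply: measurableI; [exact: measurable_I01|exact: sys_measurable_word]. Qed.

(** Pulled back atoms differ from cylinders only by preimages of endpoints, which are null; the
    generating property of the partition then reaches every Borel set. *)
Lemma sys_approx (B : set mR) : measurable B -> B `<=` I01 -> approximable mu label_sets B.
Proof.
move=> mB BI.
have appG : <<s I01, gens_all T Q >> `<=` approximable mu label_sets.
  apply: (@approximable_sigma _ mR R mu I01 label_sets (gens_all T Q)).
  - exact: measurable_I01.
  - by move=> _ [l [S ->]]; exact: measurable_label_set.
  - by exists 0%N, set0; rewrite preimage_set0 setI0.
  - move=> _ [l [S ->]]; exists l, (~` S).
    by rewrite preimage_setC setDIr setDv set0U.
  - move=> _ _ [l [S ->]] [l' [S' ->]]; exists (l + l')%N,
      ([set w | S (take l w)] `|` [set w | S' (take l' w)]).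
    rewrite preimage_setU -setIUr; congr (_ `&` (_ `|` _)); apply/seteqP; split=> x;
      by rewrite /preimage /= ?take_word// addnC take_word.
  - move=> _ [j [n [Jn ->]]].
    have mpI : measurable (pI Q n : set mR).
      exact: is_interval_measurable (pI_itv sys_ipart Jn).
    split; first exact (measurable_iterpre sys_preserving j mpI).
    move=> e e0; exists (I01 `&` W j.+1 @^-1` [set w | nth 0%N w j = n.+1]).
      by exists j.+1, [set w | nth 0%N w j = n.+1].
    have -> : I01 `&` W j.+1 @^-1` [set w | nth 0%N w j = n.+1] =
       iterpre T j (seqDU (atoms Q) n).
      rewrite (iterpreE sys_preserving) -labS; congr (_ `&` _).
      by apply/seteqP; split=> x; rewrite /preimage /= nth_word.
    have mS : measurable (seqDU (atoms Q) n : set mR) by exact: measurable_seqDU_atoms sys_ipart _.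
    apply: le_trans (symdiff_prob_iterpre sys_prob01 sys_preserving j mpI mS) _.
    have eI : pI Q n = atoms Q n by apply/seteqP; split=> x //= [].
    rewrite /symdiff_prob /setY eI (_ : seqDU _ _ `\` _ = set0); last first.
      by rewrite -subset0 => x [hx]; case; exact: (@subset_seqDU _ (atoms Q) n) hx.
    rewrite setU0 /prob (sys_ends Jn); first exact: ltW.
    + by apply: measurableD => //; rewrite -eI.
    + exact: seqDU_endpoints sys_ipart _.
have [_ [_ [_ [_ [_ [_ [gen _]]]]]]] := sys.
have [G [sG BG]] := gen B mB BI.
have [mG HG] := appG _ sG; split=> // e e0.
have [D DD GD] := HG e e0; exists D => //.
have mD : measurable D by case: DD => l [S ->]; exact: measurable_label_set.
apply: le_trans (symdiff_prob_triangle mu mB mG mD) _.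
suff -> : symdiff_prob mu B G = 0 by rewrite add0r.
have mBG := measurable_symdiff mB mG.
rewrite /symdiff_prob /prob -(prob_I01 sys_prob01 mBG) (_ : mu _ = 0%E)//.
apply: sys_null.
- by apply: measurableI => //; exact: measurable_I01.
- by move=> x [].
- apply/eqP; rewrite eq_le measure_ge0 andbT -BG le_measure ?inE//.
  by apply: measurableI => //; exact: measurable_I01.
Qed.

(** The mixing condition quantifies over the sigma-algebra generated by the atoms themselves, so
    membership must be exact, not up to null sets. Single words are treated letter by letter; a
    countable union then gives every [S]. *)
Lemma label_set_sigma l S : <<s I01, gens_upto T Q l >> (I01 `&` W l @^-1` S).
Proof.
set G := gens_upto T Q l.
have s0 : <<s I01, G >> set0 by apply: sigma_algebra0; exact: smallest_sigma_algebra.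
have [_ sDD sUU] := smallest_sigma_algebra I01 G.
have sT : <<s I01, G >> I01 by rewrite -[X in _ X]setD0; exact: sDD.
have sU2 A B : <<s I01, G >> A -> <<s I01, G >> B -> <<s I01, G >> (A `|` B).
  move=> sA sB; rewrite -bigcup2E; apply: sUU => -[|[|n]] //.
have sI2 A B : A `<=` I01 -> B `<=` I01 ->
    <<s I01, G >> A -> <<s I01, G >> B -> <<s I01, G >> (A `&` B).
  move=> AI BI sA sB.
  have -> : A `&` B = I01 `\` ((I01 `\` A) `|` (I01 `\` B)).
    apply/seteqP; split=> x; first by move=> [Ax Bx]; split; [exact: AI|case=> -[]].
    move=> [Ix /not_orP[nA nB]]; split; apply: contrapT => h.
      by apply: nA.
    by apply: nB.
  by apply: (sDD); apply: sU2; exact: (sDD).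
have sat j n : (j < l)%N -> <<s I01, G >> (I01 `&` iter j T' @^-1` (atoms Q n)).
  move=> jl; case: (pselect (pJ Q n)) => Jn.
    apply: sub_sigma_algebra; exists j, n; split=> //; split=> //.
    rewrite (iterpreE sys_preserving); congr (_ `&` _).
    by apply/seteqP; split=> x; [case|].
  rewrite (_ : _ `&` _ = set0)//.
  by rewrite -subset0 => x [_ []].
have slab j c : (j < l)%N -> <<s I01, G >> (I01 `&` (atom_label Q \o iter j T') @^-1` [set c]).
  move=> jl; case: c => [|n].
    rewrite comp_preimage lab0.
    have -> : I01 `&` iter j T' @^-1` (~` \bigcup_n atoms Q n) =
       I01 `\` \bigcup_n (I01 `&` iter j T' @^-1` (atoms Q n)).
      apply/seteqP; split=> x [Ix h]; split=> //.
        by move=> [n _ [_ an]]; apply: h; exists n.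
      by move=> [n _ an]; apply: h; exists n.
    by apply: sDD; apply: sUU => n; exact: sat.
  rewrite comp_preimage labS.
  have -> : I01 `&` iter j T' @^-1` (seqDU (atoms Q) n) =
     (I01 `&` iter j T' @^-1` (atoms Q n)) `&` (I01 `\`
       \bigcup_m (if (m < n)%N then I01 `&` iter j T' @^-1` (atoms Q m) else set0)).
    apply/seteqP; split=> x.
      move=> [Ix [an nU]]; split=> //; split=> // -[m _]; case: ifPn => // mn [_ am].
      by apply: nU; rewrite -bigcup_mkord; exists m.
    move=> [[Ix an] [_ nU]]; split=> //; split=> //.
    rewrite -bigcup_mkord => -[m /= mn am]; apply: nU; exists m => //.
    by rewrite mn.
  apply: sI2.
  - by move=> x [].
  - by move=> x [].
  - exact: sat.
  - by apply: sDD; apply: sUU => m; case: ifPn => // _; exact: sat.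
have sw w k : (k <= l)%N -> <<s I01, G >> (I01 `&` W k @^-1` [set w]).
  elim: k w => [|k IH] w kl.
    case: (pselect (w = [::])) => [->|wn].
      rewrite (_ : _ `&` _ = I01)//; apply/seteqP; split=> x; first by case.
      by move=> Ix; split.
    rewrite (_ : _ `&` _ = set0)// -subset0 => x [_ /= h].
    by apply: wn; rewrite -h.
  case/lastP: w => [|w c].
    rewrite (_ : _ `&` _ = set0)// -subset0 => x [_ /= h].
    by have := size_word T' (atom_label Q) k.+1 x; rewrite [word _ _ _ _]h.
  have -> : I01 `&` W k.+1 @^-1` [set rcons w c] =
    (I01 `&` W k @^-1` [set w]) `&` (I01 `&` (atom_label Q \o iter k T') @^-1` [set c]).
    apply/seteqP; split=> x.
      by move=> [Ix]; rewrite /preimage /= -/(W k.+1 x) wordSr => /rcons_inj[-> ->].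
    move=> [[Ix h1] [_ h2]]; split=> //.
    by rewrite /preimage /= -/(W k.+1 x) wordSr h1 -h2.
  apply: sI2.
  - by move=> x [].
  - by move=> x [].
  - by apply: IH; exact: ltnW.
  - exact: slab.
pose F n : set R := if (unpickle n : option (seq nat)) is Some c then
  (if c \in S then I01 `&` W l @^-1` [set c] else set0) else set0.
have sF n : <<s I01, G >> (F n).
  rewrite /F; case: (unpickle n) => [c|]; last exact s0.
  case: ifP => _; last exact s0.
  exact: sw.
have -> : I01 `&` W l @^-1` S = \bigcup_n F n.
  apply/seteqP; split => [x [Ix Sx]|x [n _]].
    by exists (pickle (W l x)) => //; rewrite /F pickleK /= mem_set.
  rewrite /F; case: (unpickle n) => // c; case: (boolP (c \in S)) => // /set_mem Sc.
  by move=> [Ix /= h]; split=> //; rewrite /preimage /= h.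
exact: sUU.
Qed.

(** If [A] is a cylinder of length [l], time [n] leaves a gap [n - l], whose mixing coefficient
    tends to 0; general [A] follow by approximation. *)
Lemma alpha_mixing_tot : alpha_mixing T mu Q ->
  forall A B : set mR, measurable A -> measurable B ->
  (fun n => fine (mu (A `&` iter n T' @^-1` B))) @ \oo --> fine (mu A) * fine (mu B).
Proof.
move=> [al [al0 [alc Hal]]] A B mA mB.
have mI : measurable (I01 : set mR) by exact: measurable_I01.
have mIA : measurable (I01 `&` A) by exact: measurableI.
have mIB : measurable (I01 `&` B) by exact: measurableI.
apply/cvgrPdist_le => e e0.
have e3 : 0 < e / 3 by rewrite divr_gt0.
have [_ /(_ _ e3) [_ [l [S ->]] HA]] := sys_approx mIA (@subIsetl _ _ _).
have mD := measurable_label_set l S; set D := I01 `&` _ in mD HA.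
have /cvgrPdist_le /(_ _ e3)[N _ HN] := alc.
exists (N + l)%N => // n /= Nn.
have Bn : measurable (iter n T' @^-1` B) by exact: measurable_iter_preimage sys_measurable_ext _ _ mB.
have HD : `|fine (mu (D `&` iter n T' @^-1` B)) - fine (mu D) * fine (mu B)| <= e / 3.
  have ln : (l <= n)%N by apply: leq_trans Nn; exact: leq_addl.
  have Nl : (N <= n - l)%N by rewrite leq_subRL// addnC.
  have := HN _ Nl; rewrite /= sub0r normrN => an.
  have := Hal l (n - l)%N D _ (@label_set_sigma l S) mIB (@subIsetl _ _ _).
  rewrite subnK// (prob_I01 sys_prob01 mB).
  have -> : D `&` iterpre T n (I01 `&` B) = D `&` iter n T' @^-1` B.
    rewrite (iterpreE sys_preserving); apply/seteqP; split=> x.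
      by move=> [Dx [_ []]].
    move=> [[Ix Sx] Bx]; split=> //; split=> //; split=> //.
    rewrite (iter_tot sys_preserving)//; exact (iter_I01 sys_preserving n Ix).
  by move=> /le_trans; apply; exact: le_trans (ler_norm _) an.
have AD : symdiff_prob mu A D <= e / 3.
  apply: le_trans HA; rewrite -(add0r (symdiff_prob _ (_ `&` _) _)).
  apply: le_trans (symdiff_prob_triangle mu mA mIA mD) _; rewrite lerD2r.
  rewrite /symdiff_prob /setY (_ : (I01 `&` A) `\` A = set0); last by rewrite -subset0 => x [[]].
  rewrite setU0 /prob (_ : mu _ = 0%E)//; apply/eqP; rewrite eq_le measure_ge0 andbT.
  rewrite -(prob_I01C sys_prob01) le_measure ?inE//.
  - exact: measurableD.
  - exact: measurableC.
  - by move=> x [Ax nI] Ix; apply: nI.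
have h1 : `|fine (mu A) - fine (mu D)| <= e / 3 by apply: le_trans (dist_pr mu mA mD) AD.
have h2 : `|fine (mu (A `&` iter n T' @^-1` B)) - fine (mu (D `&` iter n T' @^-1` B))| <= e / 3.
  apply: le_trans (dist_pr mu (measurableI _ _ mA Bn) (measurableI _ _ mD Bn)) _.
  apply: le_trans (symdiff_prob_setI mu mA mD Bn Bn) _; rewrite symdiff_probxx addr0//.
have B1 : 0 <= fine (mu B) <= 1 by rewrite prob_ge0 prob_le1.
move: h1 h2 HD B1.
move: (fine (mu A)) (fine (mu D)) (fine (mu B)) (fine _) (fine _) => x y z u v.
rewrite !ler_norml => /andP[a1 a2] /andP[b1 b2] /andP[c1 c2] /andP[z0 z1].
apply/andP; split; nra.
Qed.

Lemma strongly_mixing_tot : strongly_mixing T mu ->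
  forall A B : set mR, measurable A -> measurable B ->
  (fun n => fine (mu (A `&` iter n T' @^-1` B))) @ \oo --> fine (mu A) * fine (mu B).
Proof.
move=> sm A B mA mB; have mI : measurable (I01 : set mR) by exact: measurable_I01.
have mIA : measurable (I01 `&` A) by exact: measurableI.
have mIB : measurable (I01 `&` B) by exact: measurableI.
have := sm _ _ mIA (@subIsetl _ _ _) mIB (@subIsetl _ _ _).
rewrite !(prob_I01 sys_prob01)//; apply: cvg_trans; apply: near_eq_cvg; near=> n.
have Bn : measurable (iter n T' @^-1` B) by exact: measurable_iter_preimage sys_measurable_ext _ _ mB.
rewrite -(prob_I01 sys_prob01 (measurableI _ _ mA Bn)) (iterpreE sys_preserving).
congr (fine (mu _)); apply/seteqP; split=> x.
  by move=> [[Ix Ax] [_ [_ Bx]]].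
move=> [Ix [Ax Bx]]; split=> //; split=> //; split=> //.
rewrite (iter_tot sys_preserving)//; exact (iter_I01 sys_preserving n Ix).
Unshelve. all: by end_near. Qed.

End system.

(** * Kolmogorov-Sinai entropy as an entropy rate *)

Section same_fibers.
Context d (Om : measurableType d) (R : realType) (P : probability Om R).

Lemma label_entropy_fibers (C D : Type) (xi : Om -> C) (zeta : Om -> D) :
  (forall x y, xi y = xi x <-> zeta y = zeta x) -> label_entropy P xi = label_entropy P zeta.
Proof.
move=> H; rewrite /label_entropy /mean; apply: eq_integral => x _; congr EFin.
rewrite /info /label_prob; congr (- ln (fine (P _))).
by apply/seteqP; split=> y /= /H.
Qed.

Lemma entropy_rate_fibers (T : Om -> Om) (C D : countType) (xi : Om -> C) (zeta : Om -> D) :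
  (forall x y, xi y = xi x <-> zeta y = zeta x) -> entropy_rate P T xi = entropy_rate P T zeta.
Proof.
move=> H; have E n : word_rentropy P T xi n = word_rentropy P T zeta n.
  rewrite /word_rentropy /word_entropy; congr fine; apply: label_entropy_fibers => x y.
  by split=> h; apply/eq_in_map => j; rewrite mem_iota /= add0n => jn; apply/H;
    [rewrite -(nth_word T xi (xi x) y jn) h nth_word|
     rewrite -(nth_word T zeta (zeta x) y jn) h nth_word].
rewrite /entropy_rate (_ : (fun n => word_rentropy P T xi n.+1 / _) = fun n => word_rentropy P T zeta n.+1 / n.+1%:R)//.
by apply/funext => n; rewrite E.
Qed.

End same_fibers.

Section entropy.
Context (R : realType).
Local Notation mR := (measurableTypeR R).
Variables (T : R -> R) (mu : probability mR R) (Q : ipart R).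
Hypothesis sys : classT T mu Q.
Local Notation T' := (total_ext T).
Hypothesis mixT : forall A B : set mR, measurable A -> measurable B ->
  (fun n => fine (mu (A `&` iter n T' @^-1` B))) @ \oo --> fine (mu A) * fine (mu B).

(** Cells are indexed by functions on ['I_n] and words are lists, but both have the same fibers, on
    which alone entropy depends. The limit exists by the upper bound on information, hence by
    mixing. *)
Lemma hpart_hrate (m : nat) (F : 'I_m -> set R) (zeta : mR -> 'I_m) :
  measurable_label zeta -> (forall x i, I01 x -> F i x <-> zeta x = i) ->
  hpart T mu F = entropy_rate mu T' zeta.
Proof.
move=> mz FE; have mT := sys_measurable_ext sys; have pT := sys_preserving_ext sys.
have E n : Hent (@cell _ T m n F) mu = word_rentropy mu T' zeta n.
  pose om (x : mR) : {ffun 'I_n -> 'I_m} := [ffun j : 'I_n => zeta (iter j T' x)].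
  have omW x y : om y = om x <-> word T' zeta n y = word T' zeta n x.
    split=> [/ffunP h|h].
      apply/eq_in_map => j; rewrite mem_iota add0n /= => jn.
      by have := h (Ordinal jn); rewrite !ffunE.
    apply/ffunP => j; rewrite !ffunE.
    by rewrite -(nth_word T' zeta (zeta x) y (ltn_ord j)) h nth_word.
  have mom : measurable_label om.
    apply: measurable_label_fib => w.
    case: (pselect (exists x, om x = w)) => [[x <-]|nx].
      have -> : om @^-1` [set om x] = word T' zeta n @^-1` [set word T' zeta n x].
        by apply/seteqP; split=> y /= /omW.
      exact (measurable_label_word mT mz n _).
    rewrite (_ : _ @^-1` _ = set0)// -subset0 => x /= h.
    by apply: nx; exists x.
  rewrite /word_rentropy /word_entropy -(label_entropy_fibers mu omW).
  have -> : label_entropy mu om = mean mu ((fun w => - ln (label_prob mu om w)) \o om) by [].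
  rewrite mean_lab_fin//; last by move=> w; rewrite oppr_ge0 ln_le0// label_prob_le1.
  rewrite /= /Hent; apply: eq_bigr => w _.
  have -> : cell T F w = I01 `&` om @^-1` [set w].
    apply/seteqP; split=> x.
      move=> [Ix h]; split=> //; apply/ffunP => j; rewrite ffunE.
      rewrite (iter_tot (sys_preserving sys))//; apply/FE => //.
      exact (iter_I01 (sys_preserving sys) j Ix).
    move=> [Ix /ffunP h]; split=> // j; apply/FE.
      exact (iter_I01 (sys_preserving sys) j Ix).
    by have := h j; rewrite ffunE (iter_tot (sys_preserving sys)).
  by rewrite (prob_I01 (sys_prob01 sys) (mom _)) /ent /label_prob mulNr mulrC.
rewrite /hpart; apply: cvg_lim => //.
under eq_fun => n do rewrite E.
exact: (word_rentropy_cvg mT pT mixT mz (Hw1_fin mT mz (label_entropy_fin mu mz))).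
Qed.

Lemma sys_generator (C : finType) (zeta : mR -> C) (dl : R) : measurable_label zeta -> 0 < dl ->
  exists l (g : seq nat -> C),
    (mu [set x | g (word T' (atom_label Q) l x) <> zeta x] <= dl%:E)%E.
Proof.
move=> mz dl0.
have mI : measurable (I01 : set mR) by exact: measurable_I01.
(* One error set per label in [C], summed at the end; the [+ 1] keeps the denominator positive. *)
pose e := dl / (#|C|%:R + 1).
have e0 : 0 < e by rewrite divr_gt0// ltr_wpDl.
have app (c : C) : exists lS : nat * set (seq nat),
    symdiff_prob mu (I01 `&` zeta @^-1` [set c]) (I01 `&` word T' (atom_label Q) lS.1 @^-1` lS.2) <= e.
  have mzc : measurable (I01 `&` zeta @^-1` [set c]) by apply: measurableI => //; exact: mz.
  have [_ /(_ _ e0) [_ [l [S ->]] h]] := sys_approx sys mzc (@subIsetl _ _ _).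
  by exists (l, S).
have [f Hf] := choice app.
pose l := \max_(c : C) (f c).1.
have fl c : ((f c).1 <= l)%N by exact: leq_bigmax.
exists l.
have mW n : measurable_label (word T' (atom_label Q) n) by exact (sys_measurable_word sys n).
case: (pselect (exists c : C, True)) => [[c0 _]|nC]; last first.
  have x0 : mR := 0; exfalso; apply: nC; by exists (zeta x0).
(* Guess a label whose approximating cylinder contains the word. At points of [I01] outside all
   error sets [X c] exactly the right label qualifies, and the default [c0] is not reached. *)
pose g w := odflt c0 [pick c | `[< (f c).2 (take (f c).1 w) >]].
exists g.
pose X c := (I01 `&` zeta @^-1` [set c]) `+` (I01 `&` word T' (atom_label Q) (f c).1 @^-1` (f c).2).
have mX c : measurable (X c).
  by apply: measurable_symdiff; apply: measurableI => //; [exact: mz|exact: mW].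
have mE : measurable [set x | g (word T' (atom_label Q) l x) <> zeta x].
  exact: (measurable_label_pair (measurable_label_comp g (mW l)) mz (fun p => p.1 <> p.2)).
have mIC : measurable (~` I01 : set mR) by exact: measurableC.
have sub : [set x | g (word T' (atom_label Q) l x) <> zeta x] `<=` ~` I01 `|` \bigcup_(c in [set: C]) X c.
  move=> x /= h; case: (pselect (I01 x)) => Ix; last by left.
  right; apply: contrapT => nX; apply: h.
  have key c : (f c).2 (take (f c).1 (word T' (atom_label Q) l x)) <-> zeta x = c.
    rewrite -(subnKC (fl c)) take_word; split=> h; apply: contrapT => h'; apply: nX;
      exists c => //.
      by right; split; [split|case].
    by left; split; [split|case].
  rewrite /g; case: pickP => [c /asboolP/key-> //|/(_ (zeta x))/asboolP] /=.
  by case; apply/key.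
have mU : measurable (\bigcup_(c in [set: C]) X c).
  by apply: fin_bigcup_measurable => //; exact: finite_finset.
apply: (@le_trans _ _ (mu (~` I01 `|` \bigcup_(c in [set: C]) X c))).
  by rewrite le_measure ?inE//; exact: measurableU.
apply: le_trans (measureU2 _ mIC mU) _.
rewrite [X in (X + _)%E](prob_I01C (sys_prob01 sys)) add0e.
have HX c : (mu (X c) <= e%:E)%E by rewrite (prE mu (mX c)) lee_fin; exact: Hf.
have Xsum (s : seq C) : (mu (\bigcup_(c in [set` s]) X c) <= ((size s)%:R * e)%:E)%E.
  elim: s => [|c s IH].
    rewrite (_ : \bigcup_(_ in _) _ = set0) ?measure0 ?mul0r// -subset0 => x [c].
    by rewrite /= in_nil.
  have mUs : measurable (\bigcup_(c in [set` s]) X c).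
    by apply: fin_bigcup_measurable => //; exact: finite_seq.
  have -> : \bigcup_(c in [set` c :: s]) X c = X c `|` \bigcup_(c in [set` s]) X c.
    apply/seteqP; split=> x.
      move=> [c'] /=; rewrite inE => /orP[/eqP->|cs] Xx; [by left|right; by exists c'].
    move=> [Xx|[c' cs Xx]]; [exists c => //=; by rewrite mem_head|exists c' => //=].
    by rewrite inE cs orbT.
  apply: (le_trans (measureU2 mu (mX c) mUs)).
  rewrite (_ : (size (c :: s))%:R * e = e + (size s)%:R * e); last first.
    by rewrite /= -natr1 mulrDl mul1r addrC.
  rewrite EFinD; apply: leeD => //.
  exact: (HX c).
have -> : \bigcup_(c in [set: C]) X c = \bigcup_(c in [set` enum C]) X c.
  apply/seteqP; split=> x [c _ Xx]; exists c => //=.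
  by rewrite mem_enum.
apply: le_trans (Xsum _) _; rewrite lee_fin -cardE /e mulrCA ler_piMr ?(ltW dl0)//.
by rewrite ler_pdivrMr ?ltr_wpDl// mul1r lerDl.
Qed.

(** A generating partition predicts every finite partition with arbitrarily small error, so none of
    them has a larger rate. *)
Lemma KS_le : (KS_entropy T mu <= (entropy_rate mu T' (atom_label Q))%:E)%E.
Proof.
have mT := sys_measurable_ext sys; have pT := sys_preserving_ext sys.
apply: ub_ereal_sup => _ [m [F [[mF [dF cF]] ->]]]; rewrite lee_fin.
have I0 : I01 (0 : R) by apply/I01P; rewrite lexx ler01.
have [i0 _ _] : (\bigcup_(i in [set: 'I_m]) F i) (0 : R) by rewrite cF.
(* Off [I01] no [F i] holds and the label defaults to [i0], an index that exists because the cells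
   cover the point 0. *)
pose zeta (x : mR) : 'I_m := odflt i0 [pick i | `[< F i x >]].
have FE (x : R) i : I01 x -> F i x <-> zeta x = i.
  move=> Ix; have [j _ Fj] : (\bigcup_(i in [set: 'I_m]) F i) x by rewrite cF.
  have uniqF i1 i2 : F i1 x -> F i2 x -> i1 = i2.
    move=> F1 F2; apply/eqP; apply: contrapT => /negP ne.
    by have := dF _ _ ne; rewrite -subset0 => /(_ x); apply.
  rewrite /zeta; case: pickP => [i1 /asboolP F1|/(_ j)/asboolP//].
  by split=> [Fi|<-//]; exact: uniqF.
have mI : measurable (I01 : set mR) by exact: measurable_I01.
have mz : measurable_label zeta.
  apply: measurable_label_fib => i.
  have -> : zeta @^-1` [set i] = F i `|` (if i == i0 then ~` I01 else set0).
    apply/seteqP; split=> x.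
      move=> zx; case: (pselect (I01 x)) => Ix; first by left; apply/FE.
      right; move: zx; rewrite /= /zeta; case: pickP => [i1 /asboolP F1|_ /= <-].
        by exfalso; apply: Ix; exact: (mF i1).2.
      by rewrite eqxx.
    case=> [Fx|]; first by apply/FE => //; exact: (mF i).2.
    case: eqP => // -> nI; rewrite /= /zeta; case: pickP => // i1 /asboolP F1.
    by exfalso; apply: nI; exact: (mF i1).2.
  apply: measurableU; first exact: (mF i).1.
  by case: ifP => _ //; exact: measurableC.
rewrite (hpart_hrate mz FE).
apply: (generator_rate mT pT mixT (sys_measurable_label sys) (sys_entropy_fin sys) mz) => dl dl0.
exact: sys_generator.
Qed.

(** The partition may be infinite while the supremum runs over finite ones; merging all labels
    [>= M] into one costs at most [e] in the rate. *)
Lemma KS_ge : ((entropy_rate mu T' (atom_label Q))%:E <= KS_entropy T mu)%E.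
Proof.
have mT := sys_measurable_ext sys; have pT := sys_preserving_ext sys.
apply/lee_addgt0Pr => e e0.
have mx := sys_measurable_label sys.
have [M HM] := coarse_rate mT pT mx (sys_entropy_fin sys) e0.
pose zeta (x : mR) : 'I_M.+1 := inord (minn M (atom_label Q x)).
have mz : measurable_label zeta by exact: (measurable_label_comp (fun n => inord (minn M n)) mx).
have hz : entropy_rate mu T' (minn M \o atom_label Q) = entropy_rate mu T' zeta.
  apply: entropy_rate_fibers => x y; rewrite /zeta /=; split=> [->//|].
  by move=> /(congr1 (@nat_of_ord _)); rewrite !inordK// ltnS geq_minl.
have mI : measurable (I01 : set mR) by exact: measurable_I01.
pose F i := I01 `&` zeta @^-1` [set i].
have FE (x : R) i : I01 x -> F i x <-> zeta x = i by move=> Ix; split=> [[]|h]//; split.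
have FP : is_fpart F.
  split; first by move=> i; split; [apply: measurableI => //; exact: mz|move=> x []].
  split.
    move=> i j /eqP ij; rewrite -subset0 => x [[_ /= h1] [_ /= h2]]; exact: (ij (etrans (esym h1) h2)).
  by apply/seteqP; split=> x; [move=> [i _ []]|move=> Ix; exists (zeta x)].
have : ((hpart T mu F)%:E <= KS_entropy T mu)%E.
  by apply: ereal_sup_ubound; exists M.+1, F.
rewrite (hpart_hrate mz FE) -hz => h.
apply: (@le_trans _ _ ((entropy_rate mu T' (minn M \o atom_label Q)) + e)%:E); first by rewrite lee_fin.
by rewrite EFinD leeD2r.
Qed.

Lemma KS_hrate : fine (KS_entropy T mu) = entropy_rate mu T' (atom_label Q).
Proof. by rewrite (_ : KS_entropy T mu = (entropy_rate mu T' (atom_label Q))%:E)//; apply/eqP; rewrite eq_le KS_le KS_ge. Qed.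

End entropy.

(** * Transfer of asymptotics along a density *)

Import HBNNSimple.

Lemma cvg_sum_seq0 (R : realType) (I : Type) (u : I -> nat -> R) (t : seq I) :
  (forall i, u i @ \oo --> (0 : R)) -> (fun n => \sum_(i <- t) u i n) @ \oo --> (0 : R).
Proof.
move=> Hu; elim: t => [|i t IH].
  by rewrite (_ : (fun n => _) = fun=> 0); [exact: cvg_cst|apply/funext => n; rewrite big_nil].
rewrite (_ : (fun n => _) = (fun n => u i n + \sum_(i <- t) u i n)); last first.
  by apply/funext => n; rewrite big_cons.
have := cvgD (Hu i) IH; rewrite addr0; exact.
Qed.

Section transfer.
Context d (Om : measurableType d) (R : realType) (mu nu : probability Om R).
Hypothesis numu : forall A, measurable A -> mu A = 0%E -> nu A = 0%E.

(** Take a simple function below the density of [nu] with integral above [1 - e]. Its deficits on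
    [A] and on the complement are nonnegative and add up to less than [e], so the error is uniform
    in [A]. *)
Lemma density_simple (e : R) : 0 < e -> exists (s : seq R) (G : R -> set Om),
  [/\ forall r, measurable (G r) &
  forall A, measurable A -> `|prob nu A - \sum_(r <- s) r * prob mu (G r `&` A)| <= e].
Proof.
move=> e0.
have dom : nu `<< mu by apply/null_content_dominatesP => A mA A0; exact: numu.
pose f := Radon_Nikodym_SigmaFinite.f nu mu.
have f0 x : (0 <= f x)%E by exact: Radon_Nikodym_SigmaFinite.f_ge0.
have fE A : measurable A -> nu A = (\int[mu]_(x in A) f x)%E.
  by move=> mA; exact: Radon_Nikodym_SigmaFinite.f_integral.
have mf : measurable_fun setT f.
  exact: measurable_int (Radon_Nikodym_SigmaFinite.f_integrable dom).
have [h hf Hh] : exists2 h : {nnsfun Om >-> R}, (forall x, ((h x)%:E <= f x)%E) &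
    ((1 - e)%:E < \int[mu]_x (h x)%:E)%E.
  have : ((1 - e)%:E < \int[mu]_x f x)%E.
    by rewrite -fE// probability_setT lte_fin; lra.
  rewrite ge0_integralTE// => /ereal_sup_gt [_ [h /= hf <-] Hh].
  by exists h => //; rewrite integralT_nnsfun.
pose s : seq R := finmap.enum_fset (fset_set (range h)).
exists s, (fun r => h @^-1` [set r]); split=> [r|A mA]; first exact: measurable_sfunP.
have ins x : h x \in s by rewrite in_fset_set ?inE//; exists x.
have us : uniq s by exact: finmap.fset_uniq.
have s0 r : r \in s -> 0 <= r by rewrite in_fset_set// inE => -[x _ <-].
(* The absolute value changes nothing for values of [h], but makes the summand nonnegative for every
   real [r], as [mean_sum] requires. *)
have hE B x : h x * \1_B x = \sum_(r <- s) `|r| * \1_(h @^-1` [set r] `&` B) x.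
  rewrite (bigD1_seq (h x))//= big1 ?addr0.
    by rewrite ger0_norm ?s0// indicI /= [X in _ * (X * _)]indicE mem_set// mul1r.
  move=> r rx; rewrite indicI /= [X in _ * (X * _)]indicE memNset ?mul0r ?mulr0//=.
  by move=> hr; rewrite hr eqxx in rx.
have mh : measurable_fun setT h by [].
have intB B : measurable B -> mean mu (fun x => h x * \1_B x) =
    (\sum_(r <- s) r * prob mu (h @^-1` [set r] `&` B))%:E.
  move=> mB; rewrite (_ : (fun x => _) = fun x =>
    \sum_(r <- s) `|r| * \1_(h @^-1` [set r] `&` B) x); last by apply/funext => x.
  have mrB r : measurable (h @^-1` [set r] `&` B) by apply: measurableI.
  rewrite mean_sum.
  - rewrite -sumEFin big_seq [RHS]big_seq; apply: eq_bigr => r rs.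
    by rewrite meanZ// mean_indic// ger0_norm ?s0// (prE mu (mrB r)).
  - by move=> r; apply: measurable_funM => //; exact: measurable_indic.
  - by move=> r x; rewrite mulr_ge0// indicE.
have mhB B : measurable B -> measurable_fun setT (fun x => h x * \1_B x).
  by move=> mB; apply: measurable_funM => //; exact: measurable_indic.
have h0 B x : 0 <= h x * \1_B x by rewrite mulr_ge0// indicE.
have leB B : measurable B -> (mean mu (fun x => h x * \1_B x)%R <= nu B)%E.
  move=> mB; rewrite fE// [leRHS]integral_mkcond; apply: ge0_le_integral => //.
  - by move=> x _; rewrite lee_fin.
  - by apply/measurable_EFinP; exact: mhB.
  - by apply/(measurable_restrictT f mB); exact: measurable_funTS.
  - move=> x _; rewrite patchE indicE; case: ifPn => xB; rewrite ?mulr1 ?mulr0//.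
have mCA : measurable (~` A) by exact: measurableC.
have := leB _ mA; have := leB _ mCA.
rewrite !intB// (prE nu mA) (prE nu mCA) !lee_fin => lC lA.
have : ((1 - e)%:E < mean mu (fun x => h x * \1_A x)%R + mean mu (fun x => h x * \1_(~` A) x)%R)%E.
  rewrite -meanD//; [|exact: mhB..].
  rewrite (_ : (fun x => _) = h)//; apply/funext => x; rewrite -mulrDr !indicE in_setC.
  by case: (x \in A); rewrite ?addr0 ?add0r mulr1.
rewrite !intB// -EFinD lte_fin => l1.
have : prob nu A + prob nu (~` A) = 1.
  apply: EFin_inj; rewrite EFinD -(prE nu mA) -(prE nu mCA).
  by rewrite [X in (_ + X)%E]probability_setC// addeC subeK// fin_num_measure.
move: l1 lC lA; rewrite ler_norml.
move: (\sum_(r <- s) _) (\sum_(r <- s) _) (prob nu _) (prob nu _) => a b x y *.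
by apply/andP; split; lra.
Qed.

(** The hypothesis is applied to [B] cut with each level set of a simple density. Comparing with a
    moving event [C n], not with a constant, lets one factor be split off at a time. *)
Lemma transfer_asymptotic (E C : nat -> set Om) (c : R) :
  (forall n, measurable (E n)) -> (forall n, measurable (C n)) ->
  (forall B, measurable B ->
     (fun n => prob mu (B `&` E n) - c * prob mu (B `&` C n)) @ \oo --> 0) ->
  forall B, measurable B ->
     (fun n => prob nu (B `&` E n) - c * prob nu (B `&` C n)) @ \oo --> 0.
Proof.
move=> mE mC H B mB; apply/cvgrPdist_le => e e0.
(* Two approximation errors, [e / K] and [|c| * (e / K)], have to sum to [e / 2]. *)
pose K := 2 * (1 + `|c|).
have K0 : 0 < K by rewrite mulr_gt0// ltr_wpDr.
have [s [G [mG HG]]] := density_simple (divr_gt0 e0 K0).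
have S0 : (fun n => \sum_(r <- s) r *
    (prob mu (G r `&` B `&` E n) - c * prob mu (G r `&` B `&` C n))) @ \oo --> (0 : R).
  apply: cvg_sum_seq0 => r; rewrite -[X in _ --> X](mulr0 r).
  exact: cvgM (cvg_cst r) (H _ (measurableI _ _ (mG r) mB)).
have e2 : 0 < e / 2 by rewrite divr_gt0.
move/cvgrPdist_le : S0 => /(_ _ e2); apply: filterS => n.
rewrite !sub0r !normrN => Sn.
have h1 := HG _ (measurableI _ _ mB (mE n)).
have h2 := HG _ (measurableI _ _ mB (mC n)).
have SE : \sum_(r <- s) r * (prob mu (G r `&` B `&` E n) - c * prob mu (G r `&` B `&` C n)) =
   \sum_(r <- s) r * prob mu (G r `&` (B `&` E n)) -
   c * \sum_(r <- s) r * prob mu (G r `&` (B `&` C n)).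
  rewrite mulr_sumr -sumrB; apply: eq_bigr => r _; rewrite !setIA.
  by rewrite mulrBr mulrCA.
rewrite SE in Sn.
move: Sn h1 h2; set a := prob nu _; set b := prob nu _; set u := \sum_(r <- s) _.
set v := \sum_(r <- s) _ => Sn h1 h2.
rewrite (_ : a - c * b = (u - c * v) + (a - u) - c * (b - v)); last by ring.
apply: le_trans (ler_normB _ _) _; apply: le_trans (lerD (ler_normD _ _) (lexx _)) _.
rewrite normrM; have h3 : `|c| * `|b - v| <= `|c| * (e / K) by rewrite ler_wpM2l.
have h4 : (1 + `|c|) * (e / K) = e / 2.
  by rewrite /K; field; rewrite gt_eqF// ltr_wpDr.
lra.
Qed.

End transfer.

(** * Asymptotic measurability with respect to the past *)

Section comparison.
Context (R : realType).
Local Notation mR := (measurableTypeR R).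
Local Notation lambda := (@lebesgue_measure R).
Implicit Types mu nu : probability mR R.

Lemma sys_compare T T2 mu mu2 (Q Q2 : ipart R) : classT T mu Q -> classT T2 mu2 Q2 ->
  exists2 c : R, 0 < c & forall A : set mR, measurable A -> prob mu A <= c * prob mu2 A.
Proof.
move=> sys sys2.
have [_ [[c [c1 Hc]] _]] := sys; have [_ [[c' [c'1 Hc']] _]] := sys2.
have c0 : 0 < c by exact: lt_le_trans c1.
have c'0 : 0 < c' by exact: lt_le_trans c'1.
exists (c * c'); first exact: mulr_gt0.
move=> A mA.
have mIA : measurable (I01 `&` A) by apply: measurableI => //; exact: measurable_I01.
have [h1 _] := Hc _ mIA (@subIsetl _ _ _); have [_ h2] := Hc' _ mIA (@subIsetl _ _ _).
rewrite (prob_I01 (sys_prob01 sys) mA) in h1; rewrite (prob_I01 (sys_prob01 sys2) mA) in h2.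
have := le_trans h1 h2; rewrite (prE mu mA) (prE mu2 mA) -!EFinM lee_fin.
by rewrite mulrC ler_pdivrMr// mulrC mulrA.
Qed.

Lemma sys_dominates T mu (Q : ipart R) nu : classT T mu Q -> equiv_lebesgue nu ->
  forall A : set mR, measurable A -> mu A = 0%E -> nu A = 0%E.
Proof.
move=> sys [nu01 Hnu] A mA A0.
have mIA : measurable (I01 `&` A) by apply: measurableI => //; exact: measurable_I01.
rewrite -(prob_I01 nu01 mA); apply/Hnu => //.
have [_ [[c [c1 Hc]] _]] := sys; have [_] := Hc _ mIA (@subIsetl _ _ _).
rewrite (prob_I01 (sys_prob01 sys) mA) A0 mule0 => h.
by apply/eqP; rewrite eq_le h measure_ge0.
Qed.

End comparison.

(** * Preimages as counted unions of intervals, and events in the past of a map *)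

Section counted_unions.
Context (R : realType).
Local Notation mR := (measurableTypeR R).
Variables (T : R -> R) (mu : probability mR R) (Q : ipart R).
Hypothesis sys : classT T mu Q.
Local Notation T' := (total_ext T).
Local Notation W n := (word T' (atom_label Q) n).
Local Notation h := (entropy_rate mu T' (atom_label Q)).
Hypothesis mixT : forall A B : set mR, measurable A -> measurable B ->
  (fun n => fine (mu (A `&` iter n T' @^-1` B))) @ \oo --> fine (mu A) * fine (mu B).

Let mT := sys_measurable_ext sys.
Let pT := sys_preserving_ext sys.
Let mx := sys_measurable_label sys.
Let fin1 := Hw1_fin mT mx (sys_entropy_fin sys).
Let mW n : measurable_label (W n) := sys_measurable_word sys n.

(** [A] is approximated by [size t] intervals, independently of [N], and only frequent words are
    kept; each pair of a word and an interval contributes one relative interval. *)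
Lemma preimage_counted (A : set mR) (e eps : R) : measurable A -> 0 < e -> 0 < eps ->
  exists2 K : R, 0 <= K & \forall N \near \oo, exists (s : seq (set R)) (F : set mR),
    [/\ measurable F, forall i, itv_in (regular T Q) (nth set0 s i),
      forall x, F x <-> exists2 i, (i < size s)%N & nth set0 s i x,
      symdiff_prob mu (iterpre T N A) F <= e & (size s)%:R <= K * expR (N%:R * (h + eps))].
Proof.
move=> mA e0 eps0; have e2 : 0 < e / 2 by rewrite divr_gt0.
have [A' FA' AA'] := borel_approx mu mA e2.
have mA' := fin_itv_union_measurable FA'.
have [t [it tE]] := fin_itv_union_seq FA'.
exists (size t)%:R => //.
have := prob_info_upper mT pT mixT mx fin1 eps0 e2; apply: filterS => N HN.
(* At most [1 / g] words reach this probability; the others are null or have information at least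
   [N * (h + eps)]. *)
pose g := expR (- (N%:R * (h + eps))).
have g0 : 0 < g by exact: expR_gt0.
have [gs [gsP gsz]] := frequent_labels mu (mW N) g0.
pose cyl w (J : set R) := [set x | W N x = w /\ J (iter N T' x)].
pose s := [seq cyl w J | w <- gs, J <- t].
pose F : set mR := [set x | W N x \in gs /\ A' (iter N T' x)].
have mF : measurable F.
  rewrite (_ : F = W N @^-1` [set w | w \in gs] `&` iter N T' @^-1` A')//.
  by apply: measurableI; [exact: mW|exact (measurable_iter_preimage mT N mA')].
exists s, F; split=> //.
- move=> i; case: (ltnP i (size s)) => is_; last first.
    by rewrite nth_default// => x y z _ _ _ _ _ [].
  have /allpairsP[[w J] /= [_ Jt ->]] := mem_nth set0 is_.
  have [j jt <-] := nthP set0 Jt.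
  exact: (regular_cells_itv sys).
- move=> x; split.
    move=> [Wx /tE[j jt Jx]].
    have cs : cyl (W N x) (nth set0 t j) \in s.
      by apply/allpairsP; exists (W N x, nth set0 t j); split=> //=; exact: mem_nth.
    by have [i is_ iE] := nthP set0 cs; exists i => //; rewrite iE.
  move=> [i is_]; have /allpairsP[[w J] /= [wg Jt ->]] := mem_nth set0 is_.
  move=> [Wx Jx]; split; first by rewrite Wx.
  by apply/tE; have [j jt jE] := nthP set0 Jt; exists j => //; rewrite jE.
- have mXA := measurable_iterpre (sys_preserving sys) N mA.
  have mXA' := measurable_iterpre (sys_preserving sys) N mA'.
  apply: le_trans (symdiff_prob_triangle mu mXA mXA' mF) _; rewrite (splitr e); apply: lerD.
    apply: le_trans AA'.
    exact: (symdiff_prob_iterpre (sys_prob01 sys) (sys_preserving sys)).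
  have mi := measurable_info mu (mW N).
  have mBig : measurable [set x | N%:R * (h + eps) <= info mu (W N) x].
    exact: (mW N [set w | N%:R * (h + eps) <= - ln (label_prob mu (W N) w)]).
  have mN : measurable (W N @^-1` [set w | label_prob mu (W N) w = 0]) by exact: mW.
  have mIC : measurable (~` I01 : set mR) by apply: measurableC; exact: measurable_I01.
  have sub : iterpre T N A' `+` F `<=` ~` I01 `|`
     (W N @^-1` [set w | label_prob mu (W N) w = 0] `|` [set x | N%:R * (h + eps) <= info mu (W N) x]).
    move=> x; rewrite (iterpreE (sys_preserving sys)).
    case: (pselect (I01 x)) => Ix; last by left.
    case=> [[[_ Ax] nF]|[[_ Ax] nI]]; last by exfalso; apply: nI.
    right; have ng : ~~ (g <= label_prob mu (W N) (W N x)).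
      by apply/negP => /gsP wg; apply: nF.
    rewrite -ltNge in ng; have := label_prob_ge0 mu (W N) (W N x).
    rewrite le_eqVlt => /orP[/eqP p0|p0]; [by left|right].
    rewrite /= /info lerNr; apply: ltW.
    rewrite -ltr_expR lnK ?posrE//.
  apply: le_trans (prob_mono mu (measurable_symdiff mXA' mF) _ sub) _.
    by apply: measurableU => //; exact: measurableU.
  apply: le_trans (prU_le mu mIC (measurableU _ _ mN mBig)) _.
  rewrite [X in X + _](_ : _ = 0) ?add0r; last by rewrite /prob prob_I01C//; exact: sys_prob01 sys.
  apply: le_trans (prU_le mu mN mBig) _.
  rewrite [X in X + _](_ : _ = 0) ?add0r; last by rewrite /prob prl0_null.
  by rewrite -lee_fin -(prE mu mBig).
- rewrite size_allpairs natrM mulrC ler_wpM2l//.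
  by rewrite -ler_pdivlMr// in gsz; rewrite (le_trans gsz)// div1r /g expRN invrK.
Qed.

Variable a : nat -> nat.
Hypothesis a_infty : forall M : nat, \forall n \near \oo, (M <= a n)%N.
Variable eps : R.
Hypothesis eps0 : 0 < eps.

(** [S] may vary with [n]. The gap [m] is arbitrary but fixed as [n] grows, because the mixing rate
    selects it before [n]. *)
Definition past_measurable (X : nat -> set mR) := (forall n, measurable (X n)) /\
  forall (m : nat) (e : R), 0 < e -> \forall n \near \oo, exists S : set (seq nat),
    symdiff_prob mu (X n) (W (a n - m)%N @^-1` S) <= e.

Lemma past_measurableI X Y : past_measurable X -> past_measurable Y ->
  past_measurable (fun n => X n `&` Y n).
Proof.
move=> [mX HX] [mY HY]; split=> [n|m e e0]; first exact: measurableI.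
have e2 : 0 < e / 2 by rewrite divr_gt0.
have := HX m _ e2; have := HY m _ e2; apply: filterS2 => n [S YS] [S' XS].
exists (S' `&` S); rewrite preimage_setI (splitr e).
by apply: le_trans (symdiff_prob_setI mu (mX n) (mW _ _) (mY n) (mW _ _)) _; exact: lerD.
Qed.

(** Outside a small event the cells of length [a n - m] have probability below [beta], so the
    boundary cells of [K * cnt n] intervals cost at most [2 * beta * K * cnt n]. [Z] may be smaller
    than [regular T Q], so that regularity for another map can be imposed too. *)
Lemma past_measurable_counted (X : nat -> set mR) (Z : set mR) (cnt : nat -> R) :
  (forall n, measurable (X n)) -> measurable Z -> mu (~` Z) = 0%E -> Z `<=` regular T Q ->
  (forall n, 0 <= cnt n) ->
  (fun n => cnt n * expR (- ((a n)%:R * (h - eps)))) @ \oo --> 0 ->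
  (forall e : R, 0 < e -> exists2 K : R, 0 <= K & \forall n \near \oo,
    exists (s : seq (set R)) (F : set mR),
    [/\ measurable F, forall i, itv_in Z (nth set0 s i),
      forall x, F x <-> exists2 i, (i < size s)%N & nth set0 s i x,
      symdiff_prob mu (X n) F <= e & (size s)%:R <= K * cnt n]) ->
  past_measurable X.
Proof.
move=> mX mZ Z0 ZZ cnt0 cnt_cvg HX; split=> // m e e0.
have e3 : 0 < e / 3 by rewrite divr_gt0.
have [K K0 HK] := HX _ e3.
have [N0 _ HN0] := prob_info_lower mT pT mixT mx fin1 eps0 e3.
(* The price of the gap: shortening the words by [m] letters multiplies [beta] by this constant. *)
pose v := expR (m%:R * (h - eps)).
have v0 : 0 <= v by exact: expR_ge0.
pose L := 2 * v * K + 1.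
have L0 : 0 < L by rewrite ltr_wpDl// !mulr_ge0.
have e3L : 0 < e / 3 / L by rewrite divr_gt0.
move/cvgrPdist_le : cnt_cvg => /(_ _ e3L) HL.
near=> n.
have na : (N0 + m <= a n)%N by near: n; exact: a_infty.
have ma : (m <= a n)%N by apply: leq_trans na; exact: leq_addl.
have Na : (N0 <= a n - m)%N by rewrite leq_subRL// addnC.
have [s [F [mF cs Fs XF ss]]] : exists (s : seq (set R)) (F : set mR),
    [/\ measurable F, forall i, itv_in Z (nth set0 s i),
      forall x, F x <-> exists2 i, (i < size s)%N & nth set0 s i x,
      symdiff_prob mu (X n) F <= e / 3 & (size s)%:R <= K * cnt n] by near: n; exact: HK.
have cL : `|0 - cnt n * expR (- ((a n)%:R * (h - eps)))| <= e / 3 / L by near: n; exact: HL.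
set N := (a n - m)%N.
pose beta := expR (- (N%:R * (h - eps))).
have b0 : 0 <= beta by exact: expR_ge0.
have cW c : itv_in Z (W N @^-1` [set c]).
  move=> x y z /ZZ Zx /ZZ Zy /ZZ Zz; exact: (regular_cells sys).
have [S HS] := saturation mZ Z0 (mW N) cW b0 mF cs (fun x _ => Fs x).
exists S; apply: le_trans (symdiff_prob_triangle mu (mX n) mF (mW N S)) _.
have -> : e = e / 3 + (e / 3 + e / 3) by field.
apply: lerD => //; apply: le_trans HS _; apply: lerD.
  apply: (@le_trans _ _ (prob mu [set x | info mu (W N) x <= N%:R * (h - eps)])).
    have mBig : measurable [set x | info mu (W N) x <= N%:R * (h - eps)].
      exact: (mW N [set w | - ln (label_prob mu (W N) w) <= N%:R * (h - eps)]).
    apply: prob_mono => //; first exact: mW.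
    move=> x /= bx; rewrite /info lerNl.
    have p0 : 0 < label_prob mu (W N) (W N x) by apply: lt_le_trans bx; exact: expR_gt0.
    by rewrite -ler_expR lnK ?posrE.
  have mBig : measurable [set x | info mu (W N) x <= N%:R * (h - eps)].
    exact: (mW N [set w | - ln (label_prob mu (W N) w) <= N%:R * (h - eps)]).
  by rewrite -lee_fin -(prE mu mBig); exact: HN0.
have -> : beta = expR (- ((a n)%:R * (h - eps))) * v.
  by rewrite /beta -expRD /N natrB//; congr expR; ring.
rewrite sub0r normrN ger0_norm in cL; last by rewrite mulr_ge0// expR_ge0.
move: cL; set u := expR (- _) => cL.
have u0 : 0 <= u by exact: expR_ge0.
apply: (@le_trans _ _ (2 * (u * v) * (K * cnt n))).
  by apply: ler_wpM2l => //; rewrite !mulr_ge0.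
have -> : 2 * (u * v) * (K * cnt n) = (2 * v * K) * (cnt n * u) by ring.
apply: (@le_trans _ _ (L * (cnt n * u))).
  by apply: ler_wpM2r; [rewrite mulr_ge0|rewrite lerDl].
by rewrite mulrC -ler_pdivlMr.
Unshelve. all: by end_near. Qed.

Hypothesis alphaT : alpha_mixing T mu Q.

(** The [m] of the approximation becomes the gap of the mixing condition, taken with coefficient at
    most [e / 3]; the approximation is paid twice, for the joint and for the single event. *)
Lemma past_measurable_mixing (X : nat -> set mR) (A : set mR) :
  past_measurable X -> measurable A -> A `<=` I01 ->
  (fun n => prob mu (X n `&` iterpre T (a n) A) - prob mu A * prob mu (X n)) @ \oo --> 0.
Proof.
move=> [mX HX] mA AI; have [al [al0 [alc Hal]]] := alphaT.
apply/cvgrPdist_le => e e0; have e3 : 0 < e / 3 by rewrite divr_gt0.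
move/cvgrPdist_le : alc => /(_ _ e3) [m _ /(_ m (leqnn m))].
rewrite /= sub0r normrN => alm.
near=> n.
have ma : (m <= a n)%N by near: n; exact: a_infty.
have [S HS] : exists S, symdiff_prob mu (X n) (W (a n - m)%N @^-1` S) <= e / 3.
  by near: n; exact: HX.
have mI : measurable (I01 : set mR) by exact: measurable_I01.
have mD := measurable_label_set sys (a n - m) S; set D := I01 `&` _ in mD.
have mWS : measurable (W (a n - m)%N @^-1` S) by exact: mW.
have XD : symdiff_prob mu (X n) D <= e / 3.
  apply: le_trans HS; rewrite -(addr0 (symdiff_prob _ (X n) (_ @^-1` _))).
  apply: le_trans (symdiff_prob_triangle mu (mX n) mWS mD) _; rewrite lerD2l.
  rewrite /symdiff_prob /setY (_ : D `\` _ = set0); last by rewrite -subset0 => x [[]].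
  rewrite setU0 /prob (_ : mu _ = 0%E)//; apply/eqP; rewrite eq_le measure_ge0 andbT.
  rewrite -(prob_I01C (sys_prob01 sys)) le_measure ?inE//.
  - exact: measurableD.
  - exact: measurableC.
  - by move=> x [Wx nD] Ix; apply: nD.
have mXA := measurable_iterpre (sys_preserving sys) (a n) mA.
have := Hal (a n - m)%N m D A (@label_set_sigma _ _ _ _ sys (a n - m)%N S) mA AI.
rewrite subnKC// -!/(prob _ _) => hal.
have h1 := dist_pr mu (mX n) mD.
have h2 := dist_pr mu (measurableI _ _ (mX n) mXA) (measurableI _ _ mD mXA).
have h3 : symdiff_prob mu (X n `&` iterpre T (a n) A) (D `&` iterpre T (a n) A) <= e / 3.
  by apply: le_trans (symdiff_prob_setI mu (mX n) mD mXA mXA) _; rewrite symdiff_probxx addr0.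
have hal' := le_trans hal (le_trans (ler_norm _) alm).
have h1' := le_trans h1 XD; have h2' := le_trans h2 h3.
have := prob_ge0 mu A; have := prob_le1 mu mA.
rewrite sub0r normrN.
move: hal' h1' h2'; move: (prob mu (X n `&` _)) (prob mu (D `&` _)) (prob mu A) (prob mu D) (prob mu (X n)).
move=> x y p u v; rewrite !ler_norml => /andP[a1 a2] /andP[b1 b2] /andP[c1 c2] p1 p0.
apply/andP; split; nra.
Unshelve. all: by end_near. Qed.

End counted_unions.

(** * Joint mixing *)

Lemma expR_cvg0 (R : realType) (f : nat -> R) : (forall M : R, \forall n \near \oo, M <= f n) ->
  (fun n => expR (- f n)) @ \oo --> (0 : R).
Proof.
move=> Hf; apply/cvgrPdist_le => e e0; apply: filterS (Hf (- ln e)) => n h.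
rewrite sub0r normrN ger0_norm ?expR_ge0//.
by rewrite -[leRHS]lnK ?posrE// ler_expR lerNl.
Qed.

Section past_of_systems.
Context (R : realType).
Local Notation mR := (measurableTypeR R).
Variables (T : R -> R) (mu : probability mR R) (Q : ipart R).
Hypothesis sys : classT T mu Q.
Hypothesis mixT : forall A B : set mR, measurable A -> measurable B ->
  (fun n => fine (mu (A `&` iter n (total_ext T) @^-1` B))) @ \oo --> fine (mu A) * fine (mu B).
Local Notation h := (entropy_rate mu (total_ext T) (atom_label Q)).
Variable a : nat -> nat.
Hypothesis a_infty : forall M : nat, \forall n \near \oo, (M <= a n)%N.
Variable eps : R.
Hypothesis eps0 : 0 < eps.

(** A fixed Borel set is close to a fixed number of intervals, so a constant count suffices and only
    the decay of the cells matters. *)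
Lemma past_measurable_cst (B : set mR) : measurable B ->
  (forall M : R, \forall n \near \oo, M <= (a n)%:R * (h - eps)) ->
  past_measurable T mu Q a (fun=> B).
Proof.
move=> mB growth.
apply: (past_measurable_counted (Z := regular T Q) (cnt := fun=> 1) sys mixT a_infty eps0) => //.
- exact: measurable_regular sys.
- exact: regularC sys.
- rewrite (_ : (fun n => _) = fun n => expR (- ((a n)%:R * (h - eps)))).
    exact: expR_cvg0.
  by apply/funext => n; rewrite mul1r.
- move=> e e0; have [F FF BF] := borel_approx mu mB e0.
  have [t [it tE]] := fin_itv_union_seq FF.
  exists (size t)%:R => //; near=> n; exists t, F; split=> //.
  + exact: fin_itv_union_measurable.
  + move=> i x y z _ _ _ xy yz Fx Fz; apply: (it i _ _ Fx Fz).
    by rewrite !ltW.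
  + by rewrite mulr1.
Unshelve. all: by end_near. Qed.

(** Intervals come from [T2] and cells from [T], so points must be regular for both; the
    approximation error, small for [mu2], is passed to [mu] by comparison through Lebesgue
    measure. *)
Lemma past_measurable_preimage T2 mu2 (Q2 : ipart R) (a2 : nat -> nat) (A : set mR) :
  classT T2 mu2 Q2 ->
  (forall A B : set mR, measurable A -> measurable B ->
    (fun n => fine (mu2 (A `&` iter n (total_ext T2) @^-1` B))) @ \oo --> fine (mu2 A) * fine (mu2 B)) ->
  (forall M : nat, \forall n \near \oo, (M <= a2 n)%N) ->
  measurable A ->
  (forall M : R, \forall n \near \oo, M <= (a n)%:R * (h - eps) -
     (a2 n)%:R * (entropy_rate mu2 (total_ext T2) (atom_label Q2) + eps)) ->
  past_measurable T mu Q a (fun n => iterpre T2 (a2 n) A).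
Proof.
move=> sys2 mixT2 a2_infty mA growth.
have [c c0 Hc] := sys_compare sys sys2.
have mZ2 := measurable_regular sys2; have mZ := measurable_regular sys.
apply: (past_measurable_counted (Z := regular T Q `&` regular T2 Q2)
  (cnt := fun n => expR ((a2 n)%:R * (entropy_rate mu2 (total_ext T2) (atom_label Q2) + eps)))
  sys mixT a_infty eps0).
- by move=> n; exact (measurable_iterpre (sys_preserving sys2) (a2 n) mA).
- exact: measurableI.
- rewrite setCI; have m1 := measurableC mZ; have m2 := measurableC mZ2.
  apply/eqP; rewrite eq_le measure_ge0 andbT.
  apply: (le_trans (measureU2 mu m1 m2)).
  rewrite [X in (X + _)%E](regularC sys) add0e.
  have := Hc _ m2; rewrite [X in _ * X]/prob (regularC sys2) mulr0 => h2.
  by rewrite [leLHS](prE mu m2) lee_fin.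
- by move=> x [].
- by move=> n; exact: expR_ge0.
- rewrite (_ : (fun n => _) = fun n => expR (- ((a n)%:R * (h - eps) -
    (a2 n)%:R * (entropy_rate mu2 (total_ext T2) (atom_label Q2) + eps)))).
    exact: expR_cvg0.
  by apply/funext => n; rewrite -expRD opprB addrC.
- move=> e e0; have ec : 0 < e / c by rewrite divr_gt0.
  have [K K0 [N _ HN]] := preimage_counted sys2 mixT2 mA ec eps0.
  exists K => //; apply: filterS (a2_infty N) => n na.
  have [s [F [mF cs Fs AF ss]]] := HN _ na.
  exists s, F; split=> //.
    by move=> i x y z [_ Zx] [_ Zy] [_ Zz]; exact: cs.
  have mXA := measurable_iterpre (sys_preserving sys2) (a2 n) mA.
  apply: le_trans (Hc _ (measurable_symdiff mXA mF)) _.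
  by rewrite mulrC -ler_pdivlMr.
Qed.

End past_of_systems.

Theorem theorem9p2 (R : realType) (k : nat)
  (mu : nat -> probability (measurableTypeR R) R) (T : nat -> R -> R)
  (P : nat -> ipart R) (a : nat -> nat -> nat) (eps0 : R)
  (nu : probability (measurableTypeR R) R) (B : set R) (A : nat -> set R) :
  (forall i, (i <= k)%N -> classT (T i) (mu i) (P i)) ->
  (forall i, (1 <= i <= k)%N -> alpha_mixing (T i) (mu i) (P i)) ->
  (forall i, (i <= k)%N -> (KS_entropy (T i) (mu i) < +oo)%E) ->
  (forall i, (i <= k)%N -> {homo a i : m n / (m < n)%N}) ->
  0 < eps0 ->
  (forall i, (i < k)%N ->
     (fun n => (a i.+1 n)%:R * (fine (KS_entropy (T i.+1) (mu i.+1)) - eps0)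
               - (a i n)%:R * (fine (KS_entropy (T i) (mu i)) + eps0)) @ \oo --> +oo) ->
  strongly_mixing (T 0%N) (mu 0%N) ->
  equiv_lebesgue nu ->
  borel B -> B `<=` I01 ->
  (forall i, (i <= k)%N -> borel (A i) /\ A i `<=` I01) ->
  (fun n => fine (nu (B `&` \bigcap_(i in [set i | (i <= k)%N]) iterpre (T i) (a i n) (A i))))
    @ \oo --> fine (nu B) * \prod_(i < k.+1) fine (mu i (A i)).
Proof.
move=> sys al KSfin a_mono eps_gt0 growth sm eqnu mB BI HA.
have mix i : (i <= k)%N -> forall C D : set (measurableTypeR R), measurable C -> measurable D ->
    (fun n => fine (mu i (C `&` iter n (total_ext (T i)) @^-1` D))) @ \oo -->
      fine (mu i C) * fine (mu i D).
  case: i => [|i] ik; first exact: (strongly_mixing_tot (sys 0%N ik)).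
  exact: (alpha_mixing_tot (sys i.+1 ik) (al i.+1 ik)).
have a_infty i : (i <= k)%N -> forall M : nat, \forall n \near \oo, (M <= a i n)%N.
  move=> ik M; exists M => // n /= Mn; apply: leq_trans Mn _.
  elim: n => // n IH; apply: leq_ltn_trans IH _; exact: a_mono.
pose h i := entropy_rate (mu i) (total_ext (T i)) (atom_label (P i)).
have hE i : (i <= k)%N -> fine (KS_entropy (T i) (mu i)) = h i.
  by move=> ik; exact: (KS_hrate (sys i ik) (mix i ik)).
have h0 i : (i <= k)%N -> 0 <= h i.
  move=> ik; apply: entropy_rate_ge0; [exact: (sys_measurable_ext (sys i ik))|exact: (sys_measurable_label (sys i ik))].
(* [u] is the exponent of decay of the cells of the [i]-th map, [v] the exponent of growth of the
   number of intervals in its preimages. *)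
pose u i n : R := (a i n)%:R * (h i - eps0).
pose v i n : R := (a i n)%:R * (h i + eps0).
have uv i n : u i n <= v i n by rewrite ler_wpM2l// lerD2l; lra.
have v0 i n : (i <= k)%N -> 0 <= v i n by move=> ik; rewrite mulr_ge0// addr_ge0 ?h0// ltW.
have grow1 j : (j < k)%N -> forall M, \forall n \near \oo, M <= u j.+1 n - v j n.
  move=> jk M; have /cvgryPge/(_ M) := growth j jk.
  by rewrite !hE//; exact: ltnW.
(* All earlier maps have to be dominated, not only the preceding one; the gaps add up since [u <= v]
   at intermediate indices. *)
have grow i j : (i <= j)%N -> (j < k)%N -> forall M, \forall n \near \oo, M <= u j.+1 n - v i n.
  elim: j => [|j IH].
    by rewrite leqn0 => /eqP -> jk M; exact: grow1.
  rewrite leq_eqVlt => /orP[/eqP -> jk M|ij jk M]; first exact: grow1.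
  have := IH ij (ltnW jk) 0; have := grow1 _ jk M; apply: filterS2 => n h1 h2.
  have := uv j.+1 n; lra.
have grow_u j : (j < k)%N -> forall M, \forall n \near \oo, M <= u j.+1 n.
  move=> jk M; have := grow1 _ jk M; apply: filterS => n.
  have := v0 j n (ltnW jk); lra.
pose X i n := iterpre (T i) (a i n) (A i).
have mX i n : (i <= k)%N -> measurable (X i n : set (measurableTypeR R)).
  move=> ik; exact (measurable_iterpre (sys_preserving (sys i ik)) (a i n) (HA i ik).1).
pose C j n := \bigcap_(i in [set i | (i <= j)%N]) X i n.
have CS j n : C j.+1 n = C j n `&` X j.+1 n.
  apply/seteqP; split=> x.
    by move=> Cx; split; [move=> i ij; apply: Cx; exact: leqW|apply: Cx => /=].
  by move=> [Cx Xx] i; rewrite /= leq_eqVlt => /orP[/eqP->//|ij]; exact: Cx.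
have C0 n : C 0%N n = X 0%N n.
  apply/seteqP; split=> x; first by apply.
  by move=> Xx i /=; rewrite leqn0 => /eqP ->.
have mC j n : (j <= k)%N -> measurable (C j n : set (measurableTypeR R)).
  elim: j => [|j IH] jk; first by rewrite C0; exact: mX.
  by rewrite CS; apply: measurableI; [exact: IH (ltnW jk)|exact: mX].
(* Induction on the number of maps, directly for [nu]: the last event is split off, and the
   induction hypothesis evaluates the remaining ones. *)
have main j : (j <= k)%N -> forall D : set (measurableTypeR R), measurable D ->
    (fun n => prob nu (D `&` C j n)) @ \oo --> prob nu D * \prod_(i < j.+1) prob (mu i) (A i).
  elim: j => [|j IH] jk D mD.
    (* In the base case the comparison event is the whole space: mixing of [T 0] under [mu 0] is
       transferred to [nu]. *)
    have tr : forall D : set (measurableTypeR R), measurable D ->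
      (fun n => prob nu (D `&` X 0%N n) - prob (mu 0%N) (A 0%N) * prob nu (D `&` setT)) @ \oo --> 0.
      apply: (transfer_asymptotic (sys_dominates (sys 0%N jk) eqnu)) => //.
        by move=> n; exact: mX.
      move=> D' mD'; rewrite setIT.
      have mA0 := (HA 0%N jk).1.
      apply/cvgrPdist_le => e e0.
      have /cvgrPdist_le /(_ _ e0)[N _ HN] := mix 0%N jk _ _ mD' mA0.
      apply: filterS (a_infty 0%N jk N) => n na.
      rewrite sub0r opprB.
      have -> : prob (mu 0%N) (D' `&` X 0%N n) =
          prob (mu 0%N) (D' `&` iter (a 0%N n) (total_ext (T 0%N)) @^-1` A 0%N).
        rewrite /prob /X (iterpreE (sys_preserving (sys 0%N jk))).
        rewrite setICA prob_I01//; first exact: sys_prob01 (sys 0%N jk).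
        apply: measurableI => //.
        exact (measurable_iter_preimage (sys_measurable_ext (sys 0%N jk)) (a 0%N n) mA0).
      rewrite [X in X - _]mulrC; exact: HN _ na.
    have := tr D mD; rewrite big_ord_recl big_ord0 mulr1 setIT => tr0.
    have -> : (fun n => prob nu (D `&` C 0%N n)) = (fun n =>
      (prob nu (D `&` X 0%N n) - prob (mu 0%N) (A 0%N) * prob nu D) + prob nu D * prob (mu 0%N) (A 0%N)).
      by apply/funext => n; rewrite C0 mulrC subrK.
    rewrite -[X in _ --> X]add0r; apply: cvgD => //; exact: cvg_cst.
  have jk' := ltnW jk.
  have past D' : measurable D' ->
      past_measurable (T j.+1) (mu j.+1) (P j.+1) (a j.+1) (fun n => D' `&` C j n).
    move=> mD'; apply: past_measurableI.
    - exact: sys.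
    - apply: (past_measurable_cst (sys _ jk) (mix _ jk) (a_infty _ jk) eps_gt0 mD').
      exact: grow_u.
    - have pX i : (i <= j)%N ->
        past_measurable (T j.+1) (mu j.+1) (P j.+1) (a j.+1) (X i).
        move=> ij; have ik : (i <= k)%N := leq_trans ij jk'.
        apply: (past_measurable_preimage (sys _ jk) (mix _ jk) (a_infty _ jk) eps_gt0
          (sys _ ik) (mix _ ik) (a_infty _ ik) (HA i ik).1).
        exact: grow.
      have pC i : (i <= j)%N ->
        past_measurable (T j.+1) (mu j.+1) (P j.+1) (a j.+1) (C i).
        elim: i => [|i IHi] ij.
          by rewrite (_ : C 0%N = X 0%N); [exact: pX|apply/funext => n].
        rewrite (_ : C i.+1 = fun n => C i n `&` X i.+1 n); last by apply/funext => n.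
        by apply: past_measurableI; [exact: sys|exact: IHi (ltnW ij)|exact: pX].
      exact: pC.
  have [mA AI] := HA _ jk.
  (* Under [mu j.+1] the last factor decouples; with [C j] as comparison event the difference still
     vanishes under [nu], where the induction hypothesis applies. *)
  have step := transfer_asymptotic (sys_dominates (sys _ jk) eqnu)
    (E := fun n => C j n `&` X j.+1 n) (C := C j) (c := prob (mu j.+1) (A j.+1))
    (fun n => measurableI _ _ (mC j n jk') (mX _ n jk)) (fun n => mC j n jk') _ mD.
  have := step _; rewrite big_ord_recr /= mulrA => st.
  have -> : (fun n => prob nu (D `&` C j.+1 n)) = (fun n =>
    (prob nu (D `&` (C j n `&` X j.+1 n)) - prob (mu j.+1) (A j.+1) * prob nu (D `&` C j n)) +
     prob nu (D `&` C j n) * prob (mu j.+1) (A j.+1)).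
    by apply/funext => n; rewrite CS [prob (mu j.+1) _ * _]mulrC subrK.
  rewrite -[X in _ --> X]add0r; apply: cvgD.
    apply: st => D' mD'.
    rewrite (_ : (fun n => _) = fun n => prob (mu j.+1) ((D' `&` C j n) `&`
      iterpre (T j.+1) (a j.+1 n) (A j.+1)) - prob (mu j.+1) (A j.+1) *
      prob (mu j.+1) (D' `&` C j n)); last by apply/funext => n; rewrite setIA.
    exact: (past_measurable_mixing (sys _ jk) (a_infty _ jk) (al j.+1 jk) (past D' mD') mA AI).
  by apply: cvgM; [exact: IH|exact: cvg_cst].
exact: main.
Qed.
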